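(* Let $N\ge 1$, $0<s<1<p<\infty$, $\frac1p+\frac1{p'}=1$, and let $\Omega\subset\mathbb{R}^N$ be an open set with finite measure. Let $0<\lambda\le\Lambda<\infty$ and $\{a_n\}_{n\in\mathbb{N}}\subset\mathcal{A}_{\lambda,\Lambda}$, and assume that the operators $\mathcal{L}_{a_n}$ $H$-converge to $\mathcal{L}_{a_0}$ for some kernel $a_0\in\mathcal{A}_{\lambda,\frac{\Lambda^{p'}}{\lambda}}$. For $n\ge0$ define $J_n\colon L^p(\Omega)\to(-\infty,\infty]$ by $$J_n(v):=\begin{cases}\displaystyle\frac{1}{2p}\iint_{\mathbb{R}^N\times\mathbb{R}^N}a_n(x,y)\frac{|v(x)-v(y)|^p}{|x-y|^{N+sp}}\,dx\,dy & \text{if } v\in W^{s,p}_0(\Omega),\\ +\infty & \text{otherwise.}\end{cases}$$ Then $J_n$ $\Gamma$-converges to $J_0$ in $L^p(\Omega)$.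
   Context: $W^{s,p}(\mathbb{R}^N)$ is the space of $u\in L^p(\mathbb{R}^N)$ with $[u]_{s,p}:=\left(\iint_{\mathbb{R}^N\times\mathbb{R}^N}\frac{|u(x)-u(y)|^p}{|x-y|^{N+sp}}\,dx\,dy\right)^{1/p}<\infty$, normed by $\|u\|_{s,p}=(\|u\|_{L^p}^p+[u]_{s,p}^p)^{1/p}$. $W^{s,p}_0(\Omega)$ is the closure of $C_c^\infty(\Omega)$ in $W^{s,p}(\mathbb{R}^N)$ (its elements vanish a.e. outside $\Omega$ and are identified with elements of $L^p(\Omega)$); since $|\Omega|<\infty$, $[\cdot]_{s,p}$ is an equivalent norm on it. $W^{-s,p'}(\Omega)$ is the dual of $W^{s,p}_0(\Omega)$. The $(s,p)$-gradient of $u\in W^{s,p}(\mathbb{R}^N)$ is $D_{s,p}u(x,y):=\frac{u(x)-u(y)}{|x-y|^{N/p+s}}$. For positive constants $\alpha,\beta$, $\mathcal{A}_{\alpha,\beta}:=\{a\in L^\infty(\mathbb{R}^N\times\mathbb{R}^N): a(x,y)=a(y,x),\ \alpha\le a(x,y)\le\beta \text{ a.e.}\}$. For such a kernel $a$, the operator $\mathcal{L}_a u(x)=\text{p.v.}\int_{\mathbb{R}^N}a(x,y)\frac{|u(x)-u(y)|^{p-2}(u(x)-u(y))}{|x-y|^{N+sp}}\,dy$ is regarded as an operator from $W^{s,p}_0(\Omega)$ to $W^{-s,p'}(\Omega)$ through $\langle\mathcal{L}_a u,v\rangle=\frac12\iint_{\mathbb{R}^N\times\mathbb{R}^N}a(x,y)\frac{|u(x)-u(y)|^{p-2}(u(x)-u(y))(v(x)-v(y))}{|x-y|^{N+sp}}\,dx\,dy$.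 For $f\in W^{-s,p'}(\Omega)$, the solution of the Dirichlet problem $\mathcal{L}_a u=f$ in $\Omega$, $u=0$ in $\mathbb{R}^N\setminus\Omega$, is the unique $u\in W^{s,p}_0(\Omega)$ with $\langle\mathcal{L}_a u,v\rangle=\langle f,v\rangle$ for all $v\in W^{s,p}_0(\Omega)$. $H$-convergence: for $n\ge0$ let $a_n\in\mathcal{A}_{\lambda_n,\Lambda_n}$ with $0<\lambda_n\le\Lambda_n<\infty$. The sequence $\{\mathcal{L}_{a_n}\}_{n\in\mathbb{N}}$ $H$-converges to $\mathcal{L}_{a_0}$ if for every $f\in W^{-s,p'}(\Omega)$ the solutions $u_n$ of $\mathcal{L}_{a_n}u_n=f$ in $\Omega$, $u_n=0$ in $\mathbb{R}^N\setminus\Omega$ satisfy $u_n\rightharpoonup u_0$ weakly in $W^{s,p}_0(\Omega)$ and $a_n|D_{s,p}u_n|^{p-2}D_{s,p}u_n\rightharpoonup a_0|D_{s,p}u_0|^{p-2}D_{s,p}u_0$ weakly in $L^{p'}(\mathbb{R}^N\times\mathbb{R}^N)$, where $u_0$ is the solution of $\mathcal{L}_{a_0}u_0=f$ in $\Omega$, $u_0=0$ in $\mathbb{R}^N\setminus\Omega$. $\Gamma$-convergence: for a metric space $X$ and $J_n\colon X\to[-\infty,\infty]$, $n\ge0$, $J_n$ $\Gamma$-converges to $J_0$ if (liminf inequality) for every $x\in X$ and every sequence $x_n\to x$ in $X$, $J_0(x)\le\liminf_{n\to\infty}J_n(x_n)$; and (limsup inequality) for every $x\in X$ there is a sequence $y_n\to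 x$ in $X$ with $J_0(x)\ge\limsup_{n\to\infty}J_n(y_n)$. Here $X=L^p(\Omega)$ with its norm metric. *)

(* Defs.v *)
From HB Require Import structures.
From mathcomp Require Import all_boot all_order all_algebra.
From mathcomp Require Import all_classical all_reals all_analysis.
Set Implicit Arguments.
Unset Strict Implicit.
Unset Printing Implicit Defensive.
Import Order.TTheory GRing.Theory Num.Theory.
Import numFieldNormedType.Exports.
Local Open Scope classical_set_scope.
Local Open Scope ring_scope.

Definition measure_rV_display : measure_display.
Proof. exact: default_measure_display. Qed.

Section measurable_rV.
Context {R : realType}.
Variable n : nat.

Let coord (i : 'I_n) (x : 'rV[R]_n) : measurableTypeR R := x ord0 i.

Let rV_set0 : g_sigma_preimage coord set0.
Proof. exact: sigma_algebra0. Qed.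

Let rV_setC A : g_sigma_preimage coord A -> g_sigma_preimage coord (~` A).
Proof. exact: sigma_algebraC. Qed.

Let rV_bigcup (F : (set 'rV[R]_n)^nat) :
  (forall i, g_sigma_preimage coord (F i)) ->
  g_sigma_preimage coord (\bigcup_i (F i)).
Proof. exact: sigma_algebra_bigcup. Qed.

(* The sigma-algebra generated by the coordinates, which is the Borel one. *)
HB.instance Definition _ :=
  @isMeasurable.Build measure_rV_display 'rV[R]_n
    (g_sigma_preimage coord) rV_set0 rV_setC rV_bigcup.

Lemma measurable_rV_coord (i : 'I_n) :
  measurable_fun [set: 'rV[R]_n]
    (fun x : 'rV[R]_n => x ord0 i : measurableTypeR R).
Proof.
move=> _ Y mY; rewrite setTI; apply: sub_sigma_algebra => /=.
rewrite -bigcup_seq/=; exists i => /=; first by rewrite mem_index_enum.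
by exists Y => //; rewrite setTI.
Qed.

Lemma measurable_fun_rVP d (T : measurableType d) (f : T -> 'rV[R]_n) :
  (forall i, measurable_fun [set: T]
     (fun x => f x ord0 i : measurableTypeR R)) ->
  measurable_fun [set: T] f.
Proof.
move=> mf _ A mA.
have sub : g_sigma_preimage (fun i => coord i \o f) `<=` measurable.
  apply: smallest_sub; first exact: sigma_algebra_measurable.
  move=> B; rewrite -bigcup_seq => -[i _ [C mC <-]].
  exact: mf.
apply: sub; rewrite g_sigma_preimage_comp.
by exists A.
Qed.

End measurable_rV.

Section lebesgue_rV.
Context {R : realType}.

Section step.
Variables (n : nat) (m : {sigma_finite_measure set 'rV[R]_n -> \bar R}).

Definition rV_cons (z : measurableTypeR R * 'rV[R]_n) : 'rV[R]_n.+1 :=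
  row_mx (const_mx z.1 : 'rV_1) z.2.

Definition rV_uncons (v : 'rV[R]_n.+1) : measurableTypeR R * 'rV[R]_n :=
  (v ord0 ord0, rsubmx (v : 'rV_(1 + n))).

Lemma rV_consK : cancel rV_cons rV_uncons.
Proof.
move=> [x v]; rewrite /rV_uncons /rV_cons row_mxKr /=; congr pair.
transitivity (row_mx (const_mx x : 'rV[R]_1) v ord0 (lshift n ord0)).
  by congr (row_mx _ _ _ _); exact/val_inj.
by rewrite row_mxEl mxE.
Qed.

Lemma measurable_rV_cons : measurable_fun setT rV_cons.
Proof.
apply: measurable_fun_rVP => i.
case: (split_ordP (i : 'I_(1 + n))) => j ->.
  apply: (eq_measurable_fun fst) => [z _|]; last exact: measurable_fst.
  by apply/esym/(etrans (row_mxEl _ _ _ _)); rewrite mxE.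
apply: (eq_measurable_fun
    (fun z : measurableTypeR R * 'rV[R]_n => z.2 ord0 j : measurableTypeR R)).
  by move=> z _; exact/esym/row_mxEr.
exact: (measurableT_comp (measurable_rV_coord j) measurable_snd).
Qed.

Lemma measurable_rV_uncons : measurable_fun setT rV_uncons.
Proof.
apply/measurable_fun_pairP; split; first exact: measurable_rV_coord.
apply: measurable_fun_rVP => i.
apply: (eq_measurable_fun
  (fun v : 'rV[R]_n.+1 => v ord0 (rshift 1 i) : measurableTypeR R)).
  by move=> v _; rewrite /rV_uncons /= mxE.
exact: measurable_rV_coord.
Qed.

Definition lebesgue_cons : set 'rV[R]_n.+1 -> \bar R :=
  pushforward (@lebesgue_measure R \x m)%E rV_cons.

Let lebesgue_cons0 : lebesgue_cons set0 = 0%E.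
Proof. by rewrite /lebesgue_cons /pushforward preimage_set0 measure0. Qed.

Let lebesgue_cons_ge0 A : (0 <= lebesgue_cons A)%E.
Proof. by rewrite /lebesgue_cons /pushforward; exact: measure_ge0. Qed.

Let lebesgue_cons_sigma_additive : semi_sigma_additive lebesgue_cons.
Proof.
have mf := measurable_rV_cons.
move=> F mF tF mUF; rewrite /lebesgue_cons /pushforward preimage_bigcup.
apply: measure_semi_sigma_additive.
- by move=> k; rewrite -[X in measurable X]setTI; exact: mf.
- apply/trivIsetP => /= i j _ _ ij; rewrite -preimage_setI.
  by move/trivIsetP : tF => /(_ _ _ _ _ ij) ->//; rewrite preimage_set0.
- by rewrite -preimage_bigcup -[X in measurable X]setTI; exact: mf.
Qed.

HB.instance Definition _ := isMeasure.Build _ _ _ lebesgue_cons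
  lebesgue_cons0 lebesgue_cons_ge0 lebesgue_cons_sigma_additive.

Let lebesgue_cons_sigma_finite : sigma_finite setT lebesgue_cons.
Proof.
have /sigma_finiteP[F [TF ndF Foo]] := sigma_finiteT (@lebesgue_measure R).
have /sigma_finiteP[G [TG ndG Goo]] := sigma_finiteT m.
exists (fun k => rV_uncons @^-1` (F k `*` G k)).
  rewrite -preimage_bigcup (_ : \bigcup_k _ = setT) ?preimage_setT//.
  rewrite -setXTT TF TG predeqE => -[x y]; split.
    by move=> [k _ []/= ? ?]; split; exists k.
  move=> [/= [k _ Fkx] [l _ Gly]]; exists (maxn k l) => //; split.
  - by move: x Fkx; exact/subsetPset/ndF/leq_maxl.
  - by move: y Gly; exact/subsetPset/ndG/leq_maxr.
move=> k; have [mF Fk] := Foo k; have [mG Gk] := Goo k; split.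
  rewrite -[X in measurable X]setTI; apply: measurable_rV_uncons => //.
  exact: measurableX.
rewrite /lebesgue_cons /pushforward -comp_preimage.
rewrite (_ : rV_uncons \o rV_cons = id); last exact/funext/rV_consK.
by rewrite preimage_id product_measure1E// lte_mul_pinfty// ge0_fin_numE.
Qed.

HB.instance Definition _ := Measure_isSigmaFinite.Build _ _ _ lebesgue_cons
  lebesgue_cons_sigma_finite.

End step.

Fixpoint lebesgue_rV (n : nat) : {sigma_finite_measure set 'rV[R]_n -> \bar R} :=
  match n with
  | 0 => \d_ (0 : 'rV[R]_0)
  | k.+1 => lebesgue_cons (lebesgue_rV k)
  end.

End lebesgue_rV.

Section function_spaces.
Context {R : realType} {N : nat}.
Implicit Types (u v f : 'rV[R]_N -> R) (Omega : set 'rV[R]_N).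

Definition lebN : {sigma_finite_measure set 'rV[R]_N -> \bar R} :=
  lebesgue_rV N.

Definition lebN2 : {measure set ('rV[R]_N * 'rV[R]_N) -> \bar R} :=
  (lebN \x lebN)%E.

(* The library norm on 'rV[R]_N is the sup norm. *)
Definition enorm (x : 'rV[R]_N) : R := Num.sqrt (\sum_i x ord0 i ^+ 2).

Fixpoint Ck (k : nat) f : Prop :=
  match k with
  | 0 => continuous f
  | j.+1 => continuous f /\
      forall i : 'I_N, (forall x, derivable f x (delta_mx ord0 i)) /\
        Ck j (fun x => 'D_(delta_mx ord0 i) f x)
  end.

Definition Cc_infty Omega : set ('rV[R]_N -> R) :=
  [set f | [/\ forall k, Ck k f, compact (closure [set x | f x != 0]) &
    closure [set x | f x != 0] `<=` Omega]].

Definition gagliardo (s p : R) u : \bar R :=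
  ((\int[lebN2]_z
     (`|u z.1 - u z.2| `^ p / enorm (z.1 - z.2) `^ (N%:R + s * p))%:E)
   `^ p^-1)%E.

Definition Wsp (s p : R) : set ('rV[R]_N -> R) :=
  [set u | u \in Lfun lebN p%:E /\ (gagliardo s p u < +oo)%E].

Definition Wsp_norm (s p : R) u : \bar R :=
  (('N[lebN]_p%:E[EFin \o u] `^ p + gagliardo s p u `^ p) `^ p^-1)%E.

Definition Wsp0 (s p : R) Omega : set ('rV[R]_N -> R) :=
  [set u | Wsp s p u /\ forall e : R, 0 < e ->
    exists2 f, Cc_infty Omega f & (Wsp_norm s p (u \- f)%R < e%:E)%E].

End function_spaces.
Arguments lebN R N : clear implicits.
Arguments lebN2 R N : clear implicits.

(* Spaces of functions modulo a.e. equality are represented by sets [V] of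
   functions with a (semi)norm [nrm]; a bounded functional takes the same value
   on functions at distance 0. *)
Section weak_convergence.
Context {R : realType} {T : Type}.
Variables (V : set (T -> R)) (nrm : (T -> R) -> \bar R).

Definition dual : set ((T -> R) -> R) :=
  [set l | (forall (c : R) u v, V u -> V v ->
              l (fun x => c * u x + v x) = c * l u + l v) /\
           exists C : R, forall u, V u -> (`|l u|%:E <= C%:E * nrm u)%E].

Definition weak_cvg (u_ : nat -> T -> R) (u : T -> R) : Prop :=
  [/\ forall n, V (u_ n), V u &
      forall l, dual l -> l (u_ n) @[n --> \oo] --> l u].

End weak_convergence.

Section nonlocal_operators.
Context {R : realType} {N : nat}.
Variables (s p : R) (Omega : set 'rV[R]_N).
Implicit Types (u v : 'rV[R]_N -> R) (a : 'rV[R]_N * 'rV[R]_N -> R).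

(* |t|^(p-2) t; for t = 0 and p < 2 the library has 0 `^ (p - 2) = 0. *)
Definition signed_pow (t : R) : R := `|t| `^ (p - 2) * t.

Definition kernel_class (alpha beta : R) :
    set ('rV[R]_N * 'rV[R]_N -> R) :=
  [set a | a \in Lfun (lebN2 R N) +oo%E /\
    {ae lebN2 R N, forall z, a z = a (z.2, z.1) /\ alpha <= a z <= beta}].

Definition sp_gradient u (z : 'rV[R]_N * 'rV[R]_N) : R :=
  (u z.1 - u z.2) / enorm (z.1 - z.2) `^ (N%:R / p + s).

Definition flux a u (z : 'rV[R]_N * 'rV[R]_N) : R :=
  a z * signed_pow (sp_gradient u z).

(* The duality pairing <L_a u, v>; by Hoelder the integrand is integrable for u
   and v in W^{s,p}, so the integral is genuinely finite there. *)
Definition La_pairing a u v : R :=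
  2^-1 * \int[lebN2 R N]_z
    (a z * (signed_pow (u z.1 - u z.2) * (v z.1 - v z.2))
       / enorm (z.1 - z.2) `^ (N%:R + s * p)).

Definition Wsp0_dual : set (('rV[R]_N -> R) -> R) :=
  dual (Wsp0 s p Omega) (Wsp_norm s p).

Definition is_solution a (l : ('rV[R]_N -> R) -> R) u : Prop :=
  Wsp0 s p Omega u /\
  forall v, Wsp0 s p Omega v -> La_pairing a u v = l v.

Definition H_cvg (p' : R) (a_ : nat -> 'rV[R]_N * 'rV[R]_N -> R) a0 : Prop :=
  forall l, Wsp0_dual l ->
  forall (u_ : nat -> 'rV[R]_N -> R) u0,
    (forall n, is_solution (a_ n) l (u_ n)) -> is_solution a0 l u0 ->
    weak_cvg (Wsp0 s p Omega) (Wsp_norm s p) u_ u0 /\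
    weak_cvg [set F | F \in Lfun (lebN2 R N) p'%:E]
      (fun F => 'N[lebN2 R N]_p'%:E[EFin \o F]%E)
      (fun n => flux (a_ n) (u_ n)) (flux a0 u0).

(* Elements of L^p(Omega) are represented by functions on the whole space whose
   values outside Omega are ignored, and identified with their extension by 0. *)
Definition zero_ext v : 'rV[R]_N -> R := patch (cst 0) Omega v.

Definition LpOmega : set ('rV[R]_N -> R) :=
  [set v | zero_ext v \in Lfun (lebN R N) p%:E].

Definition LpOmega_dist u v : \bar R :=
  'N[lebN R N]_p%:E[EFin \o zero_ext (u \- v)%R]%E.

Definition energy a v : \bar R :=
  if `[< Wsp0 s p Omega (zero_ext v) >] then
    ((2 * p)^-1%:E * \int[lebN2 R N]_z
      (a z * `|zero_ext v z.1 - zero_ext v z.2| `^ p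
         / enorm (z.1 - z.2) `^ (N%:R + s * p))%:E)%E
  else +oo%E.

End nonlocal_operators.

Section Gamma_convergence.
Context {R : realType} {T : Type}.
Variables (X : set T) (dist : T -> T -> \bar R).

Definition dist_cvg (x_ : nat -> T) (x : T) : Prop :=
  (forall n, X (x_ n)) /\ dist (x_ n) x @[n --> \oo] --> 0%E.

Definition Gamma_cvg (J_ : nat -> T -> \bar R) (J0 : T -> \bar R) : Prop :=
  (forall x, X x -> forall x_, dist_cvg x_ x ->
     (J0 x <= limn_einf (fun n => J_ n (x_ n)))%E) /\
  (forall x, X x -> exists y_, dist_cvg y_ x /\
     (limn_esup (fun n => J_ n (y_ n)) <= J0 x)%E).

End Gamma_convergence.

(* Main.v *)
(* Gamma-limsup: given v in W_0^{s,p}, the functional l = L_{a_0} v is in the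
   dual; let u_n solve L_{a_n} u_n = l.  H-convergence gives u_n -> v weakly,
   and testing the equations with their own solutions,
   J_n(u_n) = l(u_n)/p -> l(v)/p = J_0(v).  As |Omega| is finite, weak
   convergence is strong in L^p: averages over small boxes converge pointwise,
   and [u]_{s,p} controls the distance of u to them.
   Gamma-liminf: if v_n -> v in L^p with bounded energies, convexity gives
   J_n(v_n) >= J_n(u_n) + l(v_n) - l(u_n), and l(v_n) -> l(v) because v_n
   converges weakly.  Weak compactness is replaced by uniform convexity of
   t |-> |t|^p: minimizing the seminorm over the midpoint-convex sets
   {w in K : |w - v|_p small} yields a Cauchy sequence converging to v in
   W_0^{s,p} (a Mazur argument); the same Cauchy argument provides the
   solutions u_n by minimization. *)

Require Import Defs.
From HB Require Import structures.
From mathcomp Require Import all_boot all_order all_algebra.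
From mathcomp Require Import all_classical all_reals all_analysis.
From mathcomp Require Import measurable_realfun ring lra.
Set Implicit Arguments.
Unset Strict Implicit.
Unset Printing Implicit Defensive.
Import Order.TTheory GRing.Theory Num.Theory.
Import numFieldNormedType.Exports.
Local Open Scope classical_set_scope.
Local Open Scope ring_scope.

(** [Omega] may be unbounded, so pointwise convergence of the box averages does not by itself give
    convergence of their L^p norms. The set [crowded r] removes this obstacle: it has finite
    measure, so dominated convergence applies on it, while around any other point at least half of
    the box consists of zeros of the function, and the oscillation alone controls the value. For a
    large radius no point is crowded, and the same inequality becomes the Poincare inequality.
    Uniform convexity enters as |x - y|^p <= eps (|x|^p + |y|^p) + C times the midpoint gap, valid
    for all p > 1 at once and stable under integration against a nonnegative weight. This is why the
    estimates are phrased with p-th powers ([pmod], [wmod], [smod]) rather than norms. The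
    tangent-line inequality for the energy supplies lower semicontinuity in the minimization,
    Minty's passage from minimizer to equation, and the liminf estimate. The liminf inequality is
    proved by contradiction: Mazur's argument is applied once to W_0^{s,p} and once to a half-space
    of it, so that no subsequence has to be extracted. *)

(** * Pointwise inequalities for |t|^p *)

Section power_inequalities.
Context {R : realType}.
Variable p : R.
Hypothesis p1 : 1 < p.
Implicit Types x y m t : R.

Let p0 : 0 < p. Proof. exact: lt_trans p1. Qed.

Lemma signed_powM x : signed_pow p x * x = `|x| `^ p.
Proof.
rewrite /signed_pow -mulrA -expr2 -real_normK ?num_real//.
have [->|x0] := eqVneq x 0.
  by rewrite normr0 expr0n/= mulr0 powR0// gt_eqF.
by rewrite -powR_mulrn// -powRD ?subrK// normr_eq0 x0 implybT.
Qed.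

Lemma norm_signed_pow x : `|signed_pow p x| = `|x| `^ (p - 1).
Proof.
rewrite /signed_pow normrM ger0_norm ?powR_ge0//.
have [->|x0] := eqVneq x 0.
  by rewrite normr0 mulr0 powR0// subr_eq0 gt_eqF.
rewrite -[X in _ * X]powRr1// -powRD ?normr_eq0 ?x0 ?implybT//.
by congr (_ `^ _); ring.
Qed.

(** Young's inequality with exponents p/(p-1) and p, the first factor being |x|^(p-1). *)
Lemma signed_pow_young x y :
  `|signed_pow p x * y| <= (1 - p^-1) * `|x| `^ p + p^-1 * `|y| `^ p.
Proof.
rewrite normrM norm_signed_pow.
have q0 : 0 < 1 - p^-1 by rewrite subr_gt0 invf_lt1.
apply: le_trans (@conjugate_powR _ _ _ (1 - p^-1)^-1 p _ _ _ _ _) _ => //.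
- by rewrite invr_gt0.
- by rewrite invrK subrK.
- rewrite -powRrM invrK mulrC [_ / p]mulrC lerD2r.
  rewrite (_ : (p - 1) * _ = p)//; field.
  by rewrite subr_eq0 !gt_eqF.
Qed.

(** Convexity of |t|^p as a tangent-line bound at [m]. It is Young's inequality for the product of
    [signed_pow p m] and [x], multiplied by [p], so no derivative is taken. *)
Lemma powR_tangent m x :
  `|m| `^ p + p * (signed_pow p m * (x - m)) <= `|x| `^ p.
Proof.
have h := le_trans (ler_norm _) (signed_pow_young m x).
have := ler_wpM2l (ltW p0) h; rewrite mulrBr signed_powM.
rewrite (_ : p * (_ + _) = (p - 1) * `|m| `^ p + `|x| `^ p); last first.
  by field; rewrite gt_eqF.
by lra.
Qed.

Lemma norm_signed_powM_le x y :
  `|signed_pow p x * y| <= `|x| `^ p + `|y| `^ p.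
Proof.
apply: le_trans (signed_pow_young x y) _.
have x0 : 0 <= `|x| `^ p by exact: powR_ge0.
have y0 : 0 <= `|y| `^ p by exact: powR_ge0.
have pi0 : 0 < p^-1 by rewrite invr_gt0.
have pi1 : p^-1 < 1 by rewrite invf_lt1.
by apply: lerD; [rewrite ler_piMl//; lra|rewrite ler_piMl//; lra].
Qed.

Lemma powR_normD_le x y : `|x + y| `^ p <= 2 `^ p * (`|x| `^ p + `|y| `^ p).
Proof.
wlog xy : x y / `|x| <= `|y|.
  move=> h; case: (leP `|x| `|y|) => [|/ltW] xy; first exact: h.
  by rewrite addrC [X in _ * X]addrC; exact: h.
apply: (@le_trans _ _ ((2 * `|y|) `^ p)).
  apply: ge0_ler_powR; rewrite ?nnegrE ?(ltW p0)//.
  by rewrite (le_trans (ler_normD _ _))//; lra.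
by rewrite powRM// ler_wpM2l ?powR_ge0// lerDr powR_ge0.
Qed.

Lemma powR_normB_le x y : `|x - y| `^ p <= 2 `^ p * (`|x| `^ p + `|y| `^ p).
Proof. by rewrite -[`|y|]normrN; exact: powR_normD_le. Qed.

(* Normalising the larger of the two to be 1, this compares both sides at
   [(1, t)]: the gap below decreases to its only zero at [t = 1]. *)
Lemma powR_midpoint_gap (eta : R) : 0 < eta -> eta < 1 ->
  exists2 delta : R, 0 < delta & forall t, `|t| <= 1 -> t <= 1 - eta ->
    delta <= (1 + `|t| `^ p) / 2 - `|(1 + t) / 2| `^ p.
Proof.
move=> eta0 eta1.
pose f t : R := (1 + t `^ p) / 2 - ((1 + t) / 2) `^ p.
have f1 : f 1 = 0.
  by rewrite /f powR1 (_ : (1 + 1) / 2 = 1) ?powR1 ?subrr//; field.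
have dmid t : 0 < t -> is_derive t 1 (fun t => ((1 + t) / 2) `^ p)
    (p * ((1 + t) / 2) `^ (p - 1) / 2).
  move=> t0.
  have h0 : 0 < (1 + t) / 2 by rewrite divr_gt0//; lra.
  have h1 : is_derive t 1 (fun t : R => (1 + t) / 2) 2^-1.
    apply: is_derive_eq.
    by rewrite !scaler0 !add0r /GRing.scale/= mulr1.
  have := @is_derive1_comp R (fun t : R => t `^ p) (fun t : R => (1 + t) / 2) _ _ _
    (is_derive1_powR p h0) h1.
  by rewrite mulrC.
have df t : 0 < t -> is_derive t 1 f
    (p * (t `^ (p - 1) - ((1 + t) / 2) `^ (p - 1)) / 2).
  move=> t0; have h1 := is_derive1_powR p t0; have h2 := dmid _ t0.
  rewrite /f; apply: is_derive_eq.
  rewrite !scaler0 !add0r /GRing.scale /=; ring.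
have decr a b : 0 < a -> a < b -> b <= 1 -> f b < f a.
  move=> a0 ab b1.
  apply: (@ltr0_derive1_lt_cc _ f a b); rewrite ?in_itv/= ?lexx ?(ltW ab)//.
  - move=> x; rewrite in_itv/= => /andP[ax xb].
    by have [] := df x (lt_trans a0 ax).
  - move=> x; rewrite in_itv/= => /andP[ax xb]; have x0 := lt_trans a0 ax.
    have [_] := df x x0; rewrite -derive1E => ->.
    rewrite pmulr_llt0// pmulr_rlt0// subr_lt0.
    apply: gt0_ltr_powR; rewrite ?nnegrE ?subr_gt0//; lra.
  - apply: derivable_within_continuous => x; rewrite in_itv/= => /andP[ax xb].
    by have [] := df x (lt_le_trans a0 ax).
have h2 : 2^-1 `^ p < 2^-1 :> R.
  have h0 : 0 <= 2^-1 :> R by rewrite invr_ge0.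
  rewrite -mulr_powRB1// gtr_pMr ?invr_gt0//.
  have e1 : 1 `^ (p - 1) = 1 :> R by rewrite powR1.
  rewrite -[X in _ < X]e1.
  apply: gt0_ltr_powR; rewrite ?subr_gt0 ?nnegrE//.
  by rewrite invf_lt1// ltr1n.
(* The first entry serves 0 < t <= 1 - eta, where the gap is monotone. The second serves -1 <= t <=
   0, where |1 + t|/2 <= 1/2 while the mean of the powers is at least 1/2. *)
exists (Num.min (f (1 - eta)) (2^-1 - 2^-1 `^ p)).
  rewrite lt_min; apply/andP; split; last by rewrite subr_gt0.
  rewrite -f1; apply: decr; lra.
move=> t t1 te; rewrite ge_min.
have [t0|t0] := ltP 0 t.
  apply/orP; left; rewrite !ger0_norm; [|lra|lra].
  have [->//|tne] := eqVneq t (1 - eta).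
  by apply/ltW/decr => //; [rewrite lt_neqAle tne|lra].
apply/orP; right; apply: lerB.
  by rewrite mulrDl mul1r lerDl divr_ge0// powR_ge0.
apply: ge0_ler_powR; rewrite ?nnegrE ?(ltW p0)//.
move: t1; rewrite !ler_norml => /andP[? ?]; apply/andP; split; lra.
Qed.

(** By symmetry and homogeneity only the pairs (1, t) with |t| <= 1 matter. Near t = 1 the left side
    is at most [eps]; elsewhere the midpoint gap is at least some [delta] > 0, and a large [C] makes
    it exceed the bounded left side. Clarkson's inequalities would require separating p < 2 from p
    >= 2. *)
Lemma powR_uniform_convexity (eps : R) : 0 < eps ->
  exists2 C : R, 0 <= C & forall x y, `|x - y| `^ p <=
    eps * (`|x| `^ p + `|y| `^ p) +
    C * ((`|x| `^ p + `|y| `^ p) / 2 - `|(x + y) / 2| `^ p).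
Proof.
move=> eps0.
(* For t > 1 - eta this gives |1 - t|^p <= eta^p <= eps; the cap 1/2 keeps [eta] below 1. *)
pose eta := Num.min 2^-1 (eps `^ p^-1).
have eta0 : 0 < eta by rewrite lt_min invr_gt0 ltr0n/= powR_gt0.
have eta1 : eta < 1 by rewrite gt_min invf_lt1// ltr1n.
have etap : eta `^ p <= eps.
  rewrite -[leRHS]powRr1 ?(ltW eps0)// -(@mulVf _ p) ?gt_eqF//.
  rewrite powRrM; apply: ge0_ler_powR; rewrite ?nnegrE ?powR_ge0 ?(ltW p0)//.
    exact: ltW.
  by rewrite ge_min lexx orbT.
have [delta delta0 hdelta] := powR_midpoint_gap eta0 eta1.
(* The numerator bounds |1 - t|^p over |t| <= 1. *)
exists (2 `^ p * 2 / delta); first by rewrite divr_ge0 ?mulr_ge0 ?powR_ge0 ?ltW.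
move=> x y; wlog xy : x y / `|y| <= `|x|.
  move=> h; case: (leP `|y| `|x|) => [|/ltW] xy; first exact: h.
  by have := h _ _ xy; rewrite distrC [`|y| `^ p + _]addrC [y + x]addrC.
have [x00|x0] := eqVneq x 0.
  have -> : y = 0 by apply/eqP; rewrite -normr_le0 (le_trans xy)// x00 normr0.
  rewrite x00 !(addr0, subr0, mul0r, normr0) powR0 ?gt_eqF//; lra.
have ax0 : 0 < `|x| by rewrite normr_gt0.
have [t yE] : exists t, y = t * x by exists (y / x); rewrite mulfVK.
have t1 : `|t| <= 1 by move: xy; rewrite yE normrM ger_pMl.
have -> : x - y = (1 - t) * x by rewrite yE; ring.
have -> : (x + y) / 2 = (1 + t) / 2 * x by rewrite yE; ring.
rewrite yE; set h := (1 + t) / 2; rewrite !(normrM _ x) !powRM//.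
set X := `|x| `^ p; have X0 : 0 <= X by exact: powR_ge0.
set G := _ / 2 - _; have -> : G = ((1 + `|t| `^ p) / 2 - `|h| `^ p) * X.
  by rewrite /G; ring.
set g := (1 + `|t| `^ p) / 2 - `|h| `^ p => {G}.
rewrite mulrA -[X in _ <= _ * (X + _) + _]mul1r -mulrDl mulrA -mulrDl.
apply: ler_wpM2r => //.
have T0 : 0 <= `|t| `^ p by exact: powR_ge0.
have [te|te] := leP t (1 - eta).
  have := hdelta _ t1 te; rewrite -/h -/g => dg.
  have : `|1 - t| `^ p <= 2 `^ p * 2.
    apply: le_trans (powR_normB_le _ _) _; rewrite normr1 powR1.
    apply: ler_wpM2l; first exact: powR_ge0.
    have : `|t| `^ p <= 1 `^ p by apply: ge0_ler_powR; rewrite ?nnegrE ?(ltW p0).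
    by rewrite powR1; lra.
  move=> /le_trans; apply.
  have : 2 `^ p * 2 <= 2 `^ p * 2 / delta * g.
    rewrite -[leLHS](@mulfVK _ delta) ?gt_eqF//; apply: ler_wpM2l => //.
    by rewrite divr_ge0 ?mulr_ge0 ?powR_ge0 ?ltW.
  have : 0 <= eps * (1 + `|t| `^ p) by rewrite mulr_ge0 ?addr_ge0// ltW.
  lra.
have g0 : 0 <= g.
  have := powR_tangent ((1 + t) / 2) 1; have := powR_tangent ((1 + t) / 2) t.
  rewrite /g /h normr1 powR1.
  have -> : t - (1 + t) / 2 = - (1 - (1 + t) / 2) by field.
  rewrite mulrN mulrN; lra.
have : `|1 - t| `^ p <= eps.
  apply: le_trans etap; apply: ge0_ler_powR; rewrite ?nnegrE ?(ltW p0) ?(ltW eta0)//.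
  move: t1; rewrite !ler_norml => /andP[? ?]; apply/andP; split; lra.
move=> /le_trans; apply.
have : 0 <= 2 `^ p * 2 / delta * g.
  by rewrite mulr_ge0// divr_ge0 ?mulr_ge0 ?powR_ge0 ?ltW.
have : eps * 1 <= eps * (1 + `|t| `^ p) by rewrite ler_pM2l// lerDl.
lra.
Qed.

(** The point 0 is treated apart: for p < 2 the factor |t|^(p-2) blows up there, but the product has
    absolute value |t|^(p-1), which tends to 0. *)
Lemma continuous_signed_pow : continuous (signed_pow p : R -> R).
Proof.
move=> x; have [->|x0] := eqVneq x 0.
  have h0 : signed_pow p 0 = 0 :> R by rewrite /signed_pow mulr0.
  apply/cvgrPdist_lt => e e0; rewrite h0.
  near=> y; rewrite sub0r normrN norm_signed_pow.
  have : `|y| < e `^ (p - 1)^-1.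
    near: y; exists (e `^ (p - 1)^-1) => /=; first exact: powR_gt0.
    by move=> z /=; rewrite sub0r normrN.
  have pm : 0 < p - 1 by rewrite subr_gt0.
  move=> /(gt0_ltr_powR pm); rewrite -powRrM mulVf ?gt_eqF// powRr1 ?ltW//.
  by apply; rewrite nnegrE ?powR_ge0.
have nx0 : 0 < `|x| by rewrite normr_gt0.
have -> : signed_pow p = (fun t : R => `|t| `^ (p - 2) * t) by [].
apply: (@cvgM _ _ (nbhs x) _ (fun t : R => `|t| `^ (p - 2)) id); last exact: cvg_id.
have [h _] := is_derive1_powR (p - 2) nx0.
have cp : {for `|x|, continuous (fun t : R => t `^ (p - 2))}.
  exact/differentiable_continuous/derivable1_diffP.
exact: (cvg_comp _ _ (@norm_continuous _ R^o x) cp).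
Unshelve. all: by end_near. Qed.

Lemma continuous_powR_norm : continuous (fun t : R => `|t| `^ p).
Proof.
have -> : (fun t => `|t| `^ p) = (fun t => signed_pow p t * t) :> (R -> R).
  by apply/funext => t; rewrite signed_powM.
by move=> x; apply: cvgM; [exact: continuous_signed_pow|exact: cvg_id].
Qed.

Lemma measurable_signed_pow : measurable_fun setT (signed_pow p : R -> R).
Proof.
apply: measurable_funM; last exact: measurable_id.
apply: (measurableT_comp (measurable_powR _)); exact: normr_measurable.
Qed.

End power_inequalities.

(** * Modulars (p-th powers of L^p norms): convexity, Fatou, a.e. convergence *)

HB.lock Definition wmod {R : realType} {d} {T : measurableType d}
    (mu : {measure set T -> \bar R}) (p : R) (a f : T -> R) : R :=
  \int[mu]_x (a x * `|f x| `^ p).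

HB.lock Definition pmod {R : realType} {d} {T : measurableType d}
    (mu : {measure set T -> \bar R}) (p : R) (f : T -> R) : R :=
  \int[mu]_x (`|f x| `^ p).

Section modulars.
Context {R : realType} d (T : measurableType d) (mu : {measure set T -> \bar R}).
Variable p : R.
Hypothesis p1 : 1 < p.
Implicit Types (f g h a : T -> R) (c : R).

Let p0 : 0 < p. Proof. exact: lt_trans p1. Qed.

Definition Lp f := measurable_fun setT f /\
  mu.-integrable setT (EFin \o (fun x => `|f x| `^ p)).

Local Notation wmod := (@wmod R d T mu p).
Local Notation pmod := (@pmod R d T mu p).

Lemma wmod_def a f : wmod a f = \int[mu]_x (a x * `|f x| `^ p).
Proof. by rewrite wmod.unlock. Qed.

Lemma pmod_def f : pmod f = \int[mu]_x (`|f x| `^ p).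
Proof. by rewrite pmod.unlock. Qed.

(** The bounds hold everywhere, not almost everywhere, so that pointwise inequalities can be
    integrated directly; [clamp] below brings kernels to this form. *)
Definition weight (lo hi : R) a :=
  measurable_fun setT a /\ forall x, lo <= a x <= hi.

Lemma measurable_powR_norm f : measurable_fun setT f ->
  measurable_fun setT (fun x => `|f x| `^ p).
Proof.
move=> mf; apply: (measurableT_comp (measurable_powR _)).
exact: (measurableT_comp (@normr_measurable _ setT)).
Qed.

Lemma integrable_le f g : measurable_fun setT f ->
  mu.-integrable setT (EFin \o g) -> (forall x, `|f x| <= g x) ->
  mu.-integrable setT (EFin \o f).
Proof.
move=> mf ig fg; apply: le_integrable ig => //; first exact/measurable_EFinP.
move=> x _ /=; rewrite lee_fin; apply: le_trans (fg x) _; exact: ler_norm.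
Qed.

Lemma integrable_EFinD f g : mu.-integrable setT (EFin \o f) ->
  mu.-integrable setT (EFin \o g) ->
  mu.-integrable setT (EFin \o (fun x => f x + g x)).
Proof. by move=> h1 h2; have := integrableD measurableT h1 h2. Qed.

Lemma integrable_EFinZ c f : mu.-integrable setT (EFin \o f) ->
  mu.-integrable setT (EFin \o (fun x => c * f x)).
Proof. by move=> h1; have := integrableZl measurableT c h1. Qed.

Lemma pmod_ge0 f : 0 <= pmod f.
Proof. by rewrite pmod_def; apply: Rintegral_ge0 => x _; exact: powR_ge0. Qed.

Lemma Lp_lincomb c f g : Lp f -> Lp g -> Lp (fun x => c * f x + g x).
Proof.
move=> [mf lf] [mg lg].
have mh : measurable_fun setT (fun x => c * f x + g x).
  by apply: measurable_funD => //; apply: measurable_funM.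
split=> //; apply: (@integrable_le _
    (fun x => 2 `^ p * (`|c| `^ p * `|f x| `^ p + `|g x| `^ p))).
- exact: measurable_powR_norm.
- apply: integrable_EFinZ; apply: integrable_EFinD => //.
  exact: integrable_EFinZ.
- move=> x; rewrite ger0_norm ?powR_ge0//.
  by apply: le_trans (powR_normD_le p1 _ _) _; rewrite normrM powRM.
Qed.

Lemma LpD f g : Lp f -> Lp g -> Lp (fun x => f x + g x).
Proof.
move=> lf lg; have := Lp_lincomb 1 lf lg.
by congr Lp; apply/funext => x; rewrite mul1r.
Qed.

Lemma LpB f g : Lp f -> Lp g -> Lp (fun x => f x - g x).
Proof.
move=> lf lg; have := Lp_lincomb (-1) lg lf.
by congr Lp; apply/funext => x; rewrite mulN1r addrC.
Qed.

Lemma LpZ c f : Lp f -> Lp (fun x => c * f x).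
Proof.
move=> lf; have := Lp_lincomb (c - 1) lf lf.
by congr Lp; apply/funext => x; ring.
Qed.

Lemma pmodZ c f : Lp f -> pmod (fun x => c * f x) = `|c| `^ p * pmod f.
Proof.
move=> [mf lf]; rewrite !pmod_def -RintegralZl//.
by apply: eq_Rintegral => x _; rewrite normrM powRM.
Qed.

Lemma pmodD_le f g : Lp f -> Lp g ->
  pmod (fun x => f x + g x) <= 2 `^ p * (pmod f + pmod g).
Proof.
move=> lf lg; have [_ lfg] := LpD lf lg; have [_ {}lf] := lf.
have [_ {}lg] := lg.
rewrite !pmod_def -RintegralD// -RintegralZl//; last exact: integrable_EFinD.
apply: le_Rintegral => //.
  by apply: integrable_EFinZ; exact: integrable_EFinD.
by move=> x _; exact: powR_normD_le.
Qed.

Lemma pmodN f : pmod (fun x => - f x) = pmod f.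
Proof. by rewrite !pmod_def; apply: eq_Rintegral => x _; rewrite normrN. Qed.

Lemma pmod_distrC f g : pmod (fun x => f x - g x) = pmod (fun x => g x - f x).
Proof. by rewrite !pmod_def; apply: eq_Rintegral => x _; rewrite distrC. Qed.

Lemma pmodB_le f g : Lp f -> Lp g ->
  pmod (fun x => f x - g x) <= 2 `^ p * (pmod f + pmod g).
Proof.
move=> lf lg; have := pmodD_le lf (LpZ (-1) lg).
rewrite (_ : pmod (fun x => -1 * g x) = pmod g); last first.
  by rewrite -pmodN; congr pmod; apply/funext => x; ring.
rewrite (_ : (fun x => f x + -1 * g x) = (fun x => f x - g x))//.
by apply/funext => x; rewrite mulN1r.
Qed.

Section weighted.
Variables (lo hi : R) (a : T -> R).
Hypotheses (lo0 : 0 <= lo) (wa : weight lo hi a).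

Let a0 x : 0 <= a x.
Proof. by have [_ /(_ x)/andP[h _]] := wa; exact: le_trans h. Qed.

Lemma integrable_weight f : Lp f ->
  mu.-integrable setT (EFin \o (fun x => a x * `|f x| `^ p)).
Proof.
move=> [mf lf]; have [ma ba] := wa.
apply: (@integrable_le _ (fun x => hi * `|f x| `^ p)).
- by apply: measurable_funM => //; exact: measurable_powR_norm.
- exact: integrable_EFinZ.
- move=> x; rewrite ger0_norm ?mulr_ge0 ?powR_ge0// ler_wpM2r ?powR_ge0//.
  by have /andP[] := ba x.
Qed.

Lemma wmod_ge f : Lp f -> lo * pmod f <= wmod a f.
Proof.
move=> lf; have [_ ba] := wa; have [_ l2] := lf.
rewrite wmod_def !pmod_def -RintegralZl//; apply: le_Rintegral => //.
- exact: integrable_EFinZ.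
- exact: integrable_weight.
- by move=> x _; rewrite ler_wpM2r ?powR_ge0//; have /andP[] := ba x.
Qed.

Lemma integrable_pairing f g : Lp f -> Lp g ->
  mu.-integrable setT (EFin \o (fun x => a x * (signed_pow p (f x) * g x))).
Proof.
move=> [mf lf] [mg lg]; have [ma ba] := wa.
apply: (@integrable_le _ (fun x => hi * (`|f x| `^ p + `|g x| `^ p))).
- apply: measurable_funM => //; apply: measurable_funM => //.
  exact: (measurableT_comp (measurable_signed_pow p)).
- by apply: integrable_EFinZ; exact: integrable_EFinD.
- move=> x; rewrite normrM; apply: ler_pM => //.
    by rewrite ger0_norm//; have /andP[] := ba x.
  exact: norm_signed_powM_le.
Qed.

Lemma pairing_le f g : Lp f -> Lp g ->
  `|\int[mu]_x (a x * (signed_pow p (f x) * g x))| <=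
    hi * (pmod f + pmod g).
Proof.
move=> lf lg; have [ma ba] := wa.
have ip := integrable_pairing lf lg.
apply: le_trans (le_normr_Rintegral _ ip) _ => //.
have [_ l1] := lf; have [_ l2] := lg.
rewrite !pmod_def -RintegralD// -RintegralZl//; last exact: integrable_EFinD.
apply: le_Rintegral => //.
- exact: (integrable_norm ip).
- by apply: integrable_EFinZ; exact: integrable_EFinD.
- move=> x _; rewrite normrM; apply: ler_pM => //.
    by rewrite ger0_norm//; have /andP[] := ba x.
  exact: norm_signed_powM_le.
Qed.

Lemma wmod_tangent f g : Lp f -> Lp g ->
  wmod a f + p * \int[mu]_x (a x * (signed_pow p (f x) * (g x - f x)))
  <= wmod a g.
Proof.
move=> lf lg; have lgf := LpB lg lf.
have ip := integrable_pairing lf lgf; have if_ := integrable_weight lf.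
rewrite !wmod_def -RintegralZl// -RintegralD//; last exact: integrable_EFinZ.
apply: le_Rintegral => //.
- by apply: integrable_EFinD => //; exact: integrable_EFinZ.
- exact: integrable_weight.
- move=> x _; rewrite mulrCA -mulrDr ler_wpM2l//; exact: powR_tangent.
Qed.

(** The pointwise inequality is multiplied by the nonnegative weight and integrated, so [eps] and
    [C] do not depend on the weight. *)
Lemma wmod_uniform_convexity (eps C : R) : (forall x y : R, `|x - y| `^ p <=
    eps * (`|x| `^ p + `|y| `^ p) +
    C * ((`|x| `^ p + `|y| `^ p) / 2 - `|(x + y) / 2| `^ p)) ->
  forall f g, Lp f -> Lp g -> wmod a (fun x => f x - g x) <=
    eps * (wmod a f + wmod a g) +
    C * ((wmod a f + wmod a g) / 2 - wmod a (fun x => (f x + g x) / 2)).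
Proof.
move=> hC f g lf lg.
have lm : Lp (fun x => (f x + g x) / 2).
  by have := LpZ 2^-1 (LpD lf lg); congr Lp; apply/funext => x; rewrite mulrC.
have iB := integrable_weight (LpB lf lg); have im := integrable_weight lm.
have if_ := integrable_weight lf; have ig := integrable_weight lg.
have alg (u v w : R) : u + C * w <= (eps + C / 2) * v ->
  u <= eps * v + C * (v / 2 - w) by lra.
apply: alg.
rewrite !wmod_def -[in leRHS]RintegralD// -!RintegralZl//; last exact: integrable_EFinD.
rewrite -RintegralD//; last exact: integrable_EFinZ.
apply: le_Rintegral => //.
- by apply: integrable_EFinD => //; exact: integrable_EFinZ.
- by apply: integrable_EFinZ; exact: integrable_EFinD.
- move=> x _; have := ler_wpM2l (a0 x) (hC (f x) (g x)); lra.
Qed.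

(** The conclusion stays in the extended reals because [g] is not yet known to be in [Lp]; the
    finite bound is what shows it, through [LpP]. *)
Lemma wmod_fatou (g_ : nat -> T -> R) g c : (forall k, Lp (g_ k)) ->
  measurable_fun setT g -> {ae mu, forall x, g_ k x @[k --> \oo] --> g x} ->
  (\forall k \near \oo, wmod a (g_ k) <= c) ->
  (\int[mu]_x (a x * `|g x| `^ p)%:E <= c%:E)%E.
Proof.
move=> lg_ mg gg hc; have [ma ba] := wa.
have mwg h : measurable_fun setT h ->
    measurable_fun setT (fun x => (a x * `|h x| `^ p)%:E).
  move=> mh; apply/measurable_EFinP; apply: measurable_funM => //.
  exact: measurable_powR_norm.
have mg_ k : measurable_fun setT (g_ k) by have [] := lg_ k.
have w0 h x : (0 <= (a x * `|h x| `^ p)%:E)%E.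
  by rewrite lee_fin mulr_ge0 ?powR_ge0.
apply: (@le_trans _ _ (\int[mu]_x limn_einf
    (fun k => (a x * `|g_ k x| `^ p)%:E))%E).
  apply: ae_ge0_le_integral => //.
  - exact: mwg.
  - move=> x _; rewrite limn_einf_lim; apply: lime_ge; first exact: is_cvg_einfs.
    by apply: nearW => k; apply: le_ereal_inf_tmp => _ [j _ <-].
  (* The lower limit becomes minus an upper limit, to which [measurable_fun_limn_esup] applies. *)
  - have -> : (fun x => limn_einf (fun k => (a x * `|g_ k x| `^ p)%:E)) =
        (fun x => - limn_esup (fun k => - (a x * `|g_ k x| `^ p)%:E))%E.
      by apply/funext => x; rewrite -limn_einfN; congr limn_einf; apply/funext => k;
         rewrite /comp oppeK.
    apply: measurableT_comp => //; apply: measurable_fun_limn_esup => k.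
    by apply: measurableT_comp => //; exact: mwg.
  - apply: filterS gg => x gx _.
    have : (a x * `|g_ k x| `^ p)%:E @[k --> \oo] --> (a x * `|g x| `^ p)%:E.
      apply: cvg_EFin; first exact: nearW.
      apply: cvgM; first exact: cvg_cst.
      exact: (cvg_comp _ _ gx (@continuous_powR_norm _ _ p1 _)).
    by move=> /cvg_limn_einf_sup[-> _].
apply: le_trans (fatou _ _ _ _) _ => //.
  by move=> k; exact: mwg.
rewrite limn_einf_lim; apply: lime_le; first exact: is_cvg_einfs.
near=> k; apply: (@le_trans _ _ (\int[mu]_x (a x * `|g_ k x| `^ p)%:E)%E).
  by apply: ereal_inf_lbound; exists k => //=.
have : wmod a (g_ k) <= c by near: k; exact: hc.
rewrite !wmod_def /Rintegral -lee_fin fineK//.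
by apply: integrable_fin_num => //; exact: integrable_weight.
Unshelve. all: by end_near. Qed.

End weighted.

Lemma pmod_wmod f : pmod f = wmod (cst 1) f.
Proof. by rewrite ?wmod_def !pmod_def; apply: eq_Rintegral => x _; rewrite mul1r. Qed.

Lemma weight_cst1 : weight 1 1 (cst 1 : T -> R).
Proof. by split => // x; rewrite lexx. Qed.

Lemma LpP f c : measurable_fun setT f ->
  (\int[mu]_x (`|f x| `^ p)%:E <= c%:E)%E -> Lp f /\ pmod f <= c.
Proof.
move=> mf fc; have i : mu.-integrable setT (EFin \o (fun x => `|f x| `^ p)).
  apply/integrableP; split.
    by apply/measurable_EFinP; exact: measurable_powR_norm.
  apply: (le_lt_trans _ (ltry c)); apply: le_trans fc.
  apply: ge0_le_integral => //.
  - apply: measurableT_comp => //.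
    by apply/measurable_EFinP; exact: measurable_powR_norm.
  - by apply/measurable_EFinP; exact: measurable_powR_norm.
  - by move=> x _ /=; rewrite ger0_norm ?powR_ge0.
split => //; rewrite -lee_fin !pmod_def /Rintegral fineK//.
exact: integrable_fin_num.
Qed.

Lemma pmodE f : Lp f -> (pmod f)%:E = (\int[mu]_x (`|f x| `^ p)%:E)%E.
Proof.
by move=> [_ lf]; rewrite !pmod_def /Rintegral fineK//; exact: integrable_fin_num.
Qed.

Lemma pmod_fatou (g_ : nat -> T -> R) g c : (forall k, Lp (g_ k)) ->
  measurable_fun setT g -> {ae mu, forall x, g_ k x @[k --> \oo] --> g x} ->
  (\forall k \near \oo, pmod (g_ k) <= c) -> Lp g /\ pmod g <= c.
Proof.
move=> lg_ mg gg hc; apply: LpP => //.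
have := wmod_fatou ler01 weight_cst1 lg_ mg gg.
under eq_integral do rewrite mul1r.
by apply; apply: filterS hc => k; rewrite pmod_wmod.
Qed.

(** The series of the |h_k|^p has integral at most 1, hence is finite almost everywhere. Each term
    is bounded by the tail starting at it, and the tails of a finite series vanish. *)
Lemma pmod_cvg0_ae (h_ : nat -> T -> R) : (forall k, Lp (h_ k)) ->
  (forall k, pmod (h_ k) <= (2 ^ k.+1)%:R^-1) ->
  {ae mu, forall x, h_ k x @[k --> \oo] --> (0 : R)}.
Proof.
move=> lh hh.
pose F k x := (`|h_ k x| `^ p)%:E.
have F0 k x : (0 <= F k x)%E by rewrite lee_fin powR_ge0.
have mF k : measurable_fun setT (F k).
  by apply/measurable_EFinP/measurable_powR_norm; have [] := lh k.
have mS : measurable_fun setT (fun x => \sum_(k <oo) F k x)%E.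
  exact: ge0_emeasurable_sum.
have S0 x : (0 <= \sum_(k <oo) F k x)%E by apply: nneseries_ge0.
have iS : (\int[mu]_x (\sum_(k <oo) F k x) < +oo)%E.
  rewrite integral_nneseries//; apply: le_lt_trans (ltry 1).
  (* Shape required by [epsilon_trick], with the zero series and epsilon equal to 1. *)
  apply: (@le_trans _ _ (\sum_(0 <= i <oo) (0 + (1 / (2 ^ i.+1)%:R)%:E))%E).
    apply: lee_nneseries => [k _ _|k _]; first exact: integral_ge0.
    by rewrite -pmodE// add0e lee_fin div1r; exact: hh.
  apply: le_trans (epsilon_trick _ _ _) _ => //.
  by rewrite eseries0 ?add0e.
have /integrable_ae : mu.-integrable setT (fun x => \sum_(k <oo) F k x)%E.
  by apply/integrableP; split => //; under eq_integral do rewrite gee0_abs//.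
move=> /(_ measurableT); apply: filterS => x /(_ I).
rewrite ge0_fin_numE// => /nneseries_tail_cvg => /(_ (fun k _ => F0 k x)).
move=> /fine_cvgP[fin tail].
apply/cvgr0Pnorm_lt => e e0.
have : \forall N \near \oo, `|fine (\sum_(N <= k <oo) F k x)%E| < e `^ p.
  by move/cvgr0Pnorm_lt : tail; apply; exact: powR_gt0.
move: fin; apply: filterS2 => k fk; rewrite ger0_norm ?fine_ge0 ?nneseries_ge0// => tk.
have : (F k x <= \sum_(k <= j <oo) F j x)%E.
  have := @nneseries_lim_ge R (fun k => F k x) xpredT k k.+1 (fun k _ _ => F0 k x).
  by rewrite big_nat1.
rewrite -(fineK fk) lee_fin => /le_lt_trans => /(_ _ tk).
rewrite ltNge => /negP h; rewrite ltNge; apply/negP => eh; apply: h.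
by apply: ge0_ler_powR; rewrite ?nnegrE ?(ltW p0) ?(ltW e0).
Qed.

(** The factor 2^(k p) makes the hypothesis a bound on 2^k (g_(k+1) - g_k), which therefore tends to
    0 almost everywhere. The increments are then eventually below 2^(-k), and the telescoping series
    converges. *)
Lemma pmod_cauchy_ae (g_ : nat -> T -> R) : (forall k, Lp (g_ k)) ->
  (forall k, 2 `^ (k%:R * p) * pmod (fun x => g_ k.+1 x - g_ k x) <=
     (2 ^ k.+1)%:R^-1) ->
  exists2 g : T -> R, measurable_fun setT g &
    {ae mu, forall x, g_ k x @[k --> \oo] --> g x}.
Proof.
move=> lg hg.
(* The upper limit exists at every point and is measurable; it is the limit wherever the sequence
   converges. *)
exists (fun x => fine (limn_esup (fun k => (g_ k x)%:E))).
  apply: measurableT_comp => //; apply: measurable_fun_limn_esup => k.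
  by apply/measurable_EFinP; have [] := lg k.
have lh k : Lp (fun x => 2 ^+ k * (g_ k.+1 x - g_ k x)) by apply/LpZ/LpB.
have hh k : pmod (fun x => 2 ^+ k * (g_ k.+1 x - g_ k x)) <= (2 ^ k.+1)%:R^-1.
  rewrite pmodZ; last exact: LpB.
  apply: le_trans (hg k); rewrite ler_wpM2r ?pmod_ge0//.
  by rewrite ger0_norm ?exprn_ge0// -powR_mulrn// -powRrM.
apply: filterS (pmod_cvg0_ae lh hh) => x /cvgr0Pnorm_lt/(_ _ ltr01) hx.
have cx : cvgn (fun k => g_ k x).
  have [K _ hK] := hx.
  pose v k := g_ (k + K)%N x.
  suff cv : cvgn v.
    by move/cvg_ex : cv => [l vl]; apply/cvg_ex; exists l; rewrite -(cvg_shiftn K).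
  suff : cvgn (series (telescope v)).
    move=> cs; rewrite (_ : v = (fun k => v 0%N + series (telescope v) k)).
      by apply: is_cvgD => //; exact: is_cvg_cst.
    by apply/funext => k; rewrite -eq_sum_telescope.
  apply: normed_cvg.
  apply: (@series_le_cvg _ _ (geometric 1 2^-1)) => //.
  - by move=> k /=; exact: normr_ge0.
  - by move=> k; rewrite /geometric /= mul1r exprn_ge0// invr_ge0.
  - move=> k; rewrite /geometric /= mul1r.
    have /= := hK (k + K)%N (leq_addl _ _).
    rewrite normrM ger0_norm ?exprn_ge0// exprVn => h.
    rewrite -[leRHS]mulr1 ler_pdivlMl ?exprn_gt0//; apply: le_trans (ltW h).
    by rewrite ler_wpM2r// exprD ler_peMr ?exprn_ge0// exprn_ege1// ler1n.
  - by apply: is_cvg_geometric_series; rewrite ger0_norm ?invr_ge0// invf_lt1// ltr1n.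
have : (g_ k x)%:E @[k --> \oo] --> (limn (fun k => g_ k x))%:E.
  by apply: cvg_EFin => //; exact: nearW.
by move=> /cvg_limn_einf_sup[_ ->].
Qed.

End modulars.

(** * Boxes: measurability, volume, distances *)

Section boxes.
Context {R : realType}.

Definition box n (x : 'rV[R]_n) (r : R) : set 'rV[R]_n :=
  [set y | forall i, `|x ord0 i - y ord0 i| < r].

Lemma box_sym n (x y : 'rV[R]_n) r : box x r y -> box y r x.
Proof. by move=> h i; rewrite distrC; exact: h. Qed.

Lemma measurable_coord_sub n : forall i : 'I_n, measurable_fun setT
  (fun z : 'rV[R]_n * 'rV[R]_n => z.1 ord0 i - z.2 ord0 i : R).
Proof.
move=> i; apply: measurable_funB.
  exact: (measurableT_comp (measurable_rV_coord i) measurable_fst).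
exact: (measurableT_comp (measurable_rV_coord i) measurable_snd).
Qed.

(** The sections of this set are boxes, which opens integrals over moving boxes to Tonelli's
    theorem. *)
Lemma measurable_box_rel n (r : R) :
  measurable [set z : 'rV[R]_n * 'rV[R]_n | box z.1 r z.2].
Proof.
have -> : [set z : 'rV[R]_n * 'rV[R]_n | box z.1 r z.2] =
    \bigcap_(i in [set: 'I_n]) [set z : 'rV[R]_n * 'rV[R]_n | `|z.1 ord0 i - z.2 ord0 i| < r].
  by apply/seteqP; split => z h //= i; [move=> _; exact: h|exact: h i I].
apply: fin_bigcap_measurable => // i _.
rewrite -[X in measurable X]setTI.
apply: (@measurable_fun_ltr _ _ _ setT
   (fun z : 'rV[R]_n * 'rV[R]_n => `|z.1 ord0 i - z.2 ord0 i|) (cst r)) => //.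
by apply: measurableT_comp => //; exact: measurable_coord_sub.
Qed.

Lemma measurable_box n (x : 'rV[R]_n) r : measurable (box x r).
Proof.
have := measurable_xsection x (@measurable_box_rel n r).
by congr measurable; apply/seteqP; split=> y; rewrite xsectionE /= ?inE.
Qed.

(** The sigma-algebra is generated by the coordinates, whence the detour: an open set is the
    countable union of the boxes with rational centre and radius 1/(k+1) that it contains. *)
Lemma open_measurable_rV n (A : set 'rV[R]_n) : open A -> measurable A.
Proof.
move=> oA.
pose c (q : 'rV[rat]_n) : 'rV[R]_n := map_mx ratr q.
pose F (i : 'rV[rat]_n * nat) : set 'rV[R]_n :=
  if `[< box (c i.1) i.2.+1%:R^-1 `<=` A >] then box (c i.1) i.2.+1%:R^-1 else set0.
rewrite (_ : A = \bigcup_i F i).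
  apply: countable_bigcupT_measurable; first exact: countableP.
  by move=> i; rewrite /F; case: ifPn => // _; exact: measurable_box.
apply/seteqP; split => [x Ax|x [i _]]; last first.
  by rewrite /F; case: asboolP => // h /h.
have := open_nbhs_nbhs (conj oA Ax); move=> /nbhs_ballP[e /= e0 xe].
(* Half of [e], because the box is centred at a rational point near [x] and not at [x] itself. *)
have [k ke] : exists k : nat, k.+1%:R^-1 < e / 2.
  have e20 : 0 < e / 2 by rewrite divr_gt0.
  have [k _ /(_ k (leqnn k))] := near_infty_natSinv_lt (PosNum e20).
  by exists k.
have k0 : 0 < k.+1%:R^-1 :> R by rewrite invr_gt0.
have hq i : {q : rat | `|ratr q - x ord0 i| < k.+1%:R^-1}.
  apply: cid; have [|q] := @rat_in_itvoo R (x ord0 i - k.+1%:R^-1) (x ord0 i + k.+1%:R^-1).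
    by rewrite ltrBlDr -addrA ltrDl addr_gt0.
  rewrite in_itv/= => /andP[q1 q2]; exists q.
  by rewrite ltr_distl q1 q2.
pose q : 'rV[rat]_n := \row_i sval (hq i).
have cq i : `|c q ord0 i - x ord0 i| < k.+1%:R^-1.
  by rewrite !mxE; exact: (svalP (hq i)).
exists (q, k) => //; rewrite /F /=; case: asboolP; first by move=> _ i; exact: cq.
case=> y hy; apply: xe; split => //= i j.
rewrite (ord1 i) /ball /=.
have -> : x ord0 j - y ord0 j = - (c q ord0 j - x ord0 j) + (c q ord0 j - y ord0 j).
  by ring.
rewrite (splitr e); apply: le_lt_trans (ler_normD _ _) _; rewrite normrN.
by apply: ltrD; [exact: lt_trans (cq j) ke|exact: lt_trans (hy j) ke].
Qed.

Lemma continuous_measurable_rV n (f : 'rV[R]_n -> R) :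
  continuous f -> measurable_fun setT f.
Proof.
move=> /continuousP cf.
apply: (measurability _ (RGenOpens.measurableE R)).
move=> _ [_ [a [b ->] <-]]; rewrite setTI; apply: open_measurable_rV.
exact/cf/interval_open.
Qed.

(** Induction on the dimension: through [rV_cons] a box is an interval times a box of one dimension
    less. *)
Lemma lebesgue_box n (x : 'rV[R]_n) (r : R) : 0 < r ->
  lebesgue_rV n (box x r) = ((2 * r) ^+ n)%:E.
Proof.
move=> r0; elim: n x => [|n IH] x.
  rewrite /= /dirac indicE expr0.
  by rewrite mem_set// => i; case: i.
pose x' : 'rV[R]_n := rsubmx (x : 'rV_(1 + n)).
rewrite /= /lebesgue_cons /pushforward.
rewrite (_ : _ @^-1` _ =
  (`](x ord0 ord0 - r), (x ord0 ord0 + r)[%classic : set (measurableTypeR R)) `*` box x' r).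
  rewrite product_measure1E//; last exact: measurable_box.
  rewrite IH [X in (X * _)%E](_ : _ = (2 * r)%:E) ?exprS//.
  apply: etrans (lebesgue_measure_itv _) _.
  rewrite /= lte_fin ltrBlDr -addrA ltrDl addr_gt0// -EFinB; congr _%:E; ring.
have consr (z : R) (v : 'rV[R]_n) i : rV_cons (z, v) ord0 (rshift 1 i) = v ord0 i.
  exact: row_mxEr.
apply/seteqP; split => [[z v] /= h|[z v] /= [h1 h2] i].
  split.
    have := h ord0.
    have -> : rV_cons (z, v) ord0 ord0 = z by have [] := rV_consK (z, v).
    rewrite ltr_norml => /andP[? ?]; rewrite in_itv/=; apply/andP; split; lra.
  move=> i; have := h (rshift 1 i).
  by rewrite consr /x' mxE.
case: (split_ordP (i : 'I_(1 + n))) => j ->.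
  rewrite (ord1 j) (_ : lshift n ord0 = ord0); last exact/val_inj.
  have -> : rV_cons (z, v) ord0 ord0 = z by have [] := rV_consK (z, v).
  by move: h1; rewrite in_itv/= ltr_norml => /andP[? ?]; apply/andP; split; lra.
by have := h2 j; rewrite consr /x' mxE.
Qed.

Lemma enorm_box n (x y : 'rV[R]_n) (r : R) : 0 <= r -> box x r y ->
  enorm (x - y) <= Num.sqrt (n%:R * r ^+ 2).
Proof.
move=> r0 xy; rewrite /enorm; apply: ler_wsqrtr.
apply: (@le_trans _ _ (\sum_(i < n) r ^+ 2)).
  apply: ler_sum => i _; rewrite -real_normK ?num_real// ler_sqr ?nnegrE//.
  by rewrite !mxE; exact/ltW/xy.
by rewrite sumr_const card_ord mulr_natl.
Qed.

Lemma enorm_eq0 n (x : 'rV[R]_n) : enorm x = 0 -> x = 0.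
Proof.
move=> /eqP; rewrite sqrtr_eq0 => h; apply/rowP => i; rewrite mxE.
have s0 : \sum_i x ord0 i ^+ 2 = 0.
  by apply/eqP; rewrite eq_le h/= sumr_ge0// => j _; exact: sqr_ge0.
have xi : x ord0 i ^+ 2 = 0.
  by apply: (psumr_eq0P _ s0) => // j _; exact: sqr_ge0.
by move/eqP : xi; rewrite sqrf_eq0 => /eqP.
Qed.

Lemma enorm_ge0 n (x : 'rV[R]_n) : 0 <= enorm x.
Proof. exact: sqrtr_ge0. Qed.

Lemma measurable_enorm_sub n : measurable_fun setT
  (fun z : 'rV[R]_n * 'rV[R]_n => enorm (z.1 - z.2)).
Proof.
have ms : measurable_fun setT (@Num.sqrt R).
  by apply: continuous_measurable_fun; exact: sqrt_continuous.
apply: (measurableT_comp ms); apply: measurable_sum => i; apply: measurable_funX.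
apply: eq_measurable_fun (measurable_coord_sub i) => z _.
by rewrite !mxE.
Qed.

End boxes.

Lemma integrable_cst_on {R : realType} d (T : measurableType d)
    (mu : {measure set T -> \bar R}) (B : set T) (c : R) :
  measurable B -> (mu B < +oo)%E -> mu.-integrable B (EFin \o cst c).
Proof.
move=> mB fB; apply/integrableP; split;
  have h : measurable_fun B (cst c : T -> R) by exact: measurable_cst.
  exact/measurable_EFinP.
by rewrite /= integral_cst// lte_mul_pinfty.
Qed.

(** Jensen's inequality. The tangent line of |t|^p at [c - m], with [m] the mean of [f] over [B], is
    integrated over [B]; its linear part integrates to 0. An infinite right side leaves nothing to
    prove. *)
Lemma powR_mean_le {R : realType} d (T : measurableType d)
    (mu : {measure set T -> \bar R}) (p : R) (B : set T) (V c : R) (f : T -> R) :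
  1 < p -> measurable B -> mu B = V%:E -> 0 < V -> measurable_fun setT f ->
  mu.-integrable B (EFin \o f) ->
  ((V * `|c - (\int[mu]_(y in B) f y) / V| `^ p)%:E <=
   \int[mu]_(y in B) (`|c - f y| `^ p)%:E)%E.
Proof.
move=> p1 mB muB V0 mf intf.
set m := (\int[mu]_(y in B) f y) / V; set k := c - m.
have mg : measurable_fun setT (fun y => `|c - f y| `^ p).
  by apply: measurable_powR_norm; exact: measurable_funB.
have := leey (\int[mu]_(y in B) (`|c - f y| `^ p)%:E)%E.
rewrite le_eqVlt => /predU1P[->|RHSfin]; first exact: leey.
have iR : mu.-integrable B (EFin \o (fun y => `|c - f y| `^ p)).
  apply/integrableP; split.
    by apply/measurable_EFinP; exact: measurable_funTS.
  apply: le_lt_trans RHSfin; under eq_integral do rewrite /= ger0_norm ?powR_ge0//.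
  exact: lexx.
(* With [a] below, a + b f(y) is the tangent line at [k] evaluated at c - f(y). *)
pose b := - (p * signed_pow p k).
pose a := `|k| `^ p + p * (signed_pow p k * (c - k)).
have icst z : mu.-integrable B (EFin \o cst z).
  by apply: integrable_cst_on => //; rewrite muB ltry.
have ibf : mu.-integrable B (EFin \o (fun y => b * f y)).
  by have := integrableZl mB b intf.
have iL : mu.-integrable B (EFin \o (fun y => a + b * f y)).
  by have := integrableD mB (icst a) ibf.
have <- : \int[mu]_(y in B) (a + b * f y) = V * `|k| `^ p.
  rewrite RintegralD//; last exact: icst.
  rewrite RintegralZl// Rintegral_cst// muB /=.
  have -> : \int[mu]_(x in B) f x = V * m by rewrite /m mulrC divfK ?gt_eqF.
  rewrite /a /b (_ : c = k + m); last by rewrite /k subrK.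
  ring.
rewrite /Rintegral fineK; last exact: integrable_fin_num.
apply: le_integral => // y _; rewrite lee_fin.
apply: le_trans (powR_tangent p1 k (c - f y)); rewrite /a /b; lra.
Qed.

(** * Fractional Poincare inequality and compactness through box averages *)

Section poincare.
Context {R : realType} {N : nat}.
Variables (s p : R) (Omega : set 'rV[R]_N).
Hypotheses (s0 : 0 < s) (p1 : 1 < p).
Hypotheses (mOmega : measurable Omega) (fOmega : (lebN R N Omega < +oo)%E).

Notation leb := (lebN R N).
Notation leb2 := (lebN2 R N).
Notation D := (sp_gradient s p).
Implicit Types (u : 'rV[R]_N -> R) (x y : 'rV[R]_N) (r : R).

Let p0 : 0 < p. Proof. exact: lt_trans p1. Qed.

Definition box_avg r u x : R := (\int[leb]_(y in box x r) u y) / (2 * r) ^+ N.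

Definition box_osc r u x : \bar R :=
  (\int[leb]_(y in box x r) (`|u x - u y| `^ p)%:E)%E.

(* The points around which [Omega] fills more than half of the box, so that the
   zeros of [u] alone do not control [u] there. *)
Definition crowded r : set 'rV[R]_N :=
  [set x | (((2 * r) ^+ N / 2)%:E < leb (box x r `&` Omega))%E].

Lemma leb_box x r : 0 < r -> leb (box x r) = ((2 * r) ^+ N)%:E.
Proof. exact: lebesgue_box. Qed.

Lemma integral_indic_box x r : 0 < r ->
  (\int[leb]_y (\1_(box x r) y)%:E = ((2 * r) ^+ N)%:E)%E.
Proof.
by move=> r0; rewrite integral_indic ?setIT//; [exact: leb_box|exact: measurable_box].
Qed.

(** On [Omega], |u| is at most 1 or at most |u|^p, so the indicator of [Omega] plus |u|^p is an
    integrable majorant. *)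
Lemma integrable_supported u : Lp leb p u -> (forall x, ~ Omega x -> u x = 0) ->
  leb.-integrable setT (EFin \o u).
Proof.
move=> [mu lu] u0.
have i1 : leb.-integrable setT (EFin \o (\1_Omega : _ -> R)).
  apply/integrableP; split.
    by apply/measurable_EFinP; exact: measurable_indic.
  under eq_integral do rewrite /= ger0_norm//.
  by rewrite integral_indic ?setIT.
apply: (@integrable_le _ _ _ _ _ (fun x => \1_Omega x + `|u x| `^ p)) => //.
  exact: integrable_EFinD.
move=> x; have [Ox|Ox] := pselect (Omega x); last first.
  by rewrite u0// normr0 addr_ge0// powR_ge0.
rewrite indicE mem_set//=.
have [h|h] := leP `|u x| 1; first by rewrite ler_wpDr ?powR_ge0.
by rewrite ler_wpDl// le1r_powR// ltW.
Qed.

(** Splitting at |u| = 1 stands in for Hoelder. The bound is not homogeneous, which is harmless: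
    [Wsp0_dualP] rescales, and dominated convergence only asks for a uniform bound. *)
Lemma box_avg_bound r u x : 0 < r -> Lp leb p u -> leb.-integrable setT (EFin \o u) ->
  `|box_avg r u x| <= 1 + pmod leb p u / (2 * r) ^+ N.
Proof.
move=> r0 [mu lu] iu.
have V0 : 0 < (2 * r) ^+ N by rewrite exprn_gt0// mulr_gt0.
have mB := measurable_box x r.
have ib f : leb.-integrable setT (EFin \o f) -> leb.-integrable (box x r) (EFin \o f).
  by move=> h; exact: integrableS h.
rewrite normrM normfV (ger0_norm (ltW V0)) ler_pdivrMr// mulrDl mul1r divfK ?gt_eqF//.
have ic : leb.-integrable (box x r) (EFin \o cst 1).
  have fB : (leb (box x r) < +oo)%E by rewrite leb_box// ltry.
  exact: (integrable_cst_on _ mB fB).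
apply: le_trans (le_normr_Rintegral mB (ib _ iu)) _.
apply: (@le_trans _ _ (\int[leb]_(y in box x r) (1 + `|u y| `^ p))).
  apply: le_Rintegral => //.
  - exact: (integrable_norm (ib _ iu)).
  - by have := integrableD mB ic (ib _ lu).
  - move=> y _; have [h|h] := leP `|u y| 1; first by rewrite ler_wpDr ?powR_ge0.
    by rewrite ler_wpDl// le1r_powR// ltW.
rewrite RintegralD//; last exact: ib.
have -> : \int[leb]_(_ in box x r) (1 : R) = (2 * r) ^+ N.
  by rewrite Rintegral_cst// mul1r; exact: (congr1 fine (leb_box x r0)).
rewrite lerD2l.
rewrite -lee_fin pmod_def /Rintegral !fineK; last 2 first.
  exact: integrable_fin_num lu.
  exact: integrable_fin_num (ib _ lu).
apply: ge0_subset_integral => //; first exact: measurable_int lu.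
Qed.

(** Around an uncrowded [x] at least half of the box lies outside [Omega], where u = 0, so the
    oscillation is at least half the volume times |u x|^p; this costs the constant 2. At a crowded
    [x] the value is compared with the average, and Jensen bounds the difference by the oscillation;
    this costs 2^p. *)
Lemma powR_le_box r u x : 0 < r -> Lp leb p u -> (forall x, ~ Omega x -> u x = 0) ->
  (((2 * r) ^+ N * `|u x| `^ p)%:E <=
   (2 + 2 `^ p)%:E * (box_osc r u x +
      ((2 * r) ^+ N * (\1_(crowded r) x * `|box_avg r u x| `^ p))%:E))%E.
Proof.
move=> r0 lu u0; set V := (2 * r) ^+ N.
have V0 : 0 < V by rewrite exprn_gt0// mulr_gt0.
have [mu _] := lu; have iu := integrable_supported lu u0.
have mB := measurable_box x r.
have osc0 : (0 <= box_osc r u x)%E.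
  by apply: integral_ge0 => y _; rewrite lee_fin powR_ge0.
have p20 : 0 <= 2 `^ p :> R by exact: powR_ge0.
have mosc E : measurable E -> measurable_fun E (fun y => (`|u x - u y| `^ p)%:E).
  move=> mE; apply/measurable_EFinP; apply: measurable_funTS.
  by apply: measurable_powR_norm; exact: measurable_funB.
have [xC|xC] := pselect (crowded r x).
  rewrite indicE mem_set// mul1r.
  apply: (@le_trans _ _ ((2 `^ p)%:E * (box_osc r u x + (V * `|box_avg r u x| `^ p)%:E))%E).
    apply: (@le_trans _ _ ((2 `^ p)%:E * ((V * `|u x - box_avg r u x| `^ p)%:E
        + (V * `|box_avg r u x| `^ p)%:E))%E).
      rewrite -EFinD -EFinM lee_fin -mulrDr mulrCA ler_pM2l//.
      by rewrite -{1}(subrK (box_avg r u x) (u x)); exact: powR_normD_le.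
    rewrite lee_wpmul2l// leeD2r//.
    apply: powR_mean_le => //; first exact: leb_box.
    exact: integrableS iu.
  rewrite lee_wpmul2r ?lee_fin ?lerDr// adde_ge0// lee_fin.
  by rewrite mulr_ge0 ?powR_ge0// ltW.
rewrite indicE memNset// mul0r mulr0 adde0.
apply: (@le_trans _ _ (2%:E * box_osc r u x)%E); last first.
  by rewrite lee_wpmul2r// lee_fin lerDl.
have mBO : measurable (box x r `\` Omega) by exact: measurableD.
apply: (@le_trans _ _ (2%:E * \int[leb]_(y in box x r `\` Omega)
     (`|u x - u y| `^ p)%:E)%E); last first.
  apply: lee_wpmul2l => //; apply: ge0_subset_integral => //.
  exact: mosc.
rewrite (eq_integral (cst (`|u x| `^ p)%:E)); last first.
  by move=> y; rewrite inE => -[_ /u0 ->]; rewrite subr0.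
rewrite integral_cst//.
move: xC; rewrite /crowded /= => /negP; rewrite -leNgt => xC.
have BV : (leb (box x r) < +oo)%E by rewrite leb_box// ltry.
have BE : (leb (box x r) = leb (box x r `&` Omega) + leb (box x r `\` Omega))%E.
  by rewrite [LHS](measureDI leb mB mOmega) addeC.
rewrite leb_box// in BE.
case: (leb (box x r `&` Omega)) BE xC (measure_ge0 leb (box x r `&` Omega)) => // v.
case: (leb (box x r `\` Omega)) (measure_ge0 leb (box x r `\` Omega)) => // w.
rewrite !lee_fin -EFinD => w0 [VE] xC v0.
rewrite mulrCA [leLHS]mulrC ler_wpM2l ?powR_ge0//.
move: VE xC; rewrite -/V => ->; lra.
Qed.

Lemma measurable_sp_gradient u : measurable_fun setT u -> measurable_fun setT (D u).
Proof.
move=> mu; rewrite (_ : D u = fun z => (u z.1 - u z.2) *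
    enorm (z.1 - z.2) `^ (- (N%:R / p + s))); last first.
  by apply/funext => z; rewrite powRN.
apply: measurable_funM.
  apply: measurable_funB.
    exact: (measurableT_comp mu measurable_fst).
  exact: (measurableT_comp mu measurable_snd).
apply: (measurableT_comp (measurable_powR _)); exact: measurable_enorm_sub.
Qed.

(** By Tonelli the left side integrates |u(x) - u(y)|^p over the pairs with y in the box of x. There
    |x - y| <= sqrt(N r^2), so this length to the power N + s p compensates the denominator of |D
    u|^p. *)
Lemma box_osc_integral r u : 0 < r -> measurable_fun setT u ->
  (\int[leb]_x box_osc r u x <=
    (Num.sqrt (N%:R * r ^+ 2) `^ (N%:R + s * p))%:E *
    \int[leb2]_z (`|D u z| `^ p)%:E)%E.
Proof.
move=> r0 mu.
pose S := [set z : 'rV[R]_N * 'rV[R]_N | box z.1 r z.2].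
pose f z : \bar R := (\1_S z * `|u z.1 - u z.2| `^ p)%:E.
have mS : measurable S by exact: measurable_box_rel.
have mf : measurable_fun setT f.
  apply/measurable_EFinP; apply: measurable_funM; first exact: measurable_indic.
  apply: measurable_powR_norm; apply: measurable_funB.
    exact: (measurableT_comp mu measurable_fst).
  exact: (measurableT_comp mu measurable_snd).
have f0 z : (0 <= f z)%E by rewrite lee_fin mulr_ge0// powR_ge0.
have -> : (\int[leb]_x box_osc r u x = \int[leb2]_z f z)%E.
  rewrite /lebN2 fubini_tonelli1//; apply: eq_integral => x _.
  rewrite /fubini_F /box_osc [LHS]integral_mkcond; congr integral; apply/funext => y.
  rewrite /f /= patchE /= indicE.
  have -> : ((x, y) \in S) = (y \in box x r) by apply/idP/idP; rewrite !inE.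
  by case: ifPn => _; rewrite ?mul1r ?mul0r.
have mD : measurable_fun setT (D u).
  exact: measurable_sp_gradient.
rewrite -ge0_integralZl_EFin ?powR_ge0//; last first.
  by apply/measurable_EFinP; exact: measurable_powR_norm.
apply: ge0_le_integral => //.
  apply/measurable_EFinP; apply: measurable_funM => //.
  exact: measurable_powR_norm.
move=> z _; rewrite /f -EFinM lee_fin indicE.
have [zS|zS] := boolP (z \in S); last by rewrite mul0r mulr_ge0 ?powR_ge0.
move: zS; rewrite inE mul1r => zS.
have := enorm_box (ltW r0) zS; set e := enorm _ => eK.
have e0 : 0 <= e by exact: enorm_ge0.
(* On the diagonal the convention for division by 0 makes [D u] vanish, but u(x) - u(y) vanishes as
   well. *)
have [ez|ez] := eqVneq e 0.
  have /eqP := enorm_eq0 ez; rewrite subr_eq0 => /eqP ->.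
  by rewrite subrr normr0 powR0 ?mulr_ge0 ?powR_ge0// gt_eqF.
have Np0 : 0 <= N%:R + s * p by rewrite addr_ge0// mulr_ge0 ?ltW.
rewrite /sp_gradient -/e normrM normfV [`|_ `^ _|]ger0_norm ?powR_ge0//.
rewrite powRM// ?invr_ge0 ?powR_ge0//.
have -> : (e `^ (N%:R / p + s))^-1 `^ p = (e `^ (N%:R + s * p))^-1.
  rewrite -powRN -powRrM -powRN mulNr mulrDl divfK ?gt_eqF//.
rewrite mulrCA -[leLHS]mulr1 ler_wpM2l ?powR_ge0//.
rewrite ler_pdivlMr ?powR_gt0 ?mul1r//; last by rewrite lt0r ez.
by apply: ge0_ler_powR; rewrite ?nnegrE// sqrtr_ge0.
Qed.

Lemma measurable_box_setI r : measurable_fun setT (fun x => leb (box x r `&` Omega)).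
Proof.
have mSO : measurable ([set z : 'rV[R]_N * 'rV[R]_N | box z.1 r z.2] `&`
    (setT `*` Omega)).
  by apply: measurableI; [exact: measurable_box_rel|exact: measurableX].
apply: eq_measurable_fun (measurable_fun_xsection leb mSO) => x _ /=.
congr (_ _); apply/seteqP; split => y; rewrite xsectionE /= ?inE => h.
  by case: h => ? [].
by split => //; case: h.
Qed.

Lemma measurable_crowded r : measurable (crowded r).
Proof.
rewrite -[crowded r]setTI; apply: emeasurable_fun_o_infty => //.
exact: measurable_box_setI.
Qed.

(** Markov's inequality for the measure of the part of the box of x inside [Omega]: by Tonelli its
    integral over x is V |Omega|, so the crowded set has measure at most 2 |Omega|. *)
Lemma crowded_measure r : 0 < r -> (leb (crowded r) < +oo)%E.
Proof.
move=> r0; set V := (2 * r) ^+ N.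
have V0 : 0 < V by rewrite exprn_gt0// mulr_gt0.
pose S := [set z : 'rV[R]_N * 'rV[R]_N | box z.1 r z.2].
have mS : measurable S by exact: measurable_box_rel.
have mC := measurable_crowded r.
have mb := measurable_box_setI r.
have h1 : ((V / 2)%:E * leb (crowded r) <= \int[leb]_x leb (box x r `&` Omega))%E.
  rewrite -integral_cst//; apply: (@le_trans _ _
      (\int[leb]_(x in crowded r) leb (box x r `&` Omega))%E).
    apply: ge0_le_integral => //.
    - by move=> x _; rewrite lee_fin divr_ge0// ltW.
    - exact: measurable_funTS.
    - by move=> x; rewrite /crowded /= => /ltW.
  exact: ge0_subset_integral.
have h2 : (\int[leb]_x leb (box x r `&` Omega) = V%:E * leb Omega)%E.
  pose f z : \bar R := (\1_S z * \1_Omega z.2)%:E.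
  have mf : measurable_fun setT f.
    apply/measurable_EFinP; apply: measurable_funM; first exact: measurable_indic.
    by apply: measurableT_comp => //; exact: measurable_indic.
  have f0 z : (0 <= f z)%E by rewrite lee_fin mulr_ge0.
  transitivity (\int[leb]_x \int[leb]_y f (x, y))%E.
    apply: eq_integral => x _.
    transitivity (\int[leb]_y (\1_(box x r `&` Omega) y)%:E)%E.
      by rewrite integral_indic ?setIT//; apply: measurableI => //; exact: measurable_box.
    apply: eq_integral => y _; rewrite /f !indicE in_setI /=.
    have -> : ((x, y) \in S) = (y \in box x r) by apply/idP/idP; rewrite !inE.
    by case: (y \in box x r); rewrite ?mul1r ?mul0r.
  rewrite fubini_tonelli//.
  transitivity (\int[leb]_y (V%:E * (\1_Omega y)%:E))%E.
    apply: eq_integral => y _; rewrite /f /=.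
    transitivity (\int[leb]_x ((\1_Omega y)%:E * (\1_(box y r) x)%:E))%E.
      apply: eq_integral => x _; rewrite mulrC EFinM; congr (_ * _%:E)%E.
      rewrite !indicE; congr (nat_of_bool _)%:R.
      by apply/idP/idP; rewrite !inE => /box_sym.
    rewrite ge0_integralZl_EFin//; last first.
      by apply/measurable_EFinP; apply: measurable_indic; exact: measurable_box.
    by rewrite integral_indic_box// muleC.
  rewrite ge0_integralZl_EFin// ?(ltW V0)//; last first.
    by apply/measurable_EFinP; exact: measurable_indic.
  by rewrite integral_indic ?setIT.
move: h1; rewrite h2 -(@fineK _ (leb Omega)) ?ge0_fin_numE//.
case: (leb (crowded r)) => [c _|h|//]; first exact: ltry.
by move: h; rewrite gt0_muley ?lte_fin ?divr_gt0// leNgt -EFinM ltry.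
Qed.

(** The average is a partial integral of 1_S(x, y) u(y), which is integrable on the product:
    integrating in x first gives V times the integral of |u|. *)
Lemma measurable_box_avg r u : 0 < r -> leb.-integrable setT (EFin \o u) ->
  measurable_fun setT (box_avg r u).
Proof.
move=> r0 iu; apply: measurable_funM => //.
have mu : measurable_fun setT u by apply/measurable_EFinP; exact: measurable_int iu.
pose S := [set z : 'rV[R]_N * 'rV[R]_N | box z.1 r z.2].
have mS : measurable S by exact: measurable_box_rel.
pose f (z : 'rV[R]_N * 'rV[R]_N) : \bar R := (\1_S z * u z.2)%:E.
have mf : measurable_fun setT f.
  apply/measurable_EFinP; apply: measurable_funM; first exact: measurable_indic.
  exact: (measurableT_comp mu measurable_snd).
have iF : (leb \x leb)%E.-integrable setT f.
  apply/integrable21ltyP => //.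
  rewrite (eq_integral (fun y => ((2 * r) ^+ N)%:E * `|u y|%:E))%E; last first.
    move=> y _; transitivity (\int[leb]_x (`|u y|%:E * (\1_(box y r) x)%:E))%E.
      apply: eq_integral => x _; rewrite /f /= normrM mulrC EFinM; congr (_ * _%:E)%E.
      rewrite ger0_norm// !indicE; congr (nat_of_bool _)%:R.
      by apply/idP/idP; rewrite !inE => /box_sym.
    rewrite ge0_integralZl_EFin//; last first.
      by apply/measurable_EFinP; apply: measurable_indic; exact: measurable_box.
    by rewrite integral_indic_box// muleC.
  rewrite ge0_integralZl_EFin//; last 2 first.
    by apply/measurable_EFinP; exact: measurableT_comp.
    by rewrite exprn_ge0// mulr_ge0// ltW.
  rewrite lte_mul_pinfty// ?lee_fin ?exprn_ge0 ?mulr_ge0 ?ltW//.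
  by have /integrableP[] := iu.
have := measurable_fubini_F iF.
move=> mF; have mfine : measurable_fun setT (@fine R) by [].
have := measurableT_comp mfine mF.
apply: eq_measurable_fun => x _ /=; rewrite /Rintegral; congr fine.
rewrite /fubini_F [RHS]integral_mkcond; congr integral; apply/funext => y.
rewrite /f patchE /= indicE.
have -> : ((x, y) \in S) = (y \in box x r) by apply/idP/idP; rewrite !inE.
by case: ifPn => _; rewrite ?mul1r ?mul0r.
Qed.

(** The left side scales like r^N and the seminorm term like r^(N + s p). For large r the crowded
    set is empty, which gives Poincare; for small r the gain r^(s p) makes the seminorm term
    negligible, which gives compactness. *)
Lemma pmod_le_box r u : 0 < r -> Lp leb p u -> (forall x, ~ Omega x -> u x = 0) ->
  Lp leb2 p (D u) ->
  (((2 * r) ^+ N * pmod leb p u)%:E <= (2 + 2 `^ p)%:E *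
    ((Num.sqrt (N%:R * r ^+ 2) `^ (N%:R + s * p) * pmod leb2 p (D u))%:E +
     ((2 * r) ^+ N)%:E * \int[leb]_x (\1_(crowded r) x * `|box_avg r u x| `^ p)%:E))%E.
Proof.
move=> r0 lu u0 lDu; set V := (2 * r) ^+ N.
have V0 : 0 < V by rewrite exprn_gt0// mulr_gt0.
have [mu _] := lu; have iu := integrable_supported lu u0.
have mavg : measurable_fun setT (fun x => (\1_(crowded r) x * `|box_avg r u x| `^ p)%:E).
  apply/measurable_EFinP; apply: measurable_funM.
    by apply: measurable_indic; exact: measurable_crowded.
  by apply: measurable_powR_norm; exact: measurable_box_avg.
have avg0 x : (0 <= (\1_(crowded r) x * `|box_avg r u x| `^ p)%:E)%E.
  by rewrite lee_fin mulr_ge0 ?powR_ge0.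
have mosc : measurable_fun setT (box_osc r u).
  pose S := [set z : 'rV[R]_N * 'rV[R]_N | box z.1 r z.2].
  pose f (z : 'rV[R]_N * 'rV[R]_N) := (\1_S z * `|u z.1 - u z.2| `^ p)%:E.
  have mf : measurable_fun setT f.
    apply/measurable_EFinP; apply: measurable_funM.
      by apply: measurable_indic; exact: measurable_box_rel.
    apply: measurable_powR_norm; apply: measurable_funB.
      exact: (measurableT_comp mu measurable_fst).
    exact: (measurableT_comp mu measurable_snd).
  have f0 z : (0 <= f z)%E by rewrite lee_fin mulr_ge0// powR_ge0.
  apply: eq_measurable_fun (@measurable_fun_fubini_tonelli_F _ _ _ _ _ leb f mf f0) => x _.
  rewrite /fubini_F /box_osc [RHS]integral_mkcond; congr integral; apply/funext => y.
  rewrite /f patchE /= indicE.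
  have -> : ((x, y) \in S) = (y \in box x r) by apply/idP/idP; rewrite !inE.
  by case: ifPn => _; rewrite ?mul1r ?mul0r.
have osc0 x : (0 <= box_osc r u x)%E.
  by apply: integral_ge0 => y _; rewrite lee_fin powR_ge0.
have p20 : 0 <= 2 + 2 `^ p :> R by rewrite addr_ge0 ?powR_ge0.
rewrite EFinM pmodE// -ge0_integralZl_EFin// ?(ltW V0)//; last first.
  by apply/measurable_EFinP; exact: measurable_powR_norm.
apply: (@le_trans _ _ (\int[leb]_x ((2 + 2 `^ p)%:E * (box_osc r u x +
      V%:E * (\1_(crowded r) x * `|box_avg r u x| `^ p)%:E)))%E).
  apply: ge0_le_integral => //.
  - by move=> x _; rewrite -EFinM lee_fin mulr_ge0 ?powR_ge0// ltW.
  - by apply/measurable_EFinP; apply: measurable_funM => //; exact: measurable_powR_norm.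
  - apply: emeasurable_funM => //; apply: emeasurable_funD => //.
    exact: emeasurable_funM.
  - by move=> x _; rewrite -!EFinM; exact: powR_le_box.
rewrite ge0_integralZl_EFin//; last 2 first.
  by move=> x _; rewrite adde_ge0// mule_ge0// lee_fin ltW.
  by apply: emeasurable_funD => //; exact: emeasurable_funM.
apply: lee_wpmul2l => //.
rewrite ge0_integralD//; last 2 first.
  by move=> x _; rewrite mule_ge0// lee_fin ltW.
  exact: emeasurable_funM.
rewrite ge0_integralZl_EFin// ?(ltW V0)//.
apply: leeD2r; rewrite EFinM pmodE//; exact: box_osc_integral.
Qed.

(** For r = 1 + |Omega| the box has volume at least 2 r > 2 |Omega|, so no point is crowded and the
    average term of [pmod_le_box] is 0. *)
Lemma fractional_poincare : (0 < N)%N -> exists2 C : R, 0 < C & forall u,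
  Lp leb p u -> (forall x, ~ Omega x -> u x = 0) -> Lp leb2 p (D u) ->
  pmod leb p u <= C * pmod leb2 p (D u).
Proof.
move=> N0; pose r := 1 + fine (leb Omega).
have r1 : 1 <= r by rewrite lerDl fine_ge0.
have r0 : 0 < r by exact: lt_le_trans r1.
set V := (2 * r) ^+ N; have V0 : 0 < V by rewrite exprn_gt0// mulr_gt0.
have VO : (leb Omega <= (V / 2)%:E)%E.
  rewrite -(@fineK _ (leb Omega)) ?ge0_fin_numE// lee_fin.
  rewrite ler_pdivlMr//; apply: (@le_trans _ _ (2 * r)).
    by rewrite mulrC ler_pM2l// lerDr.
  rewrite /V -(prednK N0) exprS ler_peMr ?mulr_ge0 ?(ltW r0)//.
  by rewrite exprn_ege1//; lra.
have nC x : ~ crowded r x.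
  rewrite /crowded /= -/V => /lt_le_trans => /(_ (leb Omega)).
  have : (leb (box x r `&` Omega) <= leb Omega)%E.
    apply: le_measure; [|by rewrite inE|exact: subIsetr].
    by rewrite inE; apply: measurableI => //; exact: measurable_box.
  by move=> h /(_ h); rewrite ltNge VO.
pose C := (2 + 2 `^ p) * Num.sqrt (N%:R * r ^+ 2) `^ (N%:R + s * p) / V.
have p2 : 0 < 2 + 2 `^ p :> R by rewrite ltr_pwDl ?powR_ge0.
exists C.
  rewrite divr_gt0// mulr_gt0// powR_gt0// sqrtr_gt0 mulr_gt0 ?ltr0n//.
  exact: exprn_gt0.
move=> u lu u0 lDu; have := pmod_le_box r0 lu u0 lDu.
rewrite integral0_eq ?mule0 ?adde0; last first.
  by move=> x _; rewrite indicE memNset ?mul0r.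
rewrite -EFinM lee_fin -/V mulrA -ler_pdivlMl// => /le_trans; apply.
by rewrite /C mulrA [V^-1 * _]mulrC.
Qed.

(** First [r] is fixed so that the seminorm term contributes at most e/2 for every k; then the
    averages at that radius tend to 0, with dominated convergence on the crowded set. *)
Lemma fractional_compactness (u_ : nat -> 'rV[R]_N -> R) (M : R) : (0 < N)%N ->
  (forall k, Lp leb p (u_ k)) -> (forall k x, ~ Omega x -> u_ k x = 0) ->
  (forall k, Lp leb2 p (D (u_ k))) -> (forall k, pmod leb2 p (D (u_ k)) <= M) ->
  (forall r x, 0 < r -> box_avg r (u_ k) x @[k --> \oo] --> (0 : R)) ->
  pmod leb p (u_ k) @[k --> \oo] --> (0 : R).
Proof.
move=> N0 lu u0 lDu hM havg.
have [C C0 hC] := fractional_poincare N0.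
have avgcvg r : 0 < r -> (\int[leb]_x (\1_(crowded r) x * `|box_avg r (u_ k) x| `^ p)%:E)%E
    @[k --> \oo] --> 0%E.
  move=> r0; set V := (2 * r) ^+ N; have V0 : 0 < V by rewrite exprn_gt0// mulr_gt0.
  have iu k := integrable_supported (lu k) (u0 k).
  (* Uniform bound on the averages: [box_avg_bound], then Poincare and the seminorm bound [M]. *)
  pose B := 1 + C * M / V.
  have hB k x : `|box_avg r (u_ k) x| <= B.
    apply: le_trans (box_avg_bound x r0 (lu k) (iu k)) _.
    rewrite lerD2l ler_pM2r ?invr_gt0//; apply: le_trans (hC _ (lu k) (u0 k) (lDu k)) _.
    by rewrite ler_pM2l.
  have mC := measurable_crowded r.
  have fC := crowded_measure r0.
  have m1 : measurable_fun setT (\1_(crowded r) : 'rV[R]_N -> R) by exact: measurable_indic.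
  have [|||||_ _] := @dominated_convergence _ _ _ leb setT measurableT
    (fun k x => (\1_(crowded r) x * `|box_avg r (u_ k) x| `^ p)%:E) (cst 0%E)
    (fun x => (\1_(crowded r) x * B `^ p)%:E).
  - move=> k; apply/measurable_EFinP; apply: measurable_funM => //.
    by apply: measurable_powR_norm; exact: measurable_box_avg.
  - exact: measurable_cst.
  - apply: aeW => x _; rewrite -[X in _ --> X](_ : (\1_(crowded r) x * `|0 : R| `^ p)%:E = 0%E).
      apply: cvg_EFin; first exact: nearW.
      apply: cvgM; first exact: cvg_cst.
      exact: (cvg_comp _ _ (havg r x r0) (@continuous_powR_norm _ _ p1 _)).
    by rewrite normr0 powR0 ?mulr0// gt_eqF.
  - have i1 : leb.-integrable setT (EFin \o (\1_(crowded r) : _ -> R)).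
      apply/integrableP; split; first exact/measurable_EFinP.
      under eq_integral do rewrite /= ger0_norm//.
      by rewrite integral_indic ?setIT.
    by have := integrableZr measurableT (B `^ p) i1.
  - apply: aeW => x k _; rewrite lee_fin ger0_norm ?mulr_ge0 ?powR_ge0//.
    rewrite ler_wpM2l//; apply: ge0_ler_powR; rewrite ?nnegrE ?(ltW p0)//.
    exact: le_trans (hB k x).
  - by rewrite integral0.
apply/cvgr0Pnorm_le => e e0.
have M0 : 0 <= M by apply: le_trans (hM 0%N); exact: pmod_ge0.
pose c := (2 + 2 `^ p) : R; have c0 : 0 < c by rewrite ltr_pwDl ?powR_ge0.
have [r r0 hr] : exists2 r : R, 0 < r &
   c * (Num.sqrt (N%:R * r ^+ 2) `^ (N%:R + s * p) * M) <= (2 * r) ^+ N * (e / 2).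
  pose K : R := Num.sqrt N%:R `^ (N%:R + s * p).
  have K0 : 0 <= K by exact: powR_ge0.
  have cKM : 0 < c * K * M + 1 by rewrite ltr_wpDl// !mulr_ge0// ltW.
  (* The radius will satisfy r^(s p) = q, whence c K M r^(s p) <= e/2; the added 1 keeps the
     denominator positive when [M] is 0. *)
  pose q := e / 2 / (c * K * M + 1); have q0 : 0 < q by rewrite !divr_gt0.
  have sp0 : 0 < s * p by exact: mulr_gt0.
  have r0 : 0 < q `^ (s * p)^-1 by exact: powR_gt0.
  exists (q `^ (s * p)^-1) => //; set r := _ `^ _ in r0 *.
  rewrite sqrtrM// sqrtr_sqr (gtr0_norm r0) powRM ?sqrtr_ge0 ?(ltW r0)// -/K.
  rewrite powRD ?(gt_eqF r0) ?implybT// powR_mulrn ?(ltW r0)//.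
  rewrite {2}/r -powRrM mulVf ?gt_eqF// powRr1 ?(ltW q0)//.
  rewrite exprMn.
  rewrite (_ : c * _ = r ^+ N * (q * (c * K * M))); last by ring.
  rewrite (_ : _ * (e / 2) = r ^+ N * (2 ^+ N * (e / 2))); last by ring.
  rewrite ler_pM2l ?exprn_gt0//.
  apply: (@le_trans _ _ (e / 2)).
    have qE : q * (c * K * M + 1) = e / 2 by rewrite /q divfK ?gt_eqF.
    by rewrite -qE ler_pM2l// lerDl.
  by rewrite ler_peMl ?divr_ge0 ?(ltW e0)// exprn_ege1// ler1n.
set V := (2 * r) ^+ N; have V0 : 0 < V by rewrite exprn_gt0// mulr_gt0.
have /fine_cvgP[fin /cvgr0Pnorm_le] := avgcvg _ r0.
have ec0 : 0 < e / (2 * c) by rewrite divr_gt0// mulr_gt0.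
move=> /(_ _ ec0); move: fin; apply: filterS2 => k fk /= hk.
rewrite ger0_norm ?pmod_ge0//.
have := pmod_le_box r0 (lu k) (u0 k) (lDu k); rewrite -(fineK fk) -/V -/c.
move: hk; set I := fine _ => hk h0.
have h : V * pmod leb p (u_ k) <= c * (Num.sqrt (N%:R * r ^+ 2) `^ (N%:R + s * p) *
   pmod leb2 p (D (u_ k)) + V * I) by exact: h0.
rewrite -(ler_pM2l V0); apply: le_trans h _; rewrite mulrDr (splitr e) mulrDr.
apply: lerD.
  by apply: le_trans hr; rewrite ler_pM2l// ler_wpM2l ?powR_ge0.
rewrite mulrCA ler_pM2l// mulrC -ler_pdivlMr//.
move: hk; rewrite ler_norml => /andP[_]; rewrite invfM mulrA; exact.
Qed.

End poincare.

(** * Transfers between L^p classes, modulars and a.e. equality *)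

Lemma LfunP_modular {R : realType} d (T : measurableType d)
    (mu : {measure set T -> \bar R}) (p : R) (u : T -> R) : 1 < p ->
  u \in Lfun mu p%:E <-> Lp mu p u.
Proof.
move=> p1; split => [uL|[mu' iu]].
  split; last by apply: Lfun_integrable => //; exact: ltW.
  by move: uL; rewrite inE => /andP[/[!inE]].
rewrite inE; apply/andP; split; first by rewrite inE.
rewrite inE /= /finite_norm unlock /=; apply: poweR_lty.
by have := integrable_lty measurableT iu.
Qed.

Lemma ae_eq_pmod0 {R : realType} d (T : measurableType d)
    (mu : {measure set T -> \bar R}) (p : R) (u : T -> R) : 1 < p ->
  Lp mu p u -> pmod mu p u = 0 -> {ae mu, forall x, u x = 0}.
Proof.
move=> p1 lu u0; have [mu' iu] := lu.
have : (\int[mu]_x `|(`|u x| `^ p)%:E| = 0)%E.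
  under eq_integral do rewrite abse_EFin ger0_norm ?powR_ge0//.
  by rewrite -pmodE// u0.
have mup : measurable_fun setT (EFin \o (fun x => `|u x| `^ p)).
  by apply/measurable_EFinP; exact: measurable_powR_norm.
move=> /(ae_eq_integral_abs mu measurableT mup); apply: filterS => x /(_ I) /= [].
by move/powR_eq0_eq0/eqP; rewrite normr_eq0 => /eqP.
Qed.

Lemma Lp_dominated {R : realType} d (T : measurableType d)
    (mu : {measure set T -> \bar R}) (p : R) (f g : T -> R) : 1 < p ->
  measurable_fun setT g -> (forall x, `|g x| <= `|f x|) -> Lp mu p f ->
  Lp mu p g /\ pmod mu p g <= pmod mu p f.
Proof.
move=> p1 mg gf [mf lf].
have gfp x : `|g x| `^ p <= `|f x| `^ p.
  by apply: ge0_ler_powR; rewrite ?nnegrE// ltW// (lt_trans ltr01).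
have lg : Lp mu p g.
  split => //; apply: integrable_le lf _; first exact: measurable_powR_norm.
  by move=> x; rewrite ger0_norm ?powR_ge0.
split => //; rewrite !pmod_def; apply: le_Rintegral => //.
by have [] := lg.
Qed.

Lemma Lp_ae {R : realType} d (T : measurableType d)
    (mu : {measure set T -> \bar R}) (p : R) (f g : T -> R) :
  measurable_fun setT g -> {ae mu, forall x, f x = g x} -> Lp mu p f ->
  Lp mu p g.
Proof.
move=> mg fg lf; apply: (@LpP _ _ _ mu p _ (pmod mu p f) mg _).1.
rewrite pmodE// le_eqVlt; apply/orP; left; apply/eqP.
apply: ae_eq_integral => //.
- by apply/measurable_EFinP; exact: measurable_powR_norm.
- by apply/measurable_EFinP; apply: measurable_powR_norm; have [] := lf.
- by apply: filterS fg => x ->.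
Qed.

Lemma Rintegral_ae {R : realType} d (T : measurableType d)
    (mu : {measure set T -> \bar R}) (f g : T -> R) :
  measurable_fun setT f -> measurable_fun setT g ->
  {ae mu, forall x, f x = g x} -> \int[mu]_x f x = \int[mu]_x g x.
Proof.
move=> mf mg fg; rewrite /Rintegral; congr fine; apply: ae_eq_integral => //.
- exact/measurable_EFinP.
- exact/measurable_EFinP.
- by apply: filterS fg => x ->.
Qed.

(** * The space W_0^{s,p} and its dual, in terms of modulars *)

Section sobolev.
Context {R : realType} {N : nat}.
Variables (s p : R) (Omega : set 'rV[R]_N).
Hypotheses (s0 : 0 < s) (p1 : 1 < p) (oOmega : open Omega).

Notation leb := (lebN R N).
Notation leb2 := (lebN2 R N).
Notation D := (sp_gradient s p).
Notation W0 := (Wsp0 s p Omega).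
Implicit Types (u v w f g : 'rV[R]_N -> R).

Let p0 : 0 < p. Proof. exact: lt_trans p1. Qed.

Let pi0 : 0 < p^-1. Proof. by rewrite invr_gt0. Qed.

(** Real-valued p-th power of [Wsp_norm], see [sobolev_normE]. Its triangle inequality carries a
    factor 2^p, which limit arguments absorb. *)
Definition smod u : R := pmod leb p u + pmod leb2 p (D u).

Definition sobolev u := Lp leb p u /\ Lp leb2 p (D u).

Lemma enorm_powR_sp (x : 'rV[R]_N) :
  (enorm x `^ (N%:R / p + s)) `^ p = enorm x `^ (N%:R + s * p).
Proof. by rewrite -powRrM mulrDl divfK ?gt_eqF. Qed.

Lemma powR_sp_gradient u z : `|D u z| `^ p =
  `|u z.1 - u z.2| `^ p / enorm (z.1 - z.2) `^ (N%:R + s * p).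
Proof.
rewrite /sp_gradient normrM normfV [`|_ `^ _|]ger0_norm ?powR_ge0//.
rewrite powRM// ?invr_ge0 ?powR_ge0//; congr (_ * _).
by rewrite -enorm_powR_sp -powRN -powRrM -powRN -powRrM mulNr mulrN.
Qed.

Lemma sp_gradientD c u v z : D (fun x => c * u x + v x) z = c * D u z + D v z.
Proof. by rewrite /sp_gradient; ring. Qed.

Lemma sp_gradientB u v z : D (fun x => u x - v x) z = D u z - D v z.
Proof. by rewrite /sp_gradient; ring. Qed.

Lemma sp_gradientZ c u z : D (fun x => c * u x) z = c * D u z.
Proof. by rewrite /sp_gradient; ring. Qed.

Lemma gagliardoE u :
  (gagliardo s p u = (\int[leb2]_z (`|D u z| `^ p)%:E) `^ p^-1)%E.
Proof.
by rewrite /gagliardo; congr poweR; apply: eq_integral => z _; rewrite powR_sp_gradient.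
Qed.

Lemma Wsp_normE u : (Wsp_norm s p u =
  (\int[leb]_x (`|u x| `^ p)%:E + \int[leb2]_z (`|D u z| `^ p)%:E) `^ p^-1)%E.
Proof.
rewrite /Wsp_norm gagliardoE -poweRrM mulVf ?gt_eqF// poweRe1; last first.
  by apply: integral_ge0 => z _; rewrite lee_fin powR_ge0.
by rewrite poweR_Lnorm ?gt_eqF.
Qed.

Lemma WspP u : Wsp s p u <-> sobolev u.
Proof.
rewrite /Wsp /sobolev /= LfunP_modular//; split=> -[lu h]; split => //.
  have mD : measurable_fun setT (D u).
    by apply: measurable_sp_gradient; have [] := lu.
  have fin : (\int[leb2]_z (`|D u z| `^ p)%:E < +oo)%E.
    rewrite ltey; apply/eqP => E; move: h; rewrite gagliardoE E.
    by rewrite poweRyr ?ltxx// gt_eqF.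
  apply: (@LpP _ _ _ leb2 p _ (fine (\int[leb2]_z (`|D u z| `^ p)%:E)%E) mD _).1.
  rewrite fineK// ge0_fin_numE//.
  by apply: integral_ge0 => z _; rewrite lee_fin powR_ge0.
by rewrite gagliardoE -pmodE// poweR_EFin ltry.
Qed.

Lemma sobolev_normE u : sobolev u -> (Wsp_norm s p u = (smod u `^ p^-1)%:E)%E.
Proof. by move=> [lu lD]; rewrite Wsp_normE -!pmodE// -EFinD poweR_EFin. Qed.

Lemma smod_ge0 u : 0 <= smod u.
Proof. by rewrite addr_ge0// pmod_ge0. Qed.

(** Finiteness comes first: an infinite modular would make the norm infinite, since +oo to the power
    1/p is +oo. *)
Lemma Wsp_norm_lt u e : measurable_fun setT u -> 0 < e ->
  (Wsp_norm s p u < e%:E)%E <-> sobolev u /\ smod u < e `^ p.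
Proof.
move=> mu e0; split => [h|[su h]]; last first.
  rewrite sobolev_normE// lte_fin -[ltRHS](powRr1 (ltW e0)).
  rewrite -[X in _ < _ `^ X](@mulfV _ p) ?gt_eqF// powRrM.
  by apply: gt0_ltr_powR; rewrite ?nnegrE ?powR_ge0 ?smod_ge0.
have i1 : (0 <= \int[leb]_x (`|u x| `^ p)%:E)%E.
  by apply: integral_ge0 => z _; rewrite lee_fin powR_ge0.
have i2 : (0 <= \int[leb2]_z (`|D u z| `^ p)%:E)%E.
  by apply: integral_ge0 => z _; rewrite lee_fin powR_ge0.
have fin : (\int[leb]_x (`|u x| `^ p)%:E + \int[leb2]_z (`|D u z| `^ p)%:E < +oo)%E.
  rewrite ltey; apply/eqP => E; move: h; rewrite Wsp_normE E.
  by rewrite poweRyr// gt_eqF.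
have su : sobolev u.
  split.
    apply: (@LpP _ _ _ leb p _ (fine (\int[leb]_x (`|u x| `^ p)%:E)%E) mu _).1.
    rewrite fineK// ge0_fin_numE//; apply: le_lt_trans fin.
    by rewrite leeDl.
  apply: (@LpP _ _ _ leb2 p _ (fine (\int[leb2]_z (`|D u z| `^ p)%:E)%E)
    (measurable_sp_gradient s p mu) _).1.
  rewrite fineK// ge0_fin_numE//; apply: le_lt_trans fin.
  by rewrite leeDr.
split => //; move: h; rewrite sobolev_normE// lte_fin.
move=> /(gt0_ltr_powR p0); rewrite -powRrM mulVf ?gt_eqF// powRr1 ?smod_ge0//.
by apply; rewrite nnegrE ?powR_ge0 ?(ltW e0).
Qed.

Lemma sobolev_lincomb c u v : sobolev u -> sobolev v ->
  sobolev (fun x => c * u x + v x).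
Proof.
move=> [lu lDu] [lv lDv]; split; first exact: Lp_lincomb.
have := Lp_lincomb p1 c lDu lDv; congr Lp.
by apply/funext => z; rewrite sp_gradientD.
Qed.

Lemma sobolevB u v : sobolev u -> sobolev v -> sobolev (fun x => u x - v x).
Proof.
move=> su sv; have := sobolev_lincomb (-1) sv su.
by congr sobolev; apply/funext => x; rewrite mulN1r addrC.
Qed.

Lemma sobolevD u v : sobolev u -> sobolev v -> sobolev (fun x => u x + v x).
Proof.
move=> su sv; have := sobolev_lincomb 1 su sv.
by congr sobolev; apply/funext => x; rewrite mul1r.
Qed.

Lemma smodD_le u v : sobolev u -> sobolev v ->
  smod (fun x => u x + v x) <= 2 `^ p * (smod u + smod v).
Proof.
move=> [lu lDu] [lv lDv]; rewrite /smod.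
have -> : D (fun x => u x + v x) = (fun z => D u z + D v z).
  by apply/funext => z; rewrite /sp_gradient; ring.
have h1 := pmodD_le p1 lu lv; have h2 := pmodD_le p1 lDu lDv.
rewrite addrACA mulrDr; exact: lerD.
Qed.

Lemma smod_distrC u v : smod (fun x => u x - v x) = smod (fun x => v x - u x).
Proof.
rewrite /smod pmod_distrC; congr (_ + _).
rewrite (_ : D (fun x => v x - u x) = fun z => - D (fun x => u x - v x) z) ?pmodN//.
by apply/funext => z; rewrite /sp_gradient; ring.
Qed.

Lemma smodZ c u : sobolev u -> smod (fun x => c * u x) = `|c| `^ p * smod u.
Proof.
move=> [lu lDu]; rewrite /smod pmodZ// mulrDr; congr (_ + _).
rewrite -pmodZ//; congr pmod; by apply/funext => z; rewrite sp_gradientZ.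
Qed.

Lemma Cc_infty_measurable f : Cc_infty Omega f -> measurable_fun setT f.
Proof. by move=> [/(_ 0%N) cf _ _]; exact: continuous_measurable_rV. Qed.

Lemma Cc_infty_out f x : Cc_infty Omega f -> ~ Omega x -> f x = 0.
Proof.
move=> [_ _ sub] Ox; apply/eqP/negPn/negP => fx; apply/Ox/sub.
exact: subset_closure.
Qed.

Lemma Ck_lincomb k c f g : Ck k f -> Ck k g -> Ck k (fun x => c * f x + g x).
Proof.
elim: k f g => [|k IH] f g /=.
  move=> cf cg x; apply: (@continuousD _ _ _ (fun y => c * f y) g); last exact: cg.
  by apply: (@continuousM _ _ (cst c) f); [exact: cst_continuous|exact: cf].
move=> [cf hf] [cg hg]; split.
  move=> x; apply: (@continuousD _ _ _ (fun y => c * f y) g); last exact: cg.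
  by apply: (@continuousM _ _ (cst c) f); [exact: cst_continuous|exact: cf].
move=> i; have [df kf] := hf i; have [dg kg] := hg i.
have dcf x : derivable (fun x => c * f x) x (delta_mx ord0 i).
  exact: derivableZ.
split; first by move=> x; exact: derivableD.
have -> : (fun x => 'D_(delta_mx ord0 i) (fun x => c * f x + g x) x) =
    (fun x => c * 'D_(delta_mx ord0 i) f x + 'D_(delta_mx ord0 i) g x).
  apply/funext => x.
  transitivity ('D_(delta_mx ord0 i) (fun x => c * f x) x + 'D_(delta_mx ord0 i) g x).
    exact: deriveD.
  by congr (_ + _); exact: deriveZ.
exact: IH.
Qed.

Lemma Cc_infty_lincomb c f g : Cc_infty Omega f -> Cc_infty Omega g ->
  Cc_infty Omega (fun x => c * f x + g x).
Proof.
move=> [kf cf sf] [kg cg sg].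
have sub : closure [set x | c * f x + g x != 0] `<=`
    closure [set x | f x != 0] `|` closure [set x | g x != 0].
  rewrite -closureU; apply: closure_subset => x /= h.
  apply: contrapT => /not_orP[/negP /negPn/eqP f0 /negP/negPn/eqP g0].
  by move: h; rewrite f0 g0 mulr0 addr0 eqxx.
split; first by move=> k; exact: Ck_lincomb.
  apply: (subclosed_compact _ _ sub); first exact: closed_closure.
  exact: compactU.
by move=> x /sub[/sf|/sg].
Qed.

Lemma Cc_infty0 : Cc_infty Omega (fun=> 0 : R).
Proof.
have E : [set x : 'rV[R]_N | (0 : R) != 0] = set0.
  by apply/seteqP; split => x //=; rewrite eqxx.
split; last 2 first.
- by rewrite E closure0; exact: compact0.
- by rewrite E closure0.
elim=> [|k IH] /=; first by move=> x; exact: cst_continuous.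
split; first by move=> x; exact: cst_continuous.
move=> i; split; first by move=> x; exact: derivable_cst.
have -> // : (fun x => 'D_(delta_mx ord0 i) (fun=> 0 : R) x) = (fun=> 0 : R) :> ('rV[R]_N -> R).
by apply/funext => x; exact: derive_cst.
Qed.

Lemma Wsp0P u : W0 u <-> sobolev u /\ forall e, 0 < e ->
  exists2 f, Cc_infty Omega f & sobolev (fun x => u x - f x) /\
    smod (fun x => u x - f x) < e.
Proof.
rewrite /Wsp0 /= WspP; split => -[su h]; split => // e e0;
    have mu : measurable_fun setT u by have [[]] := su.
  have [|f cf] := h (e `^ p^-1); first exact: powR_gt0.
  have mf := Cc_infty_measurable cf.
  move=> /(Wsp_norm_lt (measurable_funB mu mf)).
  rewrite -powRrM mulVf ?gt_eqF// powRr1 ?(ltW e0)// powR_gt0// => /(_ isT) h'.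
  by exists f.
have [|f cf h'] := h (e `^ p); first exact: powR_gt0.
exists f => //; apply/Wsp_norm_lt => //.
exact: (measurable_funB mu (Cc_infty_measurable cf)).
Qed.

Lemma Wsp0_sobolev u : W0 u -> sobolev u.
Proof. by move=> /Wsp0P[]. Qed.

Lemma Wsp0_lincomb c u v : W0 u -> W0 v -> W0 (fun x => c * u x + v x).
Proof.
move=> /Wsp0P[su hu] /Wsp0P[sv hv]; apply/Wsp0P; split.
  exact: sobolev_lincomb.
move=> e e0; pose k := 2 `^ p * (`|c| `^ p + 1); have k0 : 0 < k.
  by rewrite mulr_gt0 ?powR_gt0// ltr_wpDl ?powR_ge0.
have [f cf [sf hf]] := hu _ (divr_gt0 e0 k0).
have [g cg [sg hg]] := hv _ (divr_gt0 e0 k0).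
exists (fun x => c * f x + g x); first exact: Cc_infty_lincomb.
have -> : (fun x => c * u x + v x - (c * f x + g x)) =
    (fun x => c * (u x - f x) + (v x - g x)) by apply/funext => x; ring.
split; first exact: sobolev_lincomb.
have scf : sobolev (fun x => c * (u x - f x)).
  have := sobolev_lincomb (c - 1) sf sf; congr sobolev; apply/funext => x; ring.
apply: le_lt_trans (smodD_le scf sg) _; rewrite smodZ//.
have h1 : `|c| `^ p * smod (fun x => u x - f x) <= `|c| `^ p * (e / k).
  by rewrite ler_wpM2l ?powR_ge0// ltW.
have : 2 `^ p * (`|c| `^ p * smod (fun x => u x - f x) + smod (fun x => v x - g x))
    < 2 `^ p * (`|c| `^ p * (e / k) + e / k).
  by rewrite ltr_pM2l ?powR_gt0// ler_ltD.
move=> /lt_le_trans; apply.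
rewrite -{2}[e / k]mul1r -mulrDl mulrA -/k mulrC divfK ?gt_eqF//.
Qed.

Lemma Wsp00 : W0 (fun=> 0).
Proof.
have s00 : sobolev (fun=> 0) /\ smod (fun=> 0) = 0.
  have D0 : D (fun=> 0) = (fun _ : 'rV[R]_N * 'rV[R]_N => 0 : R).
    by apply/funext => z; rewrite /sp_gradient subrr mul0r.
  have h d (T : measurableType d) (mu : {measure set T -> \bar R}) :
      Lp mu p (fun=> 0) /\ pmod mu p (fun=> 0) <= 0.
    apply: LpP => //.
    by rewrite integral0_eq// => x _; rewrite normr0 powR0 ?gt_eqF.
  have [h1 h2] := h _ _ leb; have [h3 h4] := h _ _ leb2.
  split; first by split => //; rewrite D0.
  by apply/eqP; rewrite eq_le smod_ge0 andbT -[leRHS]addr0 lerD// D0.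
apply/Wsp0P; split; first exact: s00.1.
move=> e e0; exists (fun=> 0); first exact: Cc_infty0.
rewrite (_ : (fun=> _) = (fun=> 0)); last by apply/funext => x; rewrite subrr.
by split; [exact: s00.1|rewrite s00.2].
Qed.

Lemma Wsp0Z c u : W0 u -> W0 (fun x => c * u x).
Proof.
move=> wu; have := Wsp0_lincomb c wu Wsp00.
by congr W0; apply/funext => x; rewrite addr0.
Qed.

Lemma Wsp0D u v : W0 u -> W0 v -> W0 (fun x => u x + v x).
Proof.
move=> wu wv; have := Wsp0_lincomb 1 wu wv.
by congr W0; apply/funext => x; rewrite mul1r.
Qed.

Lemma Wsp0B u v : W0 u -> W0 v -> W0 (fun x => u x - v x).
Proof.
move=> wu wv; have := Wsp0_lincomb (-1) wv wu.
by congr W0; apply/funext => x; rewrite mulN1r addrC.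
Qed.

Lemma Wsp0_closed u : sobolev u -> (forall e, 0 < e ->
  exists2 w, W0 w & smod (fun x => u x - w x) < e) -> W0 u.
Proof.
move=> su h; apply/Wsp0P; split => // e e0.
pose k : R := 2 `^ p * 2; have k0 : 0 < k by rewrite mulr_gt0 ?powR_gt0.
have [w /Wsp0P[sw hw] uw] := h _ (divr_gt0 e0 k0).
have [f cf [sf wf]] := hw _ (divr_gt0 e0 k0).
exists f => //.
have -> : (fun x => u x - f x) = (fun x => (u x - w x) + (w x - f x)).
  by apply/funext => x; ring.
have suw := sobolevB su sw.
split; first exact: sobolevD.
apply: le_lt_trans (smodD_le suw sf) _.
have -> : e = 2 `^ p * (e / k + e / k).
  by rewrite /k; field; rewrite gt_eqF// powR_gt0.
by rewrite ltr_pM2l ?powR_gt0// ltrD.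
Qed.

(** This is what makes [D u] depend, up to null sets, only on the class of [u], and what carries
    a.e. convergence of functions to their gradients. *)
Lemma ae_prod (P : 'rV[R]_N -> Prop) : {ae leb, forall x, P x} ->
  {ae leb2, forall z, P z.1 /\ P z.2}.
Proof.
move=> [A [mA A0 AP]].
exists (A `*` setT `|` setT `*` A); split.
- by apply: measurableU; exact: measurableX.
- have h1 : leb2 (A `*` setT) = 0%E.
    apply: etrans (@product_measure1E _ _ _ _ R leb leb _ _ mA measurableT) _.
    exact: etrans (congr1 (fun x => x * _)%E A0) (mul0e _).
  have h2 : leb2 (setT `*` A) = 0%E.
    apply: etrans (@product_measure1E _ _ _ _ R leb leb _ _ measurableT mA) _.
    exact: etrans (congr1 (fun x => _ * x)%E A0) (mule0 _).
  by rewrite null_set_setU//; exact: measurableX.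
- move=> z /= /not_andP[h|h]; [left|right]; split => //; exact: AP.
Qed.

Lemma sp_gradient_ae u v : {ae leb, forall x, u x = v x} ->
  {ae leb2, forall z, D u z = D v z}.
Proof. by move=> /ae_prod; apply: filterS => z [h1 h2]; rewrite /sp_gradient h1 h2. Qed.

Lemma smod_ae0 u v : measurable_fun setT u -> measurable_fun setT v ->
  {ae leb, forall x, u x = v x} -> smod (fun x => u x - v x) = 0.
Proof.
move=> mu mv uv.
have h d (T : measurableType d) (nu : {measure set T -> \bar R}) (f : T -> R) :
    measurable_fun setT f -> {ae nu, forall x, f x = 0} -> pmod nu p f = 0.
  move=> mf f0; rewrite pmod_def (@Rintegral_ae _ _ _ _ _ (cst 0))//.
  - by rewrite Rintegral_cst// mul0r.
  - exact: measurable_powR_norm.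
  - by apply: filterS f0 => x ->; rewrite normr0 powR0 ?gt_eqF.
have muv : measurable_fun setT (fun x => u x - v x) by exact: measurable_funB.
have ae0 : {ae leb, forall x, u x - v x = 0}.
  by apply: filterS uv => x ->; rewrite subrr.
rewrite /smod !h ?addr0//; first exact: measurable_sp_gradient.
by apply: filterS (ae_prod ae0) => z [h1 h2]; rewrite /sp_gradient h1 h2 subrr mul0r.
Qed.

Lemma Wsp0_ae u v : W0 u -> measurable_fun setT v ->
  {ae leb, forall x, u x = v x} -> W0 v.
Proof.
move=> wu mv uv; have [lu lDu] := Wsp0_sobolev wu.
have mu : measurable_fun setT u by have [] := lu.
have sv : sobolev v.
  split; first exact: Lp_ae lu.
  apply: Lp_ae (sp_gradient_ae uv) lDu; exact: measurable_sp_gradient.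
apply: Wsp0_closed => // e e0; exists u => //.
by rewrite smod_ae0//; apply: filterS uv => x ->.
Qed.

Let mOmega : measurable Omega. Proof. exact: open_measurable_rV. Qed.

Lemma zero_extE u x : zero_ext Omega u x = \1_Omega x * u x.
Proof.
by rewrite /zero_ext patchE indicE; case: ifPn => _; rewrite ?mul1r ?mul0r.
Qed.

Lemma zero_ext_out u x : ~ Omega x -> zero_ext Omega u x = 0.
Proof. by move=> Ox; rewrite zero_extE indicE memNset ?mul0r. Qed.

Lemma zero_ext_id u : zero_ext Omega (zero_ext Omega u) = zero_ext Omega u.
Proof.
apply/funext => x; rewrite !zero_extE indicE.
by case: (x \in Omega); rewrite ?mul1r ?mul0r.
Qed.

Lemma measurable_zero_ext u : measurable_fun setT u ->
  measurable_fun setT (zero_ext Omega u).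
Proof.
move=> mu; rewrite (_ : zero_ext Omega u = fun x => \1_Omega x * u x); last first.
  by apply/funext => x; rewrite zero_extE.
by apply: measurable_funM => //; exact: measurable_indic.
Qed.

(** Test functions vanish off [Omega], so [u] minus its zero extension is dominated pointwise by u -
    f for every test function f, and its modular is arbitrarily small. *)
Lemma Wsp0_supported u : W0 u -> {ae leb, forall x, u x = zero_ext Omega u x}.
Proof.
move=> wu; have /Wsp0P[[lu lDu] hu] := wu.
have [mu _] := lu; have mz := measurable_zero_ext mu.
pose h x := u x - zero_ext Omega u x.
have mh : measurable_fun setT h by exact: measurable_funB.
have hE x : h x = (1 - \1_Omega x) * u x by rewrite /h zero_extE; ring.
have hle f x : Cc_infty Omega f -> `|h x| <= `|u x - f x|.
  move=> cf; rewrite hE indicE; case: (boolP (x \in Omega)) => [_|].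
    by rewrite subrr mul0r normr0.
  by rewrite notin_setE => Ox; rewrite subr0 mul1r (Cc_infty_out cf Ox) subr0.
have lh : Lp leb p h.
  have [f cf [[lf _] _]] := hu _ ltr01.
  by have [] := Lp_dominated p1 mh (fun x => hle f x cf) lf.
have h0 : pmod leb p h = 0.
  apply/eqP; rewrite eq_le pmod_ge0 andbT; apply/ler_addgt0Pr => e e0.
  rewrite add0r; have [f cf [[lf lDf] fe]] := hu _ e0.
  have [_ hf] := Lp_dominated p1 mh (fun x => hle f x cf) lf.
  apply: le_trans hf (ltW (le_lt_trans _ fe)).
  by rewrite /smod lerDl pmod_ge0.
by apply: filterS (ae_eq_pmod0 p1 lh h0) => x /eqP; rewrite subr_eq0 => /eqP.
Qed.

Lemma Wsp0_zero_ext u : W0 u -> W0 (zero_ext Omega u).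
Proof.
move=> wu; apply: (Wsp0_ae wu); last exact: Wsp0_supported.
by apply: measurable_zero_ext; have [[]] := Wsp0_sobolev wu.
Qed.

Section duals.
Variable l : ('rV[R]_N -> R) -> R.

(** Linearity improves a bound that is only affine in the modular: applied to c u with c = (smod
    u)^(-1/p), it yields the constant 2 A. If the modular is 0, arbitrary c is allowed and l u must
    be 0. *)
Lemma Wsp0_dualP (A : R) :
  (forall c u v, W0 u -> W0 v -> l (fun x => c * u x + v x) = c * l u + l v) ->
  (forall u, W0 u -> `|l u| <= A * (1 + smod u)) -> Wsp0_dual s p Omega l.
Proof.
move=> lin hA; split => //; exists (2 * A) => u wu.
have A0 : 0 <= A.
  have := hA _ Wsp00; move=> /(le_trans (normr_ge0 _)).
  by rewrite pmulr_lge0// ltr_pwDl// smod_ge0.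
have su := Wsp0_sobolev wu.
have l0 : l (fun=> 0) = 0.
  have := lin 1 _ _ Wsp00 Wsp00.
  rewrite (_ : (fun x => _) = (fun=> 0)); last by apply/funext => x; rewrite mul1r addr0.
  by lra.
have lZ c : l (fun x => c * u x) = c * l u.
  have := lin c _ _ wu Wsp00; rewrite l0 addr0 => <-; congr l.
  by apply/funext => x; rewrite addr0.
have hc c : 0 < c -> c * `|l u| <= A * (1 + c `^ p * smod u).
  move=> c0; have := hA _ (Wsp0Z c wu); rewrite lZ normrM smodZ//.
  by rewrite gtr0_norm.
rewrite sobolev_normE// -EFinM lee_fin.
have [m0|m0] := eqVneq (smod u) 0.
  rewrite m0 powR0 ?gt_eqF// mulr0.
  rewrite leNgt; apply/negP => lu0.
  (* On this multiple of [u] the functional has absolute value A + 1, above the bound A. *)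
  have := hc ((A + 1) / `|l u|); rewrite divr_gt0 ?ltr_wpDl// => /(_ isT).
  by rewrite m0 mulr0 addr0 mulr1 divfK ?gt_eqF// leNgt ltrDl ltr01.
have {}m0 : 0 < smod u by rewrite lt0r m0 smod_ge0.
have c0 : 0 < smod u `^ p^-1 by exact: powR_gt0.
have := hc (smod u `^ p^-1)^-1; rewrite invr_gt0 => /(_ c0).
rewrite mulrC ler_pdivrMr// => /le_trans; apply.
rewrite -powRN -powRrM mulNr mulVf ?gt_eqF// powRN powRr1 ?smod_ge0//.
by rewrite mulVf ?gt_eqF// [A * _]mulrC.
Qed.

Hypothesis dl : Wsp0_dual s p Omega l.

Lemma Wsp0_dual_lincomb c u v : W0 u -> W0 v ->
  l (fun x => c * u x + v x) = c * l u + l v.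
Proof. by have [h _] := dl; exact: h. Qed.

Lemma Wsp0_dual0 : l (fun=> 0) = 0.
Proof.
have := Wsp0_dual_lincomb 1 Wsp00 Wsp00.
rewrite (_ : (fun x => _) = (fun=> 0)); last by apply/funext => x; rewrite mul1r addr0.
by lra.
Qed.

Lemma Wsp0_dualZ c u : W0 u -> l (fun x => c * u x) = c * l u.
Proof.
move=> wu; have := Wsp0_dual_lincomb c wu Wsp00; rewrite Wsp0_dual0 addr0 => <-.
by congr l; apply/funext => x; rewrite addr0.
Qed.

Lemma Wsp0_dualB u v : W0 u -> W0 v -> l (fun x => u x - v x) = l u - l v.
Proof.
move=> wu wv; have := Wsp0_dual_lincomb (-1) wv wu; rewrite mulN1r addrC => <-.
by congr l; apply/funext => x; rewrite mulN1r addrC.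
Qed.

Lemma Wsp0_dualD u v : W0 u -> W0 v -> l (fun x => u x + v x) = l u + l v.
Proof.
move=> wu wv; have := Wsp0_dual_lincomb 1 wu wv; rewrite mul1r => <-.
by congr l; apply/funext => x; rewrite mul1r.
Qed.

Lemma Wsp0_dual_bound : exists2 C : R, 0 < C &
  forall u, W0 u -> `|l u| <= C * smod u `^ p^-1.
Proof.
have [_ [C hC]] := dl; exists (`|C| + 1); first by rewrite ltr_wpDl.
move=> u wu; have := hC u wu; rewrite sobolev_normE; last exact: Wsp0_sobolev.
rewrite -EFinM lee_fin => /le_trans; apply; apply: ler_wpM2r; first exact: powR_ge0.
by rewrite (le_trans (ler_norm _))// lerDl.
Qed.

Lemma Wsp0_dual_cvg (u_ : nat -> 'rV[R]_N -> R) u : (forall k, W0 (u_ k)) -> W0 u ->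
  smod (fun x => u_ k x - u x) @[k --> \oo] --> (0 : R) ->
  l (u_ k) @[k --> \oo] --> l u.
Proof.
move=> wu_ wu h; have [C C0 hC] := Wsp0_dual_bound.
apply/cvgrPdist_le => e e0.
have ec : 0 < (e / C) `^ p by rewrite powR_gt0// divr_gt0.
apply: (filterS _ ((cvgr0Pnorm_le _).1 h _ ec)) => k.
rewrite ger0_norm ?smod_ge0// => hk.
rewrite distrC -Wsp0_dualB//; apply: le_trans (hC _ (Wsp0B (wu_ k) wu)) _.
rewrite mulrC -ler_pdivlMr//.
apply: (@le_trans _ _ (((e / C) `^ p) `^ p^-1)).
  by apply: ge0_ler_powR; rewrite ?nnegrE ?powR_ge0 ?smod_ge0 ?(ltW pi0).
by rewrite -powRrM mulfV ?gt_eqF// powRr1// divr_ge0 ?ltW.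
Qed.

End duals.

End sobolev.

Lemma pmod_ae {R : realType} d (T : measurableType d)
    (mu : {measure set T -> \bar R}) (p : R) (f g : T -> R) :
  measurable_fun setT f -> measurable_fun setT g ->
  {ae mu, forall x, f x = g x} -> pmod mu p f = pmod mu p g.
Proof.
move=> mf mg fg; rewrite !pmod_def; apply: Rintegral_ae.
- exact: measurable_powR_norm.
- exact: measurable_powR_norm.
- by apply: filterS fg => x ->.
Qed.

Lemma pmod_midpoint {R : realType} d (T : measurableType d)
    (mu : {measure set T -> \bar R}) (p : R) (f g : T -> R) : 1 < p ->
  Lp mu p f -> Lp mu p g ->
  pmod mu p (fun x => (f x + g x) / 2) <= (pmod mu p f + pmod mu p g) / 2.
Proof.
move=> p1 lf lg; set m := fun x => _.
have lm : Lp mu p m.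
  by have := LpZ p1 2^-1 (LpD p1 lf lg); congr Lp; apply/funext => x; rewrite mulrC.
have [_ [_ i1]] := (lm, lm); have [_ i2] := lf; have [_ i3] := lg.
rewrite !pmod_def -RintegralD// -RintegralZr//; last exact: integrable_EFinD.
apply: le_Rintegral => //.
  have := integrable_EFinZ 2^-1 (integrable_EFinD i2 i3).
  by congr (integrable _ _ _); apply/funext => x; rewrite /= mulrC.
move=> x _; have := powR_tangent p1 (m x) (f x); have := powR_tangent p1 (m x) (g x).
have -> : f x - m x = - (g x - m x) by rewrite /m; field.
rewrite mulrN mulrN; lra.
Qed.

(** * Completeness, uniform convexity of the energy, and minimization *)

Section variational.
Context {R : realType} {N : nat}.
Variables (s p : R) (Omega : set 'rV[R]_N).
Hypotheses (N0 : (0 < N)%N) (s0 : 0 < s) (p1 : 1 < p).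
Hypotheses (oOmega : open Omega) (fOmega : (lebN R N Omega < +oo)%E).

Notation leb := (lebN R N).
Notation leb2 := (lebN2 R N).
Notation D := (sp_gradient s p).
Notation W0 := (Wsp0 s p Omega).
Notation smod := (smod s p).
Notation semi u := (pmod leb2 p (D u)).
Implicit Types (u v w f g : 'rV[R]_N -> R).

Let p0 : 0 < p. Proof. exact: lt_trans p1. Qed.

Let pi0 : 0 < p^-1. Proof. by rewrite invr_gt0. Qed.

Let mOmega : measurable Omega. Proof. exact: open_measurable_rV. Qed.

Let W0sob u : W0 u -> sobolev s p u. Proof. exact: Wsp0_sobolev. Qed.

Let W0m u : W0 u -> measurable_fun setT u. Proof. by move=> /W0sob[[]]. Qed.

(** Elements of [W0] vanish only almost everywhere off [Omega], so Poincare is applied to the zero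
    extension. The constant grows by 1 for the seminorm part of [smod]. *)
Lemma Wsp0_poincare : exists2 C : R, 0 < C & forall u, W0 u -> smod u <= C * semi u.
Proof.
have [C C0 hC] := fractional_poincare s0 p1 mOmega fOmega N0.
exists (C + 1); first by rewrite ltr_wpDl// ltW.
move=> u wu; have [lu lDu] := W0sob wu.
have wz := Wsp0_zero_ext p1 oOmega wu; have [lz lDz] := W0sob wz.
have uz := Wsp0_supported p1 oOmega wu.
rewrite -[X in X <= _]/(pmod leb p u + semi u) mulrDl mul1r lerD2r.
have -> : pmod leb p u = pmod leb p (zero_ext Omega u) by apply: pmod_ae => //; exact: W0m.
have -> : semi u = semi (zero_ext Omega u).
  apply: pmod_ae; last exact: sp_gradient_ae.
    by apply: measurable_sp_gradient; exact: W0m.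
  by apply: measurable_sp_gradient; exact: W0m.
by apply: hC => // x Ox; exact: zero_ext_out.
Qed.

(** A fast subsequence converges almost everywhere, and so do its gradients. Fatou in k for w_j -
    w_(phi k), with j fixed, then gives both the membership of the limit and the strong convergence
    of the whole sequence. *)
Lemma Wsp0_complete (w_ : nat -> 'rV[R]_N -> R) : (forall k, W0 (w_ k)) ->
  (forall e, 0 < e -> exists K, forall k m, (K <= k)%N -> (K <= m)%N ->
    smod (fun x => w_ k x - w_ m x) <= e) ->
  exists2 w, W0 w & smod (fun x => w_ k x - w x) @[k --> \oo] --> (0 : R).
Proof.
move=> ww cau.
(* The tolerance that [pmod_cauchy_ae] asks for. *)
pose e_ k : R := (2 ^ k.+1)%:R^-1 / 2 `^ (k%:R * p).
have e0 k : 0 < e_ k by rewrite divr_gt0 ?invr_gt0 ?ltr0n ?expn_gt0 ?powR_gt0.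
have [K_ hK_] := choice (fun k => cau _ (e0 k)).
(* Monotone, beyond the Cauchy rank [K_ k] of the k-th tolerance, and at least k so as to tend to
   infinity. *)
pose phi := fix phi (k : nat) : nat :=
  if k is j.+1 then maxn (phi j) (maxn (K_ j.+1) j.+1) else K_ 0%N.
have phiK k : (K_ k <= phi k)%N.
  by case: k => //= k; rewrite !leq_max leqnn orbT.
have phik k : (k <= phi k)%N by case: k => //= k; rewrite !leq_max leqnn !orbT.
have phiS k : (phi k <= phi k.+1)%N by rewrite /= leq_max leqnn.
have lw k := (W0sob (ww k)).1; have lDw k := (W0sob (ww k)).2.
have pmod_le u : pmod leb p u <= smod u by rewrite lerDl pmod_ge0.
have semi_le u : semi u <= smod u by rewrite lerDr pmod_ge0.
have [w mw aew] : exists2 w : 'rV[R]_N -> R, measurable_fun setT w &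
    {ae leb, forall x, w_ (phi k) x @[k --> \oo] --> w x}.
  apply: (@pmod_cauchy_ae _ _ _ leb p p1 (fun k => w_ (phi k))) => // k.
  rewrite mulrC -ler_pdivlMr ?powR_gt0//; apply: le_trans (pmod_le _) _.
  by apply: hK_; rewrite ?(leq_trans (phiK k)).
have aeDw : {ae leb2, forall z, D (w_ (phi k)) z @[k --> \oo] --> D w z}.
  apply: filterS (ae_prod aew) => z [h1 h2]; rewrite /sp_gradient.
  by apply: cvgM; [exact: cvgB|exact: cvg_cst].
(* The factor 2 collects one [e] from each of the two modulars in [smod]. *)
have fat e : 0 < e -> exists K, forall j, (K <= j)%N ->
    sobolev s p (fun x => w_ j x - w x) /\ smod (fun x => w_ j x - w x) <= 2 * e.
  move=> e0'; have [K hK] := cau _ e0'; exists K => j Kj.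
  have near_le : \forall k \near \oo, smod (fun x => w_ j x - w_ (phi k) x) <= e.
    near=> k; apply: hK => //; apply: leq_trans (phik k).
    by near: k; exact: nbhs_infty_ge.
  have lj k : sobolev s p (fun x => w_ j x - w_ (phi k) x).
    by apply: sobolevB => //; exact: W0sob.
  have [l1 b1] : Lp leb p (fun x => w_ j x - w x) /\ pmod leb p (fun x => w_ j x - w x) <= e.
    apply: (@pmod_fatou _ _ _ leb p p1 (fun k x => w_ j x - w_ (phi k) x)).
    - by move=> k; have [] := lj k.
    - by apply: measurable_funB => //; have [] := lw j.
    - by apply: filterS aew => x hx; apply: cvgB => //; exact: cvg_cst.
    - by apply: filterS near_le => k; apply: le_trans.
  have [l2 b2] : Lp leb2 p (D (fun x => w_ j x - w x)) /\ semi (fun x => w_ j x - w x) <= e.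
    apply: (@pmod_fatou _ _ _ leb2 p p1 (fun k => D (fun x => w_ j x - w_ (phi k) x))).
    - by move=> k; have [] := lj k.
    - by apply: measurable_sp_gradient; apply: measurable_funB => //; have [] := lw j.
    - apply: filterS aeDw => z hz; rewrite sp_gradientB.
      under eq_fun do rewrite sp_gradientB.
      by apply: cvgB => //; exact: cvg_cst.
    - by apply: filterS near_le => k; apply: le_trans.
  split; first by split.
  by rewrite mulr_natl mulr2n; exact: lerD.
have sw : sobolev s p w.
  have [K /(_ K (leqnn K))[h _]] := fat 1 ltr01.
  have := sobolevB p1 (W0sob (ww K)) h.
  by congr sobolev; apply/funext => x; ring.
exists w.
  apply: (Wsp0_closed p1 sw) => e e0'.
  have e40 : 0 < e / 4 by rewrite divr_gt0.
  have [K /(_ K (leqnn K))[_ h]] := fat _ e40.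
  by exists (w_ K) => //; rewrite smod_distrC; lra.
apply/cvgr0Pnorm_le => e e0'.
have e20 : 0 < e / 2 by rewrite divr_gt0.
have [K hK] := fat _ e20.
near=> k; rewrite ger0_norm ?smod_ge0//.
have [|_] := hK k; first by near: k; exact: nbhs_infty_ge.
by rewrite mulrC divfK.
Unshelve. all: by end_near. Qed.

(** Uniform convexity bounds the energy of a difference by a small multiple of the bounded energies
    plus a constant times the midpoint gap; Poincare passes from the seminorm to [smod]. *)
Lemma uniform_convexity_cauchy (lo hi B : R) a (w_ : nat -> 'rV[R]_N -> R) :
  0 < lo -> weight lo hi a -> (forall k, W0 (w_ k)) ->
  (forall k, wmod leb2 p a (D (w_ k)) <= B) ->
  (forall e, 0 < e -> exists K, forall k m, (K <= k)%N -> (k <= m)%N ->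
    (wmod leb2 p a (D (w_ k)) + wmod leb2 p a (D (w_ m))) / 2 -
    wmod leb2 p a (D (fun x => (w_ k x + w_ m x) / 2)) <= e) ->
  (forall e, 0 < e -> exists K, forall k m, (K <= k)%N -> (K <= m)%N ->
    smod (fun x => w_ k x - w_ m x) <= e).
Proof.
move=> lo0 wa ww hB hmid e e0.
have [C C0 hC] := Wsp0_poincare.
pose B' := `|B| + 1; have B'0 : 0 < B' by rewrite ltr_wpDl.
(* Multiplied by C / lo, the [eps] term and the [del] term below each contribute e/2; [G + 1]
   replaces [G], which may be 0. *)
pose eps := e * lo / (4 * C * B').
have eps0 : 0 < eps by rewrite divr_gt0 ?mulr_gt0.
have [G G0 hG] := powR_uniform_convexity p1 eps0.
pose del := e * lo / (2 * C * (G + 1)).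
have G1 : 0 < G + 1 by rewrite ltr_wpDl.
have del0 : 0 < del by rewrite divr_gt0 ?mulr_gt0.
have [K hK] := hmid _ del0; exists K.
have wlog k m : (K <= k)%N -> (k <= m)%N -> smod (fun x => w_ k x - w_ m x) <= e.
  move=> Kk km; have wB := Wsp0B p1 (ww k) (ww m).
  apply: le_trans (hC _ wB) _.
  have lk := (W0sob (ww k)).2; have lm := (W0sob (ww m)).2.
  have h1 := wmod_ge (ltW lo0) wa (W0sob wB).2.
  have DB : D (fun x => w_ k x - w_ m x) = fun z => D (w_ k) z - D (w_ m) z.
    by apply/funext => z; rewrite sp_gradientB.
  have Dm : D (fun x => (w_ k x + w_ m x) / 2) = fun z => (D (w_ k) z + D (w_ m) z) / 2.
    by apply/funext => z; rewrite /sp_gradient; ring.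
  have h2 := wmod_uniform_convexity p1 (ltW lo0) wa hG lk lm.
  have h3 := hK _ _ Kk km.
  rewrite -DB -Dm in h2.
  have b1 := hB k; have b2 := hB m.
  move: h1 h2 h3 b1 b2; set X := semi _; set Y := wmod _ _ _ _; set E1 := wmod _ _ _ (D (w_ k)).
  set E2 := wmod _ _ _ (D (w_ m)); set E3 := wmod _ _ _ _ => h1 h2 h3 b1 b2.
  have b : B <= B' by rewrite /B' (le_trans (ler_norm _))// lerDl.
  rewrite -(ler_pM2r lo0) -mulrA [X * lo]mulrC.
  apply: (@le_trans _ _ (C * (eps * (2 * B') + (G + 1) * del))).
    apply: ler_wpM2l; first exact: ltW.
    apply: le_trans h1 (le_trans h2 _); apply: lerD.
      by apply: ler_wpM2l; [exact: ltW|lra].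
    apply: (@le_trans _ _ (G * del)); first exact: ler_wpM2l.
    by apply: ler_wpM2r; [exact: ltW|rewrite lerDl].
  rewrite le_eqVlt; apply/orP; left; apply/eqP.
  rewrite /eps /del; field.
  by rewrite !gt_eqF.
move=> k m Kk Km; have [km|mk] := leqP k m; first exact: wlog.
by rewrite smod_distrC; apply: wlog => //; exact: ltnW.
Qed.

Definition sp_pairing a u v : R :=
  \int[leb2]_z (a z * (signed_pow p (D u z) * D v z)).

(** With d the denominator of [D], the kernel's denominator is d^p = d^(p-2) d d: one d for each
    difference and d^(p-2) for the absolute value. Where d = 0 both integrands are 0. *)
Lemma La_pairingE a u v : La_pairing s p a u v = 2^-1 * sp_pairing a u v.
Proof.
rewrite /La_pairing /sp_pairing; congr (_ * _); apply: eq_Rintegral => z _.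
rewrite -mulrA; congr (_ * _); rewrite -(enorm_powR_sp s p1) /sp_gradient.
set d := _ `^ (_ + s); set t := _ - _; set t' := _ - _.
have d0 : 0 <= d by exact: powR_ge0.
have [->|dn0] := eqVneq d 0.
  by rewrite powR0 ?gt_eqF// invr0 !mulr0.
have {}d0 : 0 < d by rewrite lt0r dn0.
have d2 : d^-1 `^ (p - 2) = (d `^ (p - 2))^-1.
  by rewrite -powR_inv1 ?(ltW d0)// -powRrM mulN1r powRN.
have -> : d `^ p = d `^ (p - 2) * d * d.
  rewrite -mulrA -expr2 -powR_mulrn ?(ltW d0)// -powRD ?dn0 ?implybT//.
  by rewrite subrK.
rewrite /signed_pow normrM [`|d^-1|]gtr0_norm ?invr_gt0//.
rewrite powRM ?invr_ge0 ?(ltW d0)// d2.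
have dp : d `^ (p - 2) != 0 by rewrite gt_eqF// powR_gt0.
by field; rewrite ?dp ?dn0.
Qed.

Section with_weight.
Variables (lo hi : R) (a : 'rV[R]_N * 'rV[R]_N -> R).
Hypotheses (lo0 : 0 < lo) (wa : weight lo hi a).

Notation E w := (wmod leb2 p a (D w)).

Lemma sp_pairing_self u : sp_pairing a u u = E u.
Proof.
by rewrite /sp_pairing wmod_def; apply: eq_Rintegral => z _; rewrite signed_powM.
Qed.

Lemma sp_pairing_lincomb u c v w : W0 u -> W0 v -> W0 w ->
  sp_pairing a u (fun x => c * v x + w x) = c * sp_pairing a u v + sp_pairing a u w.
Proof.
move=> /W0sob[_ lu] /W0sob[_ lv] /W0sob[_ lw].
have i1 := integrable_pairing p1 (ltW lo0) wa lu lv.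
have i2 := integrable_pairing p1 (ltW lo0) wa lu lw.
rewrite /sp_pairing -RintegralZl// -RintegralD//; last exact: integrable_EFinZ.
by apply: eq_Rintegral => z _; rewrite sp_gradientD; ring.
Qed.

Lemma La_pairing_dual u : W0 u -> Wsp0_dual s p Omega (La_pairing s p a u).
Proof.
move=> wu; apply: (@Wsp0_dualP _ _ _ _ _ p1 _ (`|hi| * (1 + semi u))).
  by move=> c v w wv ww; rewrite !La_pairingE sp_pairing_lincomb//; ring.
move=> v wv; rewrite La_pairingE.
have /W0sob[_ lu] := wu; have /W0sob[_ lv] := wv.
have := pairing_le p1 (ltW lo0) wa lu lv; rewrite -/(sp_pairing a u v) => h.
rewrite normrM ger0_norm ?invr_ge0//.
apply: (@le_trans _ _ (`|sp_pairing a u v|)).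
  by rewrite ler_piMl// invf_le1// ler1n.
apply: le_trans h _; rewrite -mulrA.
have semi0 w : 0 <= semi w by exact: pmod_ge0.
have sv : semi v <= smod v by rewrite lerDr pmod_ge0.
apply: (@le_trans _ _ (`|hi| * (semi u + semi v))).
  by apply: ler_wpM2r; [rewrite addr_ge0|exact: ler_norm].
apply: ler_wpM2l => //; rewrite mulrDr mulr1 mulrDl mul1r.
have := semi0 u; have := semi0 v; have := mulr_ge0 (semi0 u) (smod_ge0 s p v); lra.
Qed.

(** The energy lies above an affine function whose linear part is in the dual; the factor 2 undoes
    the 1/2 of the pairing. *)
Lemma energy_tangent u v : W0 u -> W0 v ->
  E u + p * (2 * (La_pairing s p a u v - La_pairing s p a u u)) <= E v.
Proof.
move=> wu wv; have /W0sob[_ lu] := wu; have /W0sob[_ lv] := wv.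
rewrite !La_pairingE.
have -> : p * (2 * (2^-1 * sp_pairing a u v - 2^-1 * sp_pairing a u u)) =
    p * (sp_pairing a u v - sp_pairing a u u) by field.
apply: le_trans (wmod_tangent p1 (ltW lo0) wa lu lv).
rewrite lerD2l ler_pM2l// /sp_pairing -RintegralB//; last 2 first.
  exact: (integrable_pairing p1 (ltW lo0) wa lu lv).
  exact: (integrable_pairing p1 (ltW lo0) wa lu lu).
rewrite le_eqVlt; apply/orP; left; apply/eqP.
by apply: eq_Rintegral => z _; ring.
Qed.

Lemma Wsp0_mid u v : W0 u -> W0 v -> W0 (fun x => (u x + v x) / 2).
Proof.
move=> wu wv; have := Wsp0Z p1 2^-1 (Wsp0D p1 wu wv).
by congr W0; apply/funext => x; rewrite mulrC.
Qed.

Section with_dual.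
Variable l : ('rV[R]_N -> R) -> R.
Hypothesis dl : Wsp0_dual s p Omega l.

Lemma Wsp0_dual_mid u v : W0 u -> W0 v ->
  l (fun x => (u x + v x) / 2) = (l u + l v) / 2.
Proof.
move=> wu wv; rewrite -(Wsp0_dualD dl)// mulrC -(Wsp0_dualZ p1 dl); last exact: Wsp0D.
by congr l; apply/funext => x; rewrite mulrC.
Qed.

(** |l w| grows at most like the power 1/p of [smod w], which is sublinear, while [smod w] is at
    most a constant times the seminorm modular. *)
Lemma Wsp0_dual_coercive eps : 0 < eps ->
  exists B : R, forall w, W0 w -> `|l w| <= eps * semi w + B.
Proof.
move=> eps0; have [C C0 hC] := Wsp0_dual_bound p1 dl.
have [C1 C10 hC1] := Wsp0_poincare.
pose q := 1 - p^-1; have q0 : 0 < q by rewrite subr_gt0 invf_lt1.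
pose eta := eps / C1; have eta0 : 0 < eta by rewrite divr_gt0.
(* The threshold at which C T^(1/p) = eta T: beyond it the linear term dominates, below it the
   constant does. *)
pose T := (C / eta) `^ q^-1.
have TE : T `^ q = C / eta.
  by rewrite /T -powRrM mulVf ?gt_eqF// powRr1// divr_ge0// ltW.
exists (C * T `^ p^-1) => w ww; apply: le_trans (hC _ ww) _.
have sw := hC1 _ ww; set X := smod w in sw *.
have X0 : 0 <= X by exact: smod_ge0.
have semi0 : 0 <= semi w by exact: pmod_ge0.
have T0 : 0 <= T by exact: powR_ge0.
have [XT|TX] := leP X T.
  apply: (@le_trans _ _ (C * T `^ p^-1)).
    by rewrite ler_pM2l//; apply: ge0_ler_powR; rewrite ?nnegrE// ltW.
  by rewrite lerDr mulr_ge0// ltW.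
apply: (@le_trans _ _ (eps * semi w)); last first.
  by rewrite lerDl mulr_ge0 ?powR_ge0// ltW.
have Xp : 0 < X by exact: le_lt_trans TX.
have h : C / eta <= X `^ q.
  by rewrite -TE; apply: ge0_ler_powR; rewrite ?nnegrE// ltW.
have XE : X = X `^ q * X `^ p^-1.
  by rewrite -powRD ?(gt_eqF Xp) ?implybT// subrK powRr1.
apply: (@le_trans _ _ (eta * X)).
  rewrite [X in _ <= eta * X]XE mulrA; apply: ler_wpM2r; first exact: powR_ge0.
  by rewrite mulrC -ler_pdivrMr.
apply: (@le_trans _ _ (eta * (C1 * semi w))); first by rewrite ler_pM2l.
by rewrite /eta mulrA divfK ?gt_eqF.
Qed.

(** The derivative of E at u in direction v is 2 p times the pairing of L_a u with v, so the factor
    2 p in front of [l] makes the Euler equation exactly L_a u = l. *)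
Lemma energy_minimizer : exists2 u, W0 u &
  forall v, W0 v -> E u - 2 * p * l u <= E v - 2 * p * l v.
Proof.
pose I w := E w - 2 * p * l w.
(* With this constant the term 2 p l(w) absorbs at most half of the energy. *)
have eps0 : 0 < lo / (4 * p) by rewrite divr_gt0 ?mulr_gt0.
have [B hB] := Wsp0_dual_coercive eps0.
have Icoer w : W0 w -> E w / 2 <= I w + 2 * p * B.
  move=> ww; have := hB _ ww; rewrite ler_norml => /andP[_ h].
  have := wmod_ge (ltW lo0) wa (W0sob ww).2.
  have {h} := ler_wpM2l (_ : 0 <= 2 * p) h; rewrite mulr_ge0 ?(ltW p0)// => /(_ isT).
  rewrite mulrDr (_ : 2 * p * (_ * semi w) = lo * semi w / 2); last first.
    by field; rewrite gt_eqF.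
  rewrite /I; set e := E w; set X := lo * _; set Y := 2 * p * l w; set Z := 2 * p * B; lra.
have E0 w : W0 w -> 0 <= E w.
  move=> ww; apply: le_trans (wmod_ge (ltW lo0) wa (W0sob ww).2).
  by rewrite mulr_ge0 ?pmod_ge0// ltW.
pose S := [set I w | w in W0].
have hS : has_inf S.
  split; first by exists (I (fun=> 0)), (fun=> 0) => //; exact: Wsp00.
  exists (- (2 * p * B)) => _ [w ww <-].
  by have := Icoer _ ww; have := E0 _ ww; move: (I w) (E w) => i e; lra.
pose m := inf S.
have mI w : W0 w -> m <= I w by move=> ww; apply: ge_inf; [exact: hS.2|exists w].
have hw k : exists w, W0 w /\ I w < m + k.+1%:R^-1.
  have vk : 0 < k.+1%:R^-1 :> R by rewrite invr_gt0.
  by have [_ [w ww <-] h] := inf_adherent vk hS; exists w.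
have [w_ hw_] := choice hw.
have ww_ k : W0 (w_ k) by have [] := hw_ k.
have inv1 k : k.+1%:R^-1 <= 1 :> R by rewrite invf_le1// ler1n.
have inv_le K k : (K <= k)%N -> k.+1%:R^-1 <= K.+1%:R^-1 :> R.
  by move=> Kk; rewrite lef_pV2 ?posrE// ler_nat.
have inv_small e : 0 < e -> exists K : nat, K.+1%:R^-1 <= e :> R.
  move=> e0; have [K _ /(_ K (leqnn K)) h] := near_infty_natSinv_lt (PosNum e0).
  by exists K; exact: ltW.
have cau : forall e, 0 < e -> exists K, forall k j, (K <= k)%N -> (K <= j)%N ->
    smod (fun x => w_ k x - w_ j x) <= e.
  apply: (@uniform_convexity_cauchy lo hi (2 * (m + 1 + 2 * p * B)) a) => //.
    move=> k; have [_ h1] := hw_ k; have h2 := Icoer _ (ww_ k); have h3 := inv1 k.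
    move: h1 h2 h3; move: (I _) (E _) (2 * p * B) (k.+1%:R^-1) => i e b z; lra.
  (* As [l] is linear, [I] and E have the same midpoint gap; the midpoint has [I] at least m, and
     both endpoints are within 1/(K+1) of m. *)
  move=> e e0; have [K hK] := inv_small _ e0; exists K => k j Kk kj.
  have := mI _ (Wsp0_mid (ww_ k) (ww_ j)).
  rewrite /I Wsp0_dual_mid//.
  have [_] := hw_ k; have [_] := hw_ j; rewrite /I.
  have := inv_le _ _ Kk; have := inv_le _ _ (leq_trans Kk kj).
  move: hK; move: (K.+1%:R^-1) (k.+1%:R^-1) (j.+1%:R^-1) => z1 z2 z3.
  move: (E (w_ k)) (E (w_ j)) (E _) (l (w_ k)) (l (w_ j)) => e1 e2 e3 l1 l2.
  have -> : 2 * p * ((l1 + l2) / 2) = (2 * p * l1 + 2 * p * l2) / 2 by ring.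
  move: (2 * p * l1) (2 * p * l2) => q1 q2; lra.
have [u wu hu] := Wsp0_complete ww_ cau.
exists u => // v wv; apply: (@le_trans _ _ m); last exact: mI.
rewrite -/(I u); apply/ler_addgt0Pr => e e0.
have c1 := Wsp0_dual_cvg p1 dl ww_ wu hu.
(* Lower semicontinuity of E at [u]: by the tangent inequality it suffices that the functional L_a u
   converges along the sequence. *)
have c2 := Wsp0_dual_cvg p1 (La_pairing_dual wu) ww_ wu hu.
have e30 : 0 < e / (6 * p) by rewrite divr_gt0 ?mulr_gt0.
have /cvgrPdist_le/(_ _ e30) n1 := c1.
have /cvgrPdist_le/(_ _ e30) n2 := c2.
have [K hK] := inv_small (e / 3) (divr_gt0 e0 (ltr0Sn _ 2)).
near \oo => k.
have k1 : `|l u - l (w_ k)| <= e / (6 * p) by near: k.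
have k2 : `|La_pairing s p a u u - La_pairing s p a u (w_ k)| <= e / (6 * p) by near: k.
have k3 : k.+1%:R^-1 <= e / 3 by apply: le_trans hK; apply: inv_le; near: k; exact: nbhs_infty_ge.
have := energy_tangent wu (ww_ k); have [_] := hw_ k; rewrite /I.
move: k1 k2; rewrite !ler_norml => /andP[k1 _] /andP[_ k2].
have p20 : 0 <= 2 * p by rewrite mulr_ge0// ltW.
have := ler_wpM2l p20 k2; have := ler_wpM2l p20 k1.
have -> : 2 * p * - (e / (6 * p)) = - (e / 3) by field; rewrite gt_eqF.
have -> : 2 * p * (e / (6 * p)) = e / 3 by field; rewrite gt_eqF.
rewrite !mulrA [p * 2]mulrC !mulrBr.
have alg (eu ek q1 q2 r1 r2 z t : R) : z <= t / 3 -> - (t / 3) <= q1 - q2 ->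
    r1 - r2 <= t / 3 -> ek - q2 < m + z -> eu + (r2 - r1) <= ek -> eu - q1 <= m + t.
  by lra.
exact: alg k3.
Unshelve. all: by end_near. Qed.

End with_dual.

End with_weight.

End variational.

(** * Solvability of the Dirichlet problem and Mazur's argument *)

Section solutions.
Context {R : realType} {N : nat}.
Variables (s p : R) (Omega : set 'rV[R]_N).
Hypotheses (N0 : (0 < N)%N) (s0 : 0 < s) (p1 : 1 < p).
Hypotheses (oOmega : open Omega) (fOmega : (lebN R N Omega < +oo)%E).

Notation leb := (lebN R N).
Notation leb2 := (lebN2 R N).
Notation D := (sp_gradient s p).
Notation W0 := (Wsp0 s p Omega).
Notation smod := (smod s p).
Notation semi u := (pmod leb2 p (D u)).
Implicit Types (u v w f g : 'rV[R]_N -> R).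

Let p0 : 0 < p. Proof. exact: lt_trans p1. Qed.

Let W0sob u : W0 u -> sobolev s p u. Proof. exact: Wsp0_sobolev. Qed.

Let W0m u : W0 u -> measurable_fun setT u. Proof. by move=> /W0sob[[]]. Qed.

Let mD u : W0 u -> measurable_fun setT (D u).
Proof. by move=> /W0m; exact: measurable_sp_gradient. Qed.

Section existence.
Variables (lo hi : R) (a : 'rV[R]_N * 'rV[R]_N -> R).
Hypotheses (lo0 : 0 < lo) (wa : weight lo hi a).

(** Hemicontinuity, the limit needed in Minty's argument; the majorant does not depend on k because
    1/(k+1) <= 1. *)
Lemma La_pairing_cvg u v : W0 u -> W0 v ->
  La_pairing s p a (fun x => k.+1%:R^-1 * v x + u x) v @[k --> \oo] -->
  La_pairing s p a u v.
Proof.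
move=> wu wv; have [_ lu] := W0sob wu; have [_ lv] := W0sob wv.
have [ma ba] := wa.
rewrite (La_pairingE s p1); under eq_fun do rewrite (La_pairingE s p1).
apply: cvgM; first exact: cvg_cst.
have t01 k : (0 <= k.+1%:R^-1 :> R) && (k.+1%:R^-1 <= 1 :> R).
  by rewrite invr_ge0 ler0n/= invf_le1// ler1n.
have hi0 : 0 <= hi by have /andP[h1 h2] := ba (0, 0); exact: le_trans (ltW lo0) (le_trans h1 h2).
pose F k z := (a z * (signed_pow p (k.+1%:R^-1 * D v z + D u z) * D v z))%:E.
pose G z := (a z * (signed_pow p (D u z) * D v z))%:E.
have mF k : measurable_fun setT (F k).
  apply/measurable_EFinP; apply: measurable_funM => //.
  apply: measurable_funM; last exact: mD.
  apply: (measurableT_comp (measurable_signed_pow p)).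
  by apply: measurable_funD; [apply: measurable_funM => //; exact: mD|exact: mD].
have mG : measurable_fun setT G.
  apply/measurable_EFinP; apply: measurable_funM => //.
  apply: measurable_funM; last exact: mD.
  by apply: (measurableT_comp (measurable_signed_pow p)); exact: mD.
pose H z := (hi * (2 `^ p * (`|D v z| `^ p + `|D u z| `^ p) + `|D v z| `^ p))%:E.
have [|||||iG _] := @dominated_convergence _ _ _ leb2 setT measurableT F G H.
- exact: mF.
- exact: mG.
- apply: aeW => z _; apply: cvg_EFin; first exact: nearW.
  apply: cvgM; first exact: cvg_cst.
  apply: cvgM; last exact: cvg_cst.
  have h : k.+1%:R^-1 * D v z + D u z @[k --> \oo] --> D u z.
    rewrite -[X in _ --> X]add0r; apply: cvgD; last exact: cvg_cst.
    rewrite -[X in _ --> X](mul0r (D v z)); apply: cvgM; last exact: cvg_cst.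
    exact: cvg_harmonic.
  exact: (cvg_comp _ _ h (@continuous_signed_pow _ _ p1 _)).
- have [_ iu] := lu; have [_ iv] := lv.
  apply: (integrable_EFinZ hi); apply: integrable_EFinD => //.
  by apply: integrable_EFinZ; exact: integrable_EFinD.
- apply: aeW => z k _; rewrite lee_fin normrM; apply: ler_pM => //.
    by have /andP[h1 h2] := ba z; rewrite ger0_norm// (le_trans (ltW lo0)).
  apply: le_trans (norm_signed_powM_le p1 _ _) _; rewrite lerD2r.
  apply: le_trans (powR_normD_le p1 _ _) _; rewrite ler_wpM2l ?powR_ge0// lerD2r.
  apply: ge0_ler_powR; rewrite ?nnegrE ?(ltW p0)// normrM.
  by have /andP[h1 h2] := t01 k; rewrite ger0_norm// ler_piMl.
move=> h; rewrite /sp_pairing /Rintegral; apply: fine_cvg.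
rewrite fineK; last by apply: integrable_fin_num.
apply: cvg_trans h; apply: near_eq_cvg; apply: nearW => k /=.
by apply: eq_integral => z _; rewrite /F sp_gradientD.
Qed.

(** Minty's trick instead of differentiating E. For w = u + t v, minimality of u against w and the
    tangent inequality at w towards u add up to l(v) <= <L_a w, v>. Letting t tend to 0, then
    replacing v by -v, gives the equation. *)
Lemma weighted_solution l : Wsp0_dual s p Omega l ->
  exists u, is_solution s p Omega a l u.
Proof.
move=> dl; have [u wu min] := energy_minimizer N0 s0 p1 oOmega fOmega lo0 wa dl.
exists u; split => //.
have half v : W0 v -> l v <= La_pairing s p a u v.
  move=> wv; have c := La_pairing_cvg wu wv.
  rewrite -(cvg_lim _ c)//; apply: limr_ge; first by apply/cvg_ex; eexists; exact: c.
  apply: nearW => k; set t : R := k.+1%:R^-1; have t0 : 0 < t by rewrite invr_gt0.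
  pose w x := t * v x + u x; have ww : W0 w by exact: Wsp0_lincomb.
  have dw := La_pairing_dual p1 lo0 wa ww.
  have h1 := min _ ww; have h2 := energy_tangent p1 lo0 wa ww wu.
  have e1 : La_pairing s p a w w = t * La_pairing s p a w v + La_pairing s p a w u.
    exact: (Wsp0_dual_lincomb dw).
  have e2 : l w = t * l v + l u by exact: (Wsp0_dual_lincomb dl).
  move: h1 h2; rewrite e1 e2 => h1 h2.
  have pt : 0 < 2 * p * t by rewrite !mulr_gt0.
  rewrite -(ler_pM2l pt).
  have alg (eu ew lv lu A Bk q : R) : eu - q * lu <= ew - q * (t * lv + lu) ->
      ew + q * (A - (t * Bk + A)) <= eu -> q * t * lv <= q * t * Bk.
    rewrite mulrDr !mulrA => z1 z2.
    have : q * (A - (t * Bk + A)) = - (q * t * Bk) by ring.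
    lra.
  apply: alg h1 _; move: h2; rewrite [in X in X -> _]mulrA [p * 2]mulrC; exact.
move=> v wv; apply/eqP; rewrite eq_le half// andbT.
have := half _ (Wsp0Z p1 (-1) wv).
rewrite (Wsp0_dualZ p1 dl)// (Wsp0_dualZ p1 (La_pairing_dual p1 lo0 wa wu))//.
by rewrite !mulN1r lerN2.
Qed.

End existence.

(** The infima [d_ k] increase and stay below [B], so they converge. For k <= m the midpoint of the
    near minimizers w_k and w_m is still admissible at level k, so the midpoint gap is at most (d_m
    - d_k)/2 up to vanishing errors. *)
Lemma mazur (K : set ('rV[R]_N -> R)) (B : R) v : Lp leb p v -> K `<=` W0 ->
  (forall u w, K u -> K w -> K (fun x => (u x + w x) / 2)) ->
  (forall e, 0 < e -> exists2 w, K w & pmod leb p (fun x => w x - v x) <= e /\ semi w <= B) ->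
  W0 v /\ exists2 w_ : nat -> 'rV[R]_N -> R, (forall k, K (w_ k)) &
    smod (fun x => w_ k x - v x) @[k --> \oo] --> (0 : R).
Proof.
move=> lv KW Kmid hK.
pose e_ k : R := (2 ^ k.+1)%:R^-1.
have e0 k : 0 < e_ k by rewrite invr_gt0 ltr0n expn_gt0.
pose Ke k := [set w | K w /\ pmod leb p (fun x => w x - v x) <= e_ k].
pose S k := [set semi w | w in Ke k].
have hS k : has_inf (S k).
  split; last by exists 0 => _ [w _ <-]; exact: pmod_ge0.
  by have [w Kw [h _]] := hK _ (e0 k); exists (semi w), w.
pose d_ k := inf (S k).
have dle k w : Ke k w -> d_ k <= semi w.
  by move=> hw; apply: ge_inf; [exact: (hS k).2|exists w].
have Kedec k m : (k <= m)%N -> Ke m `<=` Ke k.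
  move=> km w [Kw h]; split => //; apply: le_trans h _.
  by rewrite lef_pV2 ?posrE ?ltr0n ?expn_gt0// ler_nat leq_exp2l.
have dB k : d_ k <= B.
  have [w Kw [h hB]] := hK _ (e0 k); apply: le_trans hB; exact: dle.
have dnd k m : (k <= m)%N -> d_ k <= d_ m.
  move=> km; apply: lb_le_inf; first exact: (hS m).1.
  by move=> _ [w hw <-]; apply: dle; exact: Kedec hw.
have hw k : exists w, Ke k w /\ semi w < d_ k + k.+1%:R^-1.
  have vk : 0 < k.+1%:R^-1 :> R by rewrite invr_gt0.
  by have [_ [w ww <-] h] := inf_adherent vk (hS k); exists w.
have [w_ hw_] := choice hw.
have Kw_ k : K (w_ k) by have [[]] := hw_ k.
have ww_ k : W0 (w_ k) by exact/KW/Kw_.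
have inv1 k : k.+1%:R^-1 <= 1 :> R by rewrite invf_le1// ler1n.
have inv_le j k : (j <= k)%N -> k.+1%:R^-1 <= j.+1%:R^-1 :> R.
  by move=> jk; rewrite lef_pV2 ?posrE// ler_nat.
have lwv k : Lp leb p (fun x => w_ k x - v x).
  by apply: LpB => //; exact: (W0sob (ww_ k)).1.
have wmodE u : wmod leb2 p (cst 1) (D u) = semi u by rewrite pmod_wmod.
have cau : forall e, 0 < e -> exists j, forall k m, (j <= k)%N -> (j <= m)%N ->
    smod (fun x => w_ k x - w_ m x) <= e.
  apply: (@uniform_convexity_cauchy _ _ s p Omega N0 s0 p1 oOmega fOmega 1 1 (B + 1) (cst 1)) => //.
  - exact: weight_cst1.
  - move=> k; rewrite wmodE; have [_ h] := hw_ k; have := dB k; have := inv1 k.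
    by move: h; set q := _^-1; set E := semi _; lra.
  move=> e e0'.
  have dc : cvgn d_.
    apply: nondecreasing_is_cvgn => //; exists B => _ [k _ <-]; exact: dB.
  have dle_lim k : d_ k <= limn d_ by apply: nondecreasing_cvgn_le.
  have /cvgrPdist_le/(_ e e0')[j1 _ hj1] := dc.
  have [j2 hj2] : exists j2 : nat, j2.+1%:R^-1 <= e / 2 :> R.
    have e20 : 0 < e / 2 by rewrite divr_gt0.
    have [j2 _ /(_ j2 (leqnn j2)) h] := near_infty_natSinv_lt (PosNum e20).
    by exists j2; exact: ltW.
  exists (maxn j1 j2) => k m; rewrite geq_max => /andP[jk1 jk2] km.
  rewrite !wmodE.
  have hmid : d_ k <= semi (fun x => (w_ k x + w_ m x) / 2).
    apply: dle; split; first exact: Kmid.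
    have [[_ h1] _] := hw_ k; have [hm _] := hw_ m; have [_ h2] := Kedec _ _ km _ hm.
    have := pmod_midpoint p1 (lwv k) (lwv m).
    have -> : (fun x => (w_ k x - v x + (w_ m x - v x)) / 2) =
        (fun x => (w_ k x + w_ m x) / 2 - v x) by apply/funext => x; field.
    by move: h1 h2; set A1 := pmod _ _ _; set A2 := pmod _ _ _; lra.
  have [_ h1] := hw_ k; have [_ h2] := hw_ m.
  have h3 := inv_le _ _ jk2; have h4 := inv_le _ _ (leq_trans jk2 km).
  have h5 := hj1 k jk1; rewrite /= ger0_norm ?subr_ge0 ?dle_lim// in h5.
  have h6 := dle_lim m.
  move: h1 h2 h3 h4 h5 h6 hmid hj2.
  move: (semi _) (semi (w_ k)) (semi (w_ m)) (d_ k) (d_ m) (limn d_) (k.+1%:R^-1) (m.+1%:R^-1).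
  move: (j2.+1%:R^-1) => z1 e1 e2 e3 d1 d2 d3 z2 z3; lra.
have [w ww hcv] := Wsp0_complete p1 ww_ cau.
have lw := (W0sob ww).1.
have mv : measurable_fun setT v by have [] := lv.
have lwv0 := LpB p1 lw lv.
(* The near minimizers tend to [w] in the Sobolev modular and to [v] in L^p. *)
have wv0 : pmod leb p (fun x => w x - v x) = 0.
  apply/eqP; rewrite eq_le pmod_ge0 andbT; apply/ler_addgt0Pr => e e0'; rewrite add0r.
  pose c := e / 2 / 2 `^ p.
  have c0 : 0 < c by rewrite !divr_gt0// powR_gt0.
  have /cvgr0Pnorm_le/(_ _ c0)[j1 _ hj1] := hcv.
  have [j2 hj2] : exists j2 : nat, j2.+1%:R^-1 <= c :> R.
    have [j2 _ /(_ j2 (leqnn j2)) h] := near_infty_natSinv_lt (PosNum c0).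
    by exists j2; exact: ltW.
  pose k := maxn j1 j2.
  have h1 : smod (fun x => w_ k x - w x) <= c.
    by have := hj1 k (leq_maxl _ _); rewrite /= ger0_norm// smod_ge0.
  have h2 : pmod leb p (fun x => w_ k x - v x) <= c.
    have [[_ h] _] := hw_ k; apply: le_trans h (le_trans _ hj2).
    rewrite /e_ lef_pV2 ?posrE ?ltr0n ?expn_gt0// ler_nat.
    apply: leq_trans (ltn_expl k.+1 (ltnSn 1)) => //.
    by rewrite ltnS; apply: leqW; exact: leq_maxr.
  have := pmodB_le p1 (lwv k) (LpB p1 (W0sob (ww_ k)).1 lw).
  have -> : (fun x => w_ k x - v x - (w_ k x - w x)) = (fun x => w x - v x).
    by apply/funext => x; ring.
  move=> /le_trans; apply.
  have h3 : pmod leb p (fun x => w_ k x - w x) <= c.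
    by apply: le_trans h1; rewrite lerDl pmod_ge0.
  rewrite mulrC -ler_pdivlMr ?powR_gt0// (splitr e) mulrDl; exact: lerD.
have wve : {ae leb, forall x, w x = v x}.
  apply: filterS (ae_eq_pmod0 p1 lwv0 wv0) => x /eqP.
  by rewrite subr_eq0 => /eqP.
split; first exact: Wsp0_ae wve.
exists w_ => //; have h k : smod (fun x => w_ k x - v x) <= 2 `^ p * smod (fun x => w_ k x - w x).
  have wv := Wsp0_ae p1 ww mv wve.
  have := smodD_le p1 (W0sob (Wsp0B p1 (ww_ k) ww)) (W0sob (Wsp0B p1 ww wv)).
  rewrite (smod_ae0 s p1 (W0m ww) mv wve) addr0; congr (smod _ <= _).
  by apply/funext => x; ring.
apply: (@squeeze_cvgr _ _ _ _ (cst 0) (fun k => 2 `^ p * smod (fun x => w_ k x - w x))).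
- by apply: nearW => k; rewrite smod_ge0 h.
- exact: cvg_cst.
- by rewrite -(mulr0 (2 `^ p)); apply: cvgM => //; exact: cvg_cst.
Qed.

End solutions.

Lemma integrable_ae_eq {R : realType} d (T : measurableType d)
    (mu : {measure set T -> \bar R}) (f g : T -> R) :
  measurable_fun setT g -> {ae mu, forall x, f x = g x} ->
  mu.-integrable setT (EFin \o f) -> mu.-integrable setT (EFin \o g).
Proof.
move=> mg fg /integrableP[mf hf]; apply/integrableP; split.
  exact/measurable_EFinP.
apply: le_lt_trans hf; rewrite le_eqVlt; apply/orP; left; apply/eqP.
apply: ae_eq_integral => //.
- by apply: measurableT_comp => //; exact/measurable_EFinP.
- exact: measurableT_comp.
- by apply: filterS fg => x /= ->.
Qed.

Lemma lt_ereal_real {R : realType} (x y : \bar R) : (x < y)%E ->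
  exists c : R, (x < c%:E)%E && (c%:E < y)%E.
Proof.
case: x y => [r| |] [t| |]//.
- rewrite lte_fin => rt; exists ((r + t) / 2); rewrite !lte_fin; apply/andP; split; lra.
- by move=> _; exists (r + 1); rewrite lte_fin ltrDl ltr01 ltry.
- by move=> _; exists (t - 1); rewrite ltNyr lte_fin ltrBlDr ltrDl ltr01.
- by move=> _; exists 0; rewrite ltNyr ltry.
Qed.

(** * From kernels, energies and the metric of L^p(Omega) to modulars; strong convergence *)

Section gamma.
Context {R : realType} {N : nat}.
Variables (s p : R) (Omega : set 'rV[R]_N).
Hypotheses (N0 : (0 < N)%N) (s0 : 0 < s) (p1 : 1 < p).
Hypotheses (oOmega : open Omega) (fOmega : (lebN R N Omega < +oo)%E).

Notation leb := (lebN R N).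
Notation leb2 := (lebN2 R N).
Notation D := (sp_gradient s p).
Notation W0 := (Wsp0 s p Omega).
Notation smod := (smod s p).
Notation semi u := (pmod leb2 p (D u)).
Notation ze := (zero_ext Omega).
Implicit Types (u v w f g : 'rV[R]_N -> R) (a : 'rV[R]_N * 'rV[R]_N -> R).

Let p0 : 0 < p. Proof. exact: lt_trans p1. Qed.

Let mOmega : measurable Omega. Proof. exact: open_measurable_rV. Qed.

Let W0sob u : W0 u -> sobolev s p u. Proof. exact: Wsp0_sobolev. Qed.

Let W0m u : W0 u -> measurable_fun setT u. Proof. by move=> /W0sob[[]]. Qed.

Let mD u : W0 u -> measurable_fun setT (D u).
Proof. by move=> /W0m; exact: measurable_sp_gradient. Qed.

Let W0z u : W0 u -> W0 (ze u). Proof. exact: Wsp0_zero_ext. Qed.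

Let W0supp u : W0 u -> {ae leb, forall x, u x = ze u x}.
Proof. exact: Wsp0_supported. Qed.

(* The bounds of a kernel class only hold a.e.; truncating makes them hold
   everywhere. *)
Definition clamp (lo hi : R) a z := Num.max lo (Num.min (Num.max lo hi) (a z)).

(** With the ceiling max(lo, hi) the two-sided bound holds for any pair of constants, in particular
    for the pair attached to the limit kernel. *)
Lemma clamp_weight lo hi a : measurable_fun setT a ->
  weight lo (Num.max lo hi) (clamp lo hi a).
Proof.
move=> ma; split; last first.
  by move=> z; rewrite /clamp le_max lexx/= ge_max le_max lexx/= ge_min lexx.
apply: measurable_maxr; first exact: measurable_cst.
by apply: measurable_minr => //; exact: measurable_cst.
Qed.

Lemma kernel_class_measurable lo hi a : kernel_class lo hi a -> measurable_fun setT a.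
Proof. by move=> [+ _]; rewrite inE => /andP[/[!inE]]. Qed.

Lemma kernel_class_clamp lo hi a : kernel_class lo hi a ->
  {ae leb2, forall z, a z = clamp lo hi a z}.
Proof.
move=> [_]; apply: filterS => z [_ /andP[h1 h2]].
rewrite /clamp min_r; last by rewrite le_max h2 orbT.
by rewrite max_r.
Qed.

Lemma sp_pairing_clamp lo hi a u v : kernel_class lo hi a ->
  measurable_fun setT u -> measurable_fun setT v ->
  La_pairing s p a u v = La_pairing s p (clamp lo hi a) u v.
Proof.
move=> ka mu mv; rewrite !(La_pairingE s p1); congr (_ * _).
have mc := (clamp_weight lo hi (kernel_class_measurable ka)).1.
have ma := kernel_class_measurable ka.
have mDu := measurable_sp_gradient s p mu; have mDv := measurable_sp_gradient s p mv.
have msp : measurable_fun setT (fun z => signed_pow p (D u z) * D v z).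
  by apply: measurable_funM => //; exact: (measurableT_comp (measurable_signed_pow p)).
apply: Rintegral_ae; [exact: measurable_funM|exact: measurable_funM|].
by apply: filterS (kernel_class_clamp ka) => z ->.
Qed.

Lemma energy_Wsp0 lo hi a v : 0 < lo -> kernel_class lo hi a -> W0 (ze v) ->
  energy s p Omega a v = ((2 * p)^-1 * wmod leb2 p (clamp lo hi a) (D (ze v)))%:E.
Proof.
move=> lo0 ka wv; rewrite /energy asboolT// EFinM; congr (_ * _)%E.
have wc := clamp_weight lo hi (kernel_class_measurable ka).
have i1 := integrable_weight (ltW lo0) wc (W0sob wv).2.
rewrite wmod_def /Rintegral fineK; last exact: integrable_fin_num.
have mDv := mD wv; have [mc _] := wc.
have ma := kernel_class_measurable ka.
transitivity (\int[leb2]_z (a z * `|D (ze v) z| `^ p)%:E)%E.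
  by apply: eq_integral => z _; rewrite (powR_sp_gradient s p1) mulrA.
apply: ae_eq_integral => //.
- by apply/measurable_EFinP; apply: measurable_funM => //; exact: measurable_powR_norm.
- by apply/measurable_EFinP; apply: measurable_funM => //; exact: measurable_powR_norm.
- by apply: filterS (kernel_class_clamp ka) => z ->.
Qed.

Lemma energyNW a v : ~ W0 (ze v) -> energy s p Omega a v = +oo%E.
Proof. by move=> h; rewrite /energy asboolF. Qed.

Lemma Wsp0_integrable u : W0 u -> leb.-integrable setT (EFin \o u).
Proof.
move=> wu; apply: (@integrable_ae_eq _ _ _ leb (ze u)); first exact: W0m.
  by apply: filterS (W0supp wu) => x ->.
apply: (integrable_supported p1 mOmega fOmega (W0sob (W0z wu)).1) => x Ox.
exact: zero_ext_out.
Qed.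

(** Box averages are the functionals through which weak convergence is tested; the affine bound of
    [box_avg_bound] is enough for [Wsp0_dualP]. *)
Lemma box_avg_dual r x : 0 < r -> Wsp0_dual s p Omega (fun u => box_avg r u x).
Proof.
move=> r0; pose V := (2 * r) ^+ N; have V0 : 0 < V by rewrite exprn_gt0// mulr_gt0.
apply: (@Wsp0_dualP _ _ _ _ _ p1 _ (1 + V^-1)).
  move=> c u v wu wv; rewrite /box_avg.
  have mB := measurable_box x r.
  have ib f : leb.-integrable setT (EFin \o f) -> leb.-integrable (box x r) (EFin \o f).
    by move=> h; exact: integrableS h.
  have iu := ib _ (Wsp0_integrable wu); have iv := ib _ (Wsp0_integrable wv).
  rewrite RintegralD//; last by have := integrableZl mB c iu.
  by rewrite RintegralZl// mulrDl mulrA.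
move=> u wu; apply: le_trans (box_avg_bound p1 x r0 (W0sob wu).1 (Wsp0_integrable wu)) _.
rewrite -/V mulrDr mulr1 mulrDl mul1r.
have h : pmod leb p u <= smod u by rewrite lerDl pmod_ge0.
have h1 : pmod leb p u / V <= V^-1 * smod u by rewrite mulrC ler_pM2l// invr_gt0.
have := smod_ge0 s p u; have : 0 <= V^-1 by rewrite invr_ge0 ltW.
move: h1; move: (_ / V) (V^-1 * _) => A1 A2; lra.
Qed.

Lemma box_avg_ae u v x r : measurable_fun setT u -> measurable_fun setT v ->
  {ae leb, forall x, u x = v x} -> box_avg r u x = box_avg r v x.
Proof.
move=> mu mv uv; rewrite /box_avg /Rintegral; congr (fine _ / _).
apply: ae_eq_integral => //.
- exact: measurable_box.
- by apply/measurable_EFinP; exact: measurable_funTS.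
- by apply/measurable_EFinP; exact: measurable_funTS.
- by apply: filterS uv => y ->.
Qed.

(** The compactness lemma asks for functions vanishing everywhere off [Omega], so it is applied to
    the zero extensions of u_k - u, and a.e. equality carries the result back. *)
Lemma weak_cvg_strong (u_ : nat -> 'rV[R]_N -> R) u (M : R) :
  (forall k, W0 (u_ k)) -> W0 u -> (forall k, semi (u_ k) <= M) ->
  (forall l, Wsp0_dual s p Omega l -> l (u_ k) @[k --> \oo] --> l u) ->
  pmod leb p (fun x => u_ k x - u x) @[k --> \oo] --> (0 : R).
Proof.
move=> wu_ wu hM wk.
pose h k x := u_ k x - u x; have wh k : W0 (h k) := Wsp0B p1 (wu_ k) wu.
have hz k : pmod leb p (h k) = pmod leb p (ze (h k)).
  exact: pmod_ae (W0m (wh k)) (W0m (W0z (wh k))) (W0supp (wh k)).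
have hD k : semi (h k) = semi (ze (h k)).
  exact: pmod_ae (mD (wh k)) (mD (W0z (wh k))) (sp_gradient_ae s p (W0supp (wh k))).
have -> : (fun k => pmod leb p (fun x => u_ k x - u x)) =
    (fun k => pmod leb p (ze (h k))) by apply/funext => k; rewrite -hz.
apply: (fractional_compactness s0 p1 mOmega fOmega (M := 2 `^ p * (M + semi u)) N0).
- by move=> k; have [] := W0sob (W0z (wh k)).
- by move=> k x Ox; exact: zero_ext_out.
- by move=> k; have [] := W0sob (W0z (wh k)).
- move=> k; rewrite -hD (_ : D (h k) = fun z => D (u_ k) z - D u z); last first.
    by apply/funext => z; rewrite sp_gradientB.
  apply: le_trans (pmodB_le p1 (W0sob (wu_ k)).2 (W0sob wu).2) _.
  by rewrite ler_wpM2l ?powR_ge0// lerD2r.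
move=> r x r0; have dl := box_avg_dual x r0.
have -> : (fun k => box_avg r (ze (h k)) x) =
    (fun k => box_avg r (u_ k) x - box_avg r u x).
  apply/funext => k; rewrite -(Wsp0_dualB dl (wu_ k) wu).
  apply: (box_avg_ae x r (W0m (W0z (wh k))) (W0m (wh k))).
  by apply: filterS (W0supp (wh k)) => y ->.
by apply/subr_cvg0; exact: (wk _ dl).
Qed.

Lemma LpOmega_dist_pmod u v : Lp leb p (ze (u \- v)%R) ->
  LpOmega_dist p Omega u v = ((pmod leb p (ze (u \- v)%R)) `^ p^-1)%:E.
Proof.
move=> l; rewrite /LpOmega_dist unlock -poweR_EFin pmodE//; congr poweR.
Qed.

Lemma zero_extB u v : ze (u \- v)%R = (fun x => ze u x - ze v x).
Proof. by apply/funext => x; rewrite !zero_extE /=; ring. Qed.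

Lemma LpOmegaP u : LpOmega p Omega u <-> Lp leb p (ze u).
Proof. exact: LfunP_modular. Qed.

Lemma dist_cvgP (u_ : nat -> 'rV[R]_N -> R) u : LpOmega p Omega u ->
  dist_cvg (LpOmega p Omega) (LpOmega_dist p Omega) u_ u <->
  (forall k, LpOmega p Omega (u_ k)) /\
  pmod leb p (fun x => ze (u_ k) x - ze u x) @[k --> \oo] --> (0 : R).
Proof.
move=> /LpOmegaP lu; rewrite /dist_cvg.
have dE : (forall k, LpOmega p Omega (u_ k)) -> (fun k => LpOmega_dist p Omega (u_ k) u) =
    (fun k => (pmod leb p (fun x => ze (u_ k) x - ze u x) `^ p^-1)%:E).
  move=> h; apply/funext => k; rewrite LpOmega_dist_pmod zero_extB//.
  by apply: LpB => //; exact/LpOmegaP.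
have pi0 : 0 < p^-1 by rewrite invr_gt0.
split=> -[lu_ h]; split => //.
  move: h; rewrite dE// => /fine_cvgP[_ /cvgr0Pnorm_lt h].
  apply/cvgr0Pnorm_lt => e e0; have := h _ (powR_gt0 p^-1 e0); apply: filterS => k /=.
  rewrite ger0_norm ?powR_ge0// ger0_norm ?pmod_ge0// => hk.
  rewrite ltNge; apply/negP => ek; move: hk; rewrite ltNge => /negP; apply.
  by apply: ge0_ler_powR; rewrite ?nnegrE ?pmod_ge0 ?(ltW pi0) ?(ltW e0).
rewrite dE//; apply: cvg_EFin; first exact: nearW.
apply/cvgr0Pnorm_lt => e e0.
have /cvgr0Pnorm_lt/(_ _ (powR_gt0 p e0)) := h; apply: filterS => k.
rewrite /= ger0_norm ?pmod_ge0// ger0_norm ?powR_ge0// => hk.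
have := gt0_ltr_powR pi0 (_ : _ \in Num.nneg) (_ : _ \in Num.nneg) hk.
rewrite !nnegrE pmod_ge0 powR_ge0 => /(_ isT isT).
by rewrite -powRrM mulfV ?gt_eqF// powRr1// ltW.
Qed.

End gamma.

(** * The two inequalities of Gamma-convergence *)

Section H_to_Gamma.
Context {R : realType} {N : nat}.
Variables (s p p' lam Lam hi0 : R) (Omega : set 'rV[R]_N).
Variables (a_ : nat -> 'rV[R]_N * 'rV[R]_N -> R) (a0 : 'rV[R]_N * 'rV[R]_N -> R).
Hypotheses (N0 : (0 < N)%N) (s0 : 0 < s) (p1 : 1 < p).
Hypotheses (oOmega : open Omega) (fOmega : (lebN R N Omega < +oo)%E).
Hypotheses (lam0 : 0 < lam) (ka_ : forall n, kernel_class lam Lam (a_ n)).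
Hypotheses (ka0 : kernel_class lam hi0 a0) (Ha : H_cvg s p Omega p' a_ a0).

Notation leb := (lebN R N).
Notation leb2 := (lebN2 R N).
Notation D := (sp_gradient s p).
Notation W0 := (Wsp0 s p Omega).
Notation semi u := (pmod leb2 p (D u)).
Notation ze := (zero_ext Omega).
Notation c_ n := (clamp lam Lam (a_ n)).
Notation c0 := (clamp lam hi0 a0).
Notation J_ n := (energy s p Omega (a_ n)).
Notation J0 := (energy s p Omega a0).
Implicit Types (u v w : 'rV[R]_N -> R).

Let p0 : 0 < p. Proof. exact: lt_trans p1. Qed.

Let W0sob u : W0 u -> sobolev s p u. Proof. exact: Wsp0_sobolev. Qed.

Let W0m u : W0 u -> measurable_fun setT u. Proof. by move=> /W0sob[[]]. Qed.

Let wc_ n : weight lam (Num.max lam Lam) (c_ n).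
Proof. by apply: clamp_weight; exact: kernel_class_measurable (ka_ n). Qed.

Let wc0 : weight lam (Num.max lam hi0) c0.
Proof. by apply: clamp_weight; exact: kernel_class_measurable ka0. Qed.

(** Solutions are built for the truncated kernels and, by a.e. equality, solve the problems for
    [a_ n] to which H-convergence applies. They are replaced by their zero extensions so that
    [energy] sees them unchanged. The limsup inequality uses them as recovery sequence, the liminf
    inequality as points of tangency. *)
Lemma recovery_sequence v : W0 v ->
  exists u_ : nat -> 'rV[R]_N -> R,
  [/\ forall n, W0 (u_ n) /\ ze (u_ n) = u_ n,
      forall n w, W0 w -> La_pairing s p (c_ n) (u_ n) w = La_pairing s p c0 v w,
      forall l, Wsp0_dual s p Omega l -> l (u_ n) @[n --> \oo] --> l v &
      pmod leb p (fun x => u_ n x - v x) @[n --> \oo] --> (0 : R)].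
Proof.
move=> wv; pose l := La_pairing s p c0 v.
have dl : Wsp0_dual s p Omega l := La_pairing_dual p1 lam0 wc0 wv.
have [w_ hw_] := choice (fun n =>
  weighted_solution N0 s0 p1 oOmega fOmega lam0 (wc_ n) dl).
have ww_ n : W0 (w_ n) by have [] := hw_ n.
pose u_ n := ze (w_ n).
have wu_ n : W0 (u_ n) := Wsp0_zero_ext p1 oOmega (ww_ n).
have uw n := Wsp0_supported p1 oOmega (ww_ n).
have solc n w : W0 w -> La_pairing s p (c_ n) (u_ n) w = l w.
  move=> ww; have [_ <-//] := hw_ n; rewrite !(La_pairingE s p1); congr (_ * _).
  have mDw := measurable_sp_gradient s p (W0m ww).
  have mp u : W0 u -> measurable_fun setT
      (fun z => c_ n z * (signed_pow p (D u z) * D w z)).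
    move=> wu; apply: measurable_funM; first exact: (wc_ n).1.
    apply: measurable_funM => //; apply: (measurableT_comp (measurable_signed_pow p)).
    exact: measurable_sp_gradient (W0m wu).
  apply: (Rintegral_ae (mp _ (wu_ n)) (mp _ (ww_ n))).
  by apply: filterS (sp_gradient_ae s p (uw n)) => z ->.
have sol n : is_solution s p Omega (a_ n) l (u_ n).
  split; first exact: wu_.
  by move=> w ww; rewrite (sp_pairing_clamp s p1 (ka_ n) (W0m (wu_ n)) (W0m ww)) solc.
have sol0 : is_solution s p Omega a0 l v.
  by split => // w ww; rewrite (sp_pairing_clamp s p1 ka0 (W0m wv) (W0m ww)).
have [[_ _ wk] _] := Ha dl sol sol0.
(* Testing the equation with its solution gives lam semi(u_n) <= 2 l(u_n), and a convergent sequence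
   is bounded. *)
have [M hM] : exists M, forall n, semi (u_ n) <= M.
  have : cvgn (fun n => l (u_ n)) by apply/cvg_ex; exists (l v); exact: wk.
  move=> /cvg_seq_bounded[B [_ hB]]; exists (2 * (B + 1) / lam) => n.
  have lB : l (u_ n) <= B + 1.
    by apply: le_trans (ler_norm _) _; apply: hB => //; rewrite ltrDl.
  rewrite ler_pdivlMr// mulrC; apply: le_trans (wmod_ge (ltW lam0) (wc_ n) (W0sob (wu_ n)).2) _.
  have := solc n _ (wu_ n); rewrite (La_pairingE s p1) (sp_pairing_self s p1) => h.
  by move: lB; rewrite -h; move: (wmod _ _ _ _) => e; lra.
exists u_; split.
- by move=> n; split; [exact: wu_|exact: zero_ext_id].
- exact: solc.
- exact: wk.
- exact: (weak_cvg_strong N0 s0 p1 oOmega fOmega wu_ wv hM wk).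
Qed.

Lemma gamma_limsup v : LpOmega p Omega v ->
  exists y_, dist_cvg (LpOmega p Omega) (LpOmega_dist p Omega) y_ v /\
    (limn_esup (fun n => J_ n (y_ n)) <= J0 v)%E.
Proof.
move=> lv; have [wv|nv] := pselect (W0 (ze v)); last first.
  exists (fun=> v); split; last by rewrite energyNW// leey.
  apply/(dist_cvgP p1) => //; split => //.
  have h : pmod leb p (fun x => ze v x - ze v x) = 0.
    have -> : (fun x => ze v x - ze v x) = (fun x => 0 * ze v x).
      by apply/funext => x; rewrite subrr mul0r.
    rewrite pmodZ; last exact/(LpOmegaP Omega p1).
    by rewrite normr0 powR0 ?mul0r// gt_eqF.
  by rewrite h; exact: cvg_cst.
have [u_ [wu_ sol wk str]] := recovery_sequence wv.
exists u_; split.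
  apply/(dist_cvgP p1) => //; split.
    by move=> n; apply/(LpOmegaP Omega p1); have [wu ->] := wu_ n; have [] := W0sob wu.
  have -> : (fun n => pmod leb p (fun x => ze (u_ n) x - ze v x)) =
      (fun n => pmod leb p (fun x => u_ n x - ze v x)).
    by apply/funext => n; have [_ ->] := wu_ n.
  exact: str.
pose l := La_pairing s p c0 (ze v).
have dl : Wsp0_dual s p Omega l := La_pairing_dual p1 lam0 wc0 wv.
have JE n : J_ n (u_ n) = (p^-1 * l (u_ n))%:E.
  have [wu zu] := wu_ n; rewrite (energy_Wsp0 p1 lam0 (ka_ n)) ?zu//.
  have := sol n _ wu; rewrite -/(l _) (La_pairingE s p1) (sp_pairing_self s p1) => <-.
  by congr _%:E; field; rewrite gt_eqF.
have J0E : J0 v = (p^-1 * l (ze v))%:E.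
  rewrite (energy_Wsp0 p1 lam0 ka0)// /l (La_pairingE s p1) (sp_pairing_self s p1).
  by congr _%:E; field; rewrite gt_eqF.
have cv : J_ n (u_ n) @[n --> \oo] --> J0 v.
  rewrite J0E; under eq_fun do rewrite JE.
  apply: cvg_EFin; first exact: nearW.
  by apply: cvgM; [exact: cvg_cst|exact: wk].
by have [_ ->] := cvg_limn_einf_sup cv.
Qed.

(** If the inequality fails, a real [c] separates the two sides and infinitely many n have energy
    below [c]. Only these indices are used, and of the convergence of l(v_n) only the lower bound
    [hm] along them. *)
Lemma gamma_liminf v (v_ : nat -> 'rV[R]_N -> R) : LpOmega p Omega v ->
  dist_cvg (LpOmega p Omega) (LpOmega_dist p Omega) v_ v ->
  (J0 v <= limn_einf (fun n => J_ n (v_ n)))%E.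
Proof.
move=> lv /(dist_cvgP p1)[//|lv_ vv].
rewrite leNgt; apply/negP => /lt_ereal_real[c /andP[Lc cJ]].
have freq m : exists2 n, (m <= n)%N & (J_ n (v_ n) < c%:E)%E.
  have : (einfs (fun n => J_ n (v_ n)) m < c%:E)%E.
    apply: le_lt_trans Lc; rewrite limn_einf_lim.
    rewrite (cvg_lim _ (ereal_nondecreasing_cvgn (nondecreasing_einfs _)))//.
    by apply: ereal_sup_ubound; exists m.
  by move=> /ereal_inf_lt[_ [n mn <-] h]; exists n.
have lowW n : (J_ n (v_ n) < c%:E)%E -> W0 (ze (v_ n)).
  by move=> h; apply: contrapT => nW; move: h; rewrite energyNW// ltNge leey.
have lowB n : (J_ n (v_ n) < c%:E)%E -> semi (ze (v_ n)) <= 2 * p * c / lam.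
  move=> h; have wn := lowW _ h; move: h; rewrite (energy_Wsp0 p1 lam0 (ka_ n))// lte_fin.
  have := wmod_ge (ltW lam0) (wc_ n) (W0sob wn).2.
  rewrite ler_pdivlMr// mulrC => h1; rewrite mulrC ltr_pdivrMr ?mulr_gt0// => h2.
  by apply: le_trans h1 (ltW _); rewrite mulrC.
have small e : 0 < e -> exists K, forall n, (K <= n)%N ->
    pmod leb p (fun x => ze (v_ n) x - ze v x) <= e.
  move=> e0; have /cvgr0Pnorm_le/(_ _ e0)[K _ hK] := vv.
  by exists K => n /hK /=; rewrite ger0_norm// pmod_ge0.
have lz : Lp leb p (ze v) by exact/(LpOmegaP Omega p1).
have wv : W0 (ze v).
  have mid u w : W0 u -> W0 w -> W0 (fun x => (u x + w x) / 2) by exact: Wsp0_mid.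
  have near e : 0 < e -> exists2 w, W0 w &
      pmod leb p (fun x => w x - ze v x) <= e /\ semi w <= 2 * p * c / lam.
    move=> e0; have [K hK] := small _ e0; have [n Kn hn] := freq K.
    exact: (ex_intro2 _ _ (ze (v_ n)) (lowW _ hn) (conj (hK _ Kn) (lowB _ hn))).
  by have [] := mazur N0 s0 p1 oOmega fOmega lz (fun u wu => wu) mid near.
have [u_ [wu_ sol wk _]] := recovery_sequence wv.
pose l := La_pairing s p c0 (ze v).
have dl : Wsp0_dual s p Omega l := La_pairing_dual p1 lam0 wc0 wv.
have J0E : J0 v = (p^-1 * l (ze v))%:E.
  rewrite (energy_Wsp0 p1 lam0 ka0)// /l (La_pairingE s p1) (sp_pairing_self s p1).
  by congr _%:E; field; rewrite gt_eqF.
move: cJ; rewrite J0E lte_fin => cJ; pose del := p^-1 * l (ze v) - c.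
have del0 : 0 < del by rewrite subr_gt0.
(* Otherwise infinitely many low-energy v_n lie in the half-space l <= l(v) - del/2; Mazur then
   yields points of that half-space converging strongly to v, against the continuity of [l]. *)
have [m hm] : exists m, forall n, (m <= n)%N -> (J_ n (v_ n) < c%:E)%E ->
    l (ze v) - del / 2 < l (ze (v_ n)).
  apply: contrapT => nm.
  have bad m : exists2 n, (m <= n)%N & (J_ n (v_ n) < c%:E)%E /\
      l (ze (v_ n)) <= l (ze v) - del / 2.
    apply: contrapT => h; apply: nm; exists m => n mn hn.
    by rewrite ltNge; apply/negP => h'; apply: h; exists n.
  have [|||_ [w_ Kw_ cw]] := mazur N0 s0 p1 oOmega fOmega
      (K := [set w | W0 w /\ l w <= l (ze v) - del / 2]) (B := 2 * p * c / lam) lz.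
  - by move=> w [].
  - move=> u w [wu hu] [ww hw]; split; first exact: Wsp0_mid.
    by rewrite (Wsp0_dual_mid p1 dl)//; move: hu hw; move: (l u) (l w) (_ - _) => x y z; lra.
  - move=> e e0; have [K hK] := small _ e0; have [n Kn [hn hl]] := bad K.
    exact: (ex_intro2 _ _ (ze (v_ n)) (conj (lowW _ hn) hl) (conj (hK _ Kn) (lowB _ hn))).
  have wwk k : W0 (w_ k) by have [] := Kw_ k.
  have := Wsp0_dual_cvg p1 dl wwk wv cw.
  move=> /cvgrPdist_lt/(_ _ (divr_gt0 del0 (ltr0Sn R 1)))[K _ /(_ K (leqnn K))] /=.
  have [_] := Kw_ K; rewrite ltr_norml => h1 /andP[_ h2].
  by move: h1 h2; move: (l (w_ K)) (l (ze v)) (del / _) => x y z; lra.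
have p10 : 0 < 1 - p^-1 by rewrite subr_gt0 invf_lt1.
have /cvgrPdist_le/(_ (del / 4) (divr_gt0 del0 (ltr0Sn R 3)))[K _ hK] := wk _ dl.
have [n Kn hn] := freq (maxn m K).
have wn := lowW _ hn; have [wu zu] := wu_ n.
have h1 := hm n (leq_trans (leq_maxl _ _) Kn) hn.
have h2 := hK n (leq_trans (leq_maxr _ _) Kn).
have h3 := energy_tangent p1 lam0 (wc_ n) wu wn.
move: h3; rewrite !sol// -!/(l _) => h3.
have e3 : wmod leb2 p (c_ n) (D (u_ n)) = 2 * l (u_ n).
  have := sol n _ wu; rewrite -/(l _) (La_pairingE s p1) (sp_pairing_self s p1) => <-.
  by field.
move: hn; rewrite (energy_Wsp0 p1 lam0 (ka_ n))// lte_fin => hn.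
move: h3; rewrite e3 => h3.
(* The tangent inequality at u_n divided by 2 p, the energy of u_n being 2 l(u_n). *)
have h4 : p^-1 * l (u_ n) + (l (ze (v_ n)) - l (u_ n)) <= (2 * p)^-1 *
    wmod leb2 p (c_ n) (D (ze (v_ n))).
  rewrite [_^-1 * wmod _ _ _ _]mulrC ler_pdivlMr ?mulr_gt0//; apply: le_trans h3.
  rewrite le_eqVlt; apply/orP; left; apply/eqP; field.
  by rewrite gt_eqF.
have h5 : (1 - p^-1) * (l (u_ n) - l (ze v)) <= del / 4.
  move: h2; rewrite /= distrC => h2.
  apply: le_trans (ler_norm _) _; rewrite normrM gtr0_norm//.
  apply: le_trans h2; rewrite ler_piMl// lerBlDr lerDl invr_ge0 ltW//.
(* With q = 1/p: X >= C - (1 - q) A > B - d/2 - (1 - q) B - d/4 = q B - 3 d/4 = c + d/4, against X <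
   c. *)
have alg (q A B C X d : R) : B - d / 2 < C -> q * A + (C - A) <= X ->
    (1 - q) * (A - B) <= d / 4 -> X < c -> d = q * B - c -> 0 < d -> False.
  rewrite !mulrBr mulrBl mul1r mulrBl mul1r; move: (q * A) (q * B) => qA qB; lra.
exact: (alg _ _ _ _ _ _ h1 h4 h5 hn (erefl _) del0).
Qed.

End H_to_Gamma.

Theorem theorem5p4 (R : realType) (N : nat) (s p p' lam Lam : R)
    (Omega : set 'rV[R]_N)
    (a_ : nat -> 'rV[R]_N * 'rV[R]_N -> R)
    (a0 : 'rV[R]_N * 'rV[R]_N -> R) :
  (1 <= N)%N ->
  0 < s -> s < 1 -> 1 < p -> p^-1 + p'^-1 = 1 ->
  open Omega -> (lebN R N Omega < +oo)%E ->
  0 < lam -> lam <= Lam ->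
  (forall n, kernel_class lam Lam (a_ n)) ->
  kernel_class lam (Lam `^ p' / lam) a0 ->
  H_cvg s p Omega p' a_ a0 ->
  Gamma_cvg (LpOmega p Omega) (LpOmega_dist p Omega)
    (fun n => energy s p Omega (a_ n)) (energy s p Omega a0).
Proof.
move=> N0 s0 _ p1 _ oO fO lam0 _ ka_ ka0 Ha; split=> v lv.
  by move=> v_; exact: (gamma_liminf N0 s0 p1 oO fO lam0 ka_ ka0 Ha lv).
exact: (gamma_limsup N0 s0 p1 oO fO lam0 ka_ ka0 Ha lv).
Qed.
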